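(* Let $v_\bullet$ satisfy (V1)-(V3) and let $f_\bullet$ satisfy (A1)-(A3) (conditions spelled out in the context). Assume that $f_\bullet$ is of the form $$f_t(\mu)=p_t(\mu)+F_t(\mu)\cdot\mu,\qquad t\ge 0,\ \mu\in\mathcal{M}(\Omega),$$ with maps $p_\bullet:\mathbb{R}_+\times\mathcal{M}(\Omega)\to\mathcal{M}^+(\Omega)$ and $F_\bullet:\mathbb{R}_+\times\mathcal{M}(\Omega)\to\mathrm{BL}(\Omega)$, such that for every $R>0$ and $T>0$ there exists $C'_{R,T}>0$ with $$\sup_{0\le t\le T}\|F_t(\mu)\|_\infty\le C'_{R,T}\qquad\text{for all }\mu\in\mathcal{M}^+(\Omega)\text{ with }\|\mu\|_{\mathrm{TV}}\le R.$$ Moreover, assume that for some $1<p\le\infty$, $f_t$ maps $L^p(\lambda)$ into itself for all $t\ge0$ (i.e. maps $L^1\cap L^p(\lambda)$, viewed as a subspace of $\mathcal{M}(\Omega)$, into itself) and that for any $t>t'\geq 0$ and $r>0$ there exists $B^f_{t',t}(r)\ge0$ such that $$\|f_s(\phi\,d\lambda)\|_{L^p(\lambda)}\le B^f_{t',t}(r)\quad\text{for all }\phi\in L^1\cap L^p(\lambda)\text{ with }\|\phi\|_{L^p(\lambda)}\le r,\ t'\le s\le t.$$ Let $t_0\ge0$ and let $\nu=\phi\,d\lambda\in\mathcal{M}^+(\Omega)$ be an initial condition at time $t_0$ with $\phi\in L^p_+(\lambda)$. Let $\mu_\bullet$ be the maximal mild solution to Problem (P) in $\mathcal{M}(\Omega)$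 with $\mu_{t_0}=\nu$, with maximal interval of existence $[t_0,T^*_\nu)$. Then there exists $\hat T^*_\nu$ with $t_0<\hat T^*_\nu\le T^*_\nu$ such that: (i) $\mu_t\in L^p_+(\lambda)$ for all $t\in[t_0,\hat T^*_\nu)$. (ii) For every $T\in(t_0,\hat T^*_\nu)$, $\sup_{t_0\le t\le T}\|\mu_t\|_{L^p(\lambda)}<\infty$. (iii) If $\hat T^*_\nu<T^*_\nu$, then $\limsup_{t\to\hat T^*_\nu}\|\mu_t\|_{L^p(\lambda)}=+\infty$, where the limsup is taken over $t<\hat T^*_\nu$.
   Context: $\Omega$ is either $\mathbb{R}^d$ or the torus $\mathbb{T}^d=\mathbb{R}^d/\mathbb{Z}^d$ with the Euclidean-based metric; $\lambda$ is Borel-Lebesgue measure on $\Omega$. $\mathcal{M}(\Omega)$: finite signed Borel (Radon) measures on $\Omega$; $\mathcal{M}^+(\Omega)$: the positive ones. For a Lipschitz function $g$, $|g|_L$ is its Lipschitz constant. $\mathrm{BL}(\Omega)$: bounded Lipschitz real functions, with norm $\|g\|_{\mathrm{FM}}=\max(\|g\|_\infty,|g|_L)$; $\mathrm{BL}(\Omega,\mathbb{R}^d)$ is defined analogously. $\|\mu\|_{\mathrm{FM}}^*=\sup\{\int g\,d\mu: g\in\mathrm{BL}(\Omega),\|g\|_\infty\le1,|g|_L\le1\}$; $\|\mu\|_{\mathrm{TV}}=|\mu|(\Omega)$; $\mathcal{M}_R(\Omega)=\{\mu\in\mathcal{M}(\Omega):\|\mu\|_{\mathrm{TV}}\le R\}$.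 $\mathcal{M}(\Omega)_{\mathrm{FM}}$ is $\mathcal{M}(\Omega)$ with norm $\|\cdot\|_{\mathrm{FM}}^*$, and $\overline{\mathcal{M}}(\Omega)_{\mathrm{FM}}$ its completion. $g\cdot\mu$ is the measure with density $g$ with respect to $\mu$. Functions $\phi\in L^1\cap L^p(\lambda)$ are identified with the measures $\phi\,d\lambda\in\mathcal{M}(\Omega)$. $L^p_+(\lambda)=\{\phi\in L^1\cap L^p(\Omega,\lambda):\phi\ge0\ \lambda\text{-a.e.}\}$. For a measure $\mu$, $\|\mu\|_{L^p(\lambda)}$ is the $L^p$-norm of its density with respect to $\lambda$, and is $+\infty$ if $\mu$ is not absolutely continuous with respect to $\lambda$ or if its density is not in $L^p$. Velocity field $v_t:\Omega\to\mathbb{R}^d$, $t\ge0$: (V1) $(t,x)\mapsto v_t(x)$ is continuous; (V2) $x\mapsto v_t(x)$ is bounded and globally Lipschitz for each $t\ge0$; (V3) $t\mapsto v_t:\mathbb{R}_+\to\mathrm{BL}(\Omega,\mathbb{R}^d)$ is continuous. For $0\le s\le t$, $\Phi^v_{s,t}:\Omega\to\Omega$ is the flow map: $t\mapsto\Phi^v_{s,t}(x_0)$ is the unique global solution of $\dot x(t)=v_t(x(t))$, $t>s$, $x(s)=x_0$. $P^v_{s,t}\mu:=(\Phi^v_{s,t})_\#\mu$ (push-forward). Reaction map $f:(t,\mu)\mapsto f_t(\mu)\in\mathcal{M}(\Omega)$: (A1) $f:\mathbb{R}_+\times\mathcal{M}(\Omega)_{\mathrm{FM}}\to\mathcal{M}(\Omega)_{\mathrm{FM}}$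 is jointly continuous; (A2) for every $T\ge0$ and $R>0$ there exists $L>0$ such that $\|f_t(\mu_1)-f_t(\mu_2)\|_{\mathrm{FM}}^*\le L\|\mu_1-\mu_2\|_{\mathrm{FM}}^*$ for all $\mu_1,\mu_2\in\mathcal{M}_R(\Omega)$ and $t\in[0,T]$; (A3) for every $R>0$ there exists $C^f_R>0$ such that $\|f_t(\mu)\|_{\mathrm{TV}}\le C^f_R$ for all $\mu\in\mathcal{M}_R(\Omega)$, $t\ge0$. Problem (P): $\partial_t\mu_t+\mathrm{div}_x(v_t(x)\mu_t)=f_t(\mu_t)$ with $\mu_{t_0}=\nu$. A mild solution on $[t_0,T]$ is a continuous map $\mu_\bullet:[t_0,T]\to\mathcal{M}(\Omega)_{\mathrm{FM}}$ with $\sup_{t\in[t_0,T]}\|\mu_t\|_{\mathrm{TV}}<\infty$ and $\mu_t=P^v_{t_0,t}\nu+\int_{t_0}^tP^v_{s,t}[f_s(\mu_s)]\,ds$ for $t\in[t_0,T]$ (Bochner integral in $\overline{\mathcal{M}}(\Omega)_{\mathrm{FM}}$). Under (V1)-(V3), (A1)-(A3) there is, for each $\nu\in\mathcal{M}(\Omega)$ and $t_0\ge 0$, a unique maximal mild solution on a maximal interval of existence $[t_0,T^*_\nu)$, $T^*_\nu\in(t_0,\infty]$: its restriction to each $[t_0,T]$, $T<T^*_\nu$, is a mild solution, and it cannot be extended further. *)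

(* Defs.v *)
From HB Require Import structures.
From mathcomp Require Import all_boot all_order all_algebra generic_quotient.
From mathcomp Require Import all_classical all_reals all_analysis.
Import Order.TTheory GRing.Theory Num.Theory.
Import numFieldNormedType.Exports.

Set Implicit Arguments.
Unset Strict Implicit.
Unset Printing Implicit Defensive.

Local Open Scope classical_set_scope.
Local Open Scope ring_scope.

Section torus.
Context (R : realType) (d : nat).

Definition lattice_eqv (x y : 'rV[R]_d) : bool :=
  [forall i, (x - y) 0 i \is a Num.int].

Lemma lattice_eqv_refl : reflexive lattice_eqv.
Proof. by move=> x; apply/forallP => i; rewrite subrr mxE rpred0. Qed.

Lemma lattice_eqv_sym : symmetric lattice_eqv.
Proof.
by move=> x y; apply: eq_forallb => i; rewrite -opprB mxE rpredN.
Qed.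

Lemma lattice_eqv_trans : transitive lattice_eqv.
Proof.
move=> y x z /forallP xy /forallP yz; apply/forallP => i.
have -> : x - z = (x - y) + (y - z) by rewrite addrA subrK.
by rewrite mxE rpredD.
Qed.

Canonical lattice_equiv :=
  EquivRel lattice_eqv lattice_eqv_refl lattice_eqv_sym lattice_eqv_trans.

Definition torus := quotient_topology {eq_quot lattice_equiv}%qT.

HB.instance Definition _ := PointedTopological.on torus.

End torus.

Inductive domain := Euclidean | Torus.

Definition phase_space (R : realType) (d : nat) (k : domain) : ptopologicalType :=
  match k with
  | Euclidean => 'rV[R]_d
  | Torus => torus R d
  end.

(* The identity map of R^d, resp. the projection R^d -> R^d/Z^d. *)
Definition cover_map (R : realType) (d : nat) (k : domain) :
    'rV[R]_d -> phase_space R d k :=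
  match k with
  | Euclidean => fun x => x
  | Torus => fun x => (\pi_(torus R d) x)%qT
  end.

(* The norm of 'rV[R]_d provided by the library is the sup norm. *)
Definition enorm (R : realType) (d : nat) (x : 'rV[R]_d) : R :=
  Num.sqrt (\sum_i x 0 i ^+ 2).

Notation borel R d k := (g_sigma_algebraType (@open (phase_space R d k))).

(* A charge is a function on all subsets, whose values on non-measurable sets
   are meaningless: two charges are the same measure when they are related by
   charge_eq below. *)
Definition signed_measure (R : realType) (d : nat) (k : domain) :=
  charge (borel R d k) R.

Section setting.
Context (R : realType) (d : nat) (k : domain).

Local Notation Omega := (phase_space R d k).
Local Notation B := (borel R d k).
Local Notation pi := (@cover_map R d k).

(* On R^d this is the Euclidean distance, on the torus the distance between
   cosets. *)
Definition dist (a b : Omega) : R :=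
  inf [set enorm (z.1 - z.2) | z in [set z | pi z.1 = a /\ pi z.2 = b]].

Definition box (a b : 'rV[R]_d) : set 'rV[R]_d :=
  [set x | forall i, a 0 i <= x 0 i < b 0 i].

(* Boxes, resp. the images of the boxes that embed in the torus, have their
   elementary volume; this determines the measure on Borel sets. *)
Definition is_lebesgue (lam : set B -> \bar R) : Prop :=
  forall a b : 'rV[R]_d, (forall i, a 0 i <= b 0 i) ->
    set_inj (box a b) pi ->
    lam (pi @` box a b) = (\prod_i (b 0 i - a 0 i))%:E.

(* N is the norm of the target space. *)
Section bounded_lipschitz.
Context (V : zmodType) (N : V -> R).
Implicit Type g : Omega -> V.

Definition supnorm g : \bar R := ereal_sup [set (N (g x))%:E | x in setT].

(* The diagonal contributes 0, since 0 / 0 = 0. *)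
Definition lipconst g : \bar R :=
  ereal_sup [set (N (g z.1 - g z.2) / dist z.1 z.2)%:E
            | z in [set: Omega * Omega]].

Definition BLnorm g : \bar R := maxe (supnorm g) (lipconst g).

Definition BL g : Prop := (BLnorm g < +oo)%E.

End bounded_lipschitz.

Local Notation M := (signed_measure R d k).

Definition charge_eq (mu nu : M) : Prop :=
  forall A, measurable A -> mu A = nu A.

Definition charge_pos (mu : M) : Prop :=
  forall A, measurable A -> (0 <= mu A)%E.

Definition csub (mu nu : M) : M := cadd mu (copp nu).

Definition hahn_pos (mu : M) : set B :=
  sval (cid (Hahn_decomposition mu)).

Definition hahn_neg (mu : M) : set B :=
  sval (cid (svalP (cid (Hahn_decomposition mu)))).

Definition hahnP (mu : M) : hahn_decomposition mu (hahn_pos mu) (hahn_neg mu) :=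
  svalP (cid (svalP (cid (Hahn_decomposition mu)))).

Definition cintegral (mu : M) (A : set B) (g : Omega -> R) : R :=
  \int[jordan_pos (hahnP mu)]_(x in A) g x -
  \int[jordan_neg (hahnP mu)]_(x in A) g x.

Definition TVnorm (mu : M) : R := fine (charge_variation (hahnP mu) setT).

Definition FMnorm (mu : M) : R :=
  sup [set cintegral mu setT g | g in
    [set g | (supnorm Num.norm g <= 1)%E /\ (lipconst Num.norm g <= 1)%E]].

(* Non-measurable maps, which do not occur among flow maps, are sent to 0. *)
Definition cpush (h : Omega -> Omega) (mu : M) : M :=
  match pselect (measurable_fun [set: B] (h : B -> B)) with
  | left mh => measure_function_pushforward__canonical__charge_Charge mu mh
  | right _ => czero
  end.

(* Completions of M(Omega)_FM: a Banach space E with a dense linear isometric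
   embedding. *)
Definition is_FM_completion (E : completeNormedModType R) (iota : M -> E) :
    Prop :=
  [/\ forall mu nu : M, iota (cadd mu nu) = iota mu + iota nu,
      forall (c : R) (mu : M), iota (cscale c mu) = c *: iota mu,
      forall mu : M, `|iota mu| = FMnorm mu &
      dense (range iota)].

Definition V1 (v : R -> Omega -> 'rV[R]_d) : Prop :=
  {within [set z : R * Omega | 0 <= z.1],
    continuous (fun z : R * Omega => v z.1 z.2)}.

Definition V2 (v : R -> Omega -> 'rV[R]_d) : Prop :=
  forall t : R, 0 <= t -> BL (@enorm R d) (v t).

Definition V3 (v : R -> Omega -> 'rV[R]_d) : Prop :=
  forall t : R, 0 <= t -> forall e : R, 0 < e -> exists2 delta : R, 0 < delta &
    forall s : R, 0 <= s -> `|s - t| < delta ->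
      (BLnorm (@enorm R d) (fun x => v s x - v t x)%R < e%:E)%E.

(* Curves on the torus are differentiated through a lift to R^d; on R^d the
   lift y is the curve itself. *)
Definition is_flow (v : R -> Omega -> 'rV[R]_d)
    (Phi : R -> R -> Omega -> Omega) : Prop :=
  forall s : R, 0 <= s -> forall x0 : Omega, exists y : R -> 'rV[R]_d,
    [/\ pi (y s) = x0,
        {within `[s, +oo[, continuous y},
        forall t : R, s < t -> is_derive t (1 : R) y (v t (pi (y t))) &
        forall t : R, s <= t -> Phi s t x0 = pi (y t)].

Definition A1 (f : R -> M -> M) : Prop :=
  forall (t : R) (mu : M), 0 <= t -> forall e : R, 0 < e ->
  exists2 delta : R, 0 < delta &
    forall (s : R) (nu : M), 0 <= s ->
      `|s - t| < delta -> FMnorm (csub nu mu) < delta ->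
      FMnorm (csub (f s nu) (f t mu)) < e.

Definition A2 (f : R -> M -> M) : Prop :=
  forall T r : R, 0 <= T -> 0 < r -> exists2 L : R, 0 < L &
    forall (mu1 mu2 : M) (t : R),
      TVnorm mu1 <= r -> TVnorm mu2 <= r -> 0 <= t <= T ->
      FMnorm (csub (f t mu1) (f t mu2)) <= L * FMnorm (csub mu1 mu2).

Definition A3 (f : R -> M -> M) : Prop :=
  forall r : R, 0 < r -> exists2 C : R, 0 < C &
    forall (mu : M) (t : R), TVnorm mu <= r -> 0 <= t -> TVnorm (f t mu) <= C.

Section bochner.
Context (E : normedModType R).

Record step := Step {
  step_size : nat ;
  step_set : 'I_step_size -> set (measurableTypeR R) ;
  step_val : 'I_step_size -> E }.

Definition step_eval (S : step) (x : R) : E :=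
  \sum_(i < step_size S) \1_(step_set i) x *: step_val i.

Definition step_on (D : set R) (S : step) : Prop :=
  forall i : 'I_(step_size S),
    measurable (step_set i) /\ step_set i `<=` D.

Definition step_integral (S : step) : E :=
  \sum_(i < step_size S) fine (lebesgue_measure (step_set i)) *: step_val i.

(* D is intended to have finite measure. *)
Definition is_bochner_integral (D : set R) (g : R -> E) (I : E) : Prop :=
  exists S : nat -> step,
    [/\ forall n, step_on D (S n),
        {ae (@lebesgue_measure R), forall x, D x ->
          step_eval (S n) x @[n --> \oo] --> g x},
        (\int[@lebesgue_measure R]_(x in D) (`|g x - step_eval (S n) x|%R)%:E)%E
          @[n --> \oo] --> 0%E &
        step_integral (S n) @[n --> \oo] --> I].

End bochner.

Section mild_solutions.
Context (E : completeNormedModType R) (iota : M -> E).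
Context (Phi : R -> R -> Omega -> Omega) (f : R -> M -> M).

Definition mild_solution (t0 T : R) (nu : M) (mu : R -> M) : Prop :=
  [/\ forall t : R, t0 <= t <= T -> forall e : R, 0 < e ->
        exists2 delta : R, 0 < delta &
        forall s : R, t0 <= s <= T -> `|s - t| < delta ->
          FMnorm (csub (mu s) (mu t)) < e,
      exists C : R, forall t : R, t0 <= t <= T -> TVnorm (mu t) <= C &
      forall t : R, t0 <= t <= T -> exists2 I : E,
        is_bochner_integral `[t0, t]
          (fun s => iota (cpush (Phi s t) (f s (mu s)))) I &
        iota (mu t) = iota (cpush (Phi t0 t) nu) + I].

(* Only the restriction of mu to [t0, Ts) matters.  An extension to any larger
   interval would restrict to a mild solution on a compact interval [t0, T]
   with Ts <= T. *)
Definition maximal_mild_solution (t0 : R) (nu : M) (Ts : \bar R)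
    (mu : R -> M) : Prop :=
  [/\ (t0%:E < Ts)%E,
      forall T : R, t0 <= T -> (T%:E < Ts)%E -> mild_solution t0 T nu mu &
      forall (T : R) (mu' : R -> M), (Ts <= T%:E)%E -> mild_solution t0 T nu mu' ->
        ~ (forall t : R, t0 <= t -> (t%:E < Ts)%E -> charge_eq (mu' t) (mu t))].

End mild_solutions.

Section Lp.
Context (lam : {sigma_finite_measure set B -> \bar R}) (p : \bar R).

Definition Lpnorm (mu : M) : \bar R :=
  if `[< mu `<< lam >] then Lnorm lam p (Radon_Nikodym mu lam) else +oo%E.

(* The density of a finite measure is always in L^1. *)
Definition Lp (mu : M) : Prop := (Lpnorm mu < +oo)%E.

Definition Lp_pos (mu : M) : Prop :=
  Lp mu /\ {ae lam, forall x, (0 <= Radon_Nikodym mu lam x)%E}.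

End Lp.

End setting.

(* Main.v *)
Require Import Defs.
From mathcomp Require Import all_boot all_order all_algebra.
From mathcomp Require Import all_classical all_reals all_analysis.
From mathcomp Require Import measurable_realfun ess_sup_inf.
From mathcomp Require Import ring lra.
Import Order.TTheory GRing.Theory Num.Theory.
Import numFieldNormedType.Exports.
Set Implicit Arguments.
Unset Strict Implicit.
Unset Printing Implicit Defensive.
Local Open Scope classical_set_scope.
Local Open Scope ring_scope.

(** The solution is a limit of explicit Euler iterates
      X_(j+1) = P_(s_j, s_(j+1)) (X_j + h f_(s_j) (X_j)),
    where P_(s, t) is the push-forward by the flow, and both positivity and L^p
    bounds are visible on the iterates.

    Positivity.  The loss part of h f(X_j) is at least - h C X_j, where C bounds
    |F| on measures of a given mass, so X_j + h f(X_j) is positive as soon as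
    h C <= 1 (reaction_step_pos).  The mass of a positive measure is controlled by
    the flat norm (TVnorm_le_FM), which keeps the iterates in the range where the
    constants are valid.

    Convergence (euler_close).  A Bochner integral is compared with Riemann sums
    (bochner_partition), and the Duhamel formula of the mild solution is restarted
    at an arbitrary time t1 (restart).  A discrete Gronwall argument then shows
    that the iterates started at mu_(t1) stay close to mu in the flat norm.
    Positivity is preserved by flat limits (charge_pos_closed), hence mu_t >= 0.

    L^p bounds.  That the density of m has L^p norm at most K is expressed through
    duality: |int g dm| <= K |g|_q for all bounded g >= 0 (dual_ball), where q is
    the conjugate exponent.  Such bounds add up along the Duhamel formula, are
    stable under limits in the flat norm because q is finite (dual_ball_closed),
    and are equivalent to the original ones for positive measures
    (hoelder_dual_ball, dual_ball_Lpnorm).  They are multiplied by a constant under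
    the flow: by Gronwall's lemma the flow contracts distances by at most a
    constant factor, so preimages of small cells lie in comparable cells and the
    Lebesgue measure of a preimage is at most a constant times that of the set
    (flow_expansive, lebesgue_preimage_le).

    Consequently (local_Lp_bound), if the norm of mu_(t1) is at most r, then the
    norm of mu_t is bounded for t in [t1, t1 + delta], with delta depending on r
    but not on t1.  The time That is the supremum of the times up to which the L^p
    norm of mu remains bounded: delta > 0 at t1 = t0 gives t0 < That, and if the
    norm did not blow up at That < Tstar, a restart shortly before That would
    bound it beyond That.

    The Euclidean space and the torus are treated at once, as quotients of R^d by
    a discrete group of translations. *)

(** * Integration against signed measures *)

Section integration_against_charges.
Context (R : realType) (d : nat) (k : domain).
Local Notation Omega := (phase_space R d k).
Local Notation B := (borel R d k).
Local Notation M := (signed_measure R d k).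
Implicit Types (mu nu : M) (g : B -> R).

Definition bounded_measurable g :=
  measurable_fun [set: B] g /\ exists c, forall x, `|g x| <= c.

Lemma sube_eq_adde (a b c e : \bar R) :
  a \is a fin_num -> b \is a fin_num -> c \is a fin_num -> e \is a fin_num ->
  (a - b = c - e -> a + e = b + c)%E.
Proof.
move: a b c e => [a| |] [b| |] [c| |] [e| |]//= _ _ _ _.
by rewrite -!EFinB -!EFinD => -[] ?; congr EFin; lra.
Qed.

Lemma bounded_measurable_integrable (m : {measure set B -> \bar R}) A g :
  (m setT < +oo)%E -> measurable A -> bounded_measurable g ->
  m.-integrable A (EFin \o g).
Proof.
move=> mT mA [mg [c gc]]; apply: measurable_bounded_integrable => //.
- by rewrite (@le_lt_trans _ _ (m setT))// le_measure ?inE.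
- exact: measurable_funTS.
- exists c; split; first by rewrite num_real.
  by move=> y cy x _; rewrite /= (le_trans (gc x)) ?ltW.
Qed.

Lemma finite_measure_lty (m : {finite_measure set B -> \bar R}) :
  (m setT < +oo)%E.
Proof. by rewrite fin_num_fun_lty// => X mX; exact: fin_num_measure. Qed.

Lemma measure_add_lty (m1 m2 : {measure set B -> \bar R}) :
  (m1 setT < +oo)%E -> (m2 setT < +oo)%E -> (measure_add m1 m2 setT < +oo)%E.
Proof. by move=> ? ?; rewrite measure_addE lte_add_pinfty. Qed.

Lemma lty_fin_num (m : {measure set B -> \bar R}) X :
  (m setT < +oo)%E -> measurable X -> m X \is a fin_num.
Proof.
move=> mT mX; rewrite ge0_fin_numE//.
by rewrite (le_lt_trans _ mT)// le_measure ?inE.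
Qed.

Lemma bounded_measurable_EFin A g :
  bounded_measurable g -> measurable_fun A (fun x => (g x)%:E).
Proof. by move=> [mg _]; apply: measurable_funTS; exact/measurable_EFinP. Qed.

Lemma Rintegral_measure_add (m1 m2 : {measure set B -> \bar R}) A g :
  (m1 setT < +oo)%E -> (m2 setT < +oo)%E ->
  measurable A -> bounded_measurable g ->
  (\int[measure_add m1 m2]_(x in A) g x =
   \int[m1]_(x in A) g x + \int[m2]_(x in A) g x)%R.
Proof.
move=> m1T m2T mA bg; have i1 := bounded_measurable_integrable m1T mA bg.
have i2 := bounded_measurable_integrable m2T mA bg.
rewrite /Rintegral (integral_measure_add mA i1 i2).
by rewrite fineD//; exact: integrable_fin_num.
Qed.

Lemma Rintegral_mscale (c : {nonneg R}) (m : {measure set B -> \bar R}) A g :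
  (m setT < +oo)%E -> measurable A -> bounded_measurable g ->
  (\int[mscale c m]_(x in A) g x = c%:num * \int[m]_(x in A) g x)%R.
Proof.
move=> mT mA bg; have i1 := bounded_measurable_integrable mT mA bg.
have mg := @bounded_measurable_EFin A g bg.
rewrite /Rintegral integralE [X in _ = _ * fine X]integralE.
rewrite !ge0_integral_mscale//; last 2 first.
- exact: measurable_funeneg.
- exact: measurable_funepos.
have fp := integrable_pos_fin_num mA i1; have fn := integrable_neg_fin_num mA i1.
rewrite -muleBr//; last by rewrite fin_num_adde_defr.
by rewrite fineM// fin_numB fp fn.
Qed.

Lemma jordan_sub mu A : measurable A ->
  mu A = (jordan_pos (hahnP mu) A - jordan_neg (hahnP mu) A)%E.
Proof. by move=> mA; rewrite (jordan_decomp (hahnP mu) mA) /cadd/= cscaleN1. Qed.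

Lemma caddE mu nu X : (cadd mu nu : M) X = (mu X + nu X)%E.
Proof. by []. Qed.

Lemma coppE mu X : (copp mu : M) X = (- mu X)%E.
Proof. by []. Qed.

Lemma cscaleE c mu X : (cscale c mu : M) X = (c%:E * mu X)%E.
Proof. by []. Qed.

(** The Jordan decomposition is not additive in the charge, but the integral
    may be computed from any pair of finite measures of which the charge is the
    difference; linearity and the change of variables follow from this. *)
Lemma cintegral_diff mu (m1 m2 : {measure set B -> \bar R}) A g :
  (m1 setT < +oo)%E -> (m2 setT < +oo)%E ->
  (forall X, measurable X -> mu X = (m1 X - m2 X)%E) ->
  measurable A -> bounded_measurable g ->
  cintegral mu A g = \int[m1]_(x in A) g x - \int[m2]_(x in A) g x.
Proof.
move=> m1T m2T mum mA bg; rewrite /cintegral.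
have jpT := finite_measure_lty (jordan_pos (hahnP mu)).
have jnT := finite_measure_lty (jordan_neg (hahnP mu)).
set jp := jordan_pos _ in jpT *; set jn := jordan_neg _ in jnT *.
have E : \int[measure_add jp m2]_(x in A) g x =
         \int[measure_add jn m1]_(x in A) g x.
  congr fine; apply: eq_measure_integral => X mX _.
  rewrite [LHS]measure_addE [RHS]measure_addE.
  apply: sube_eq_adde; rewrite ?lty_fin_num// -mum// jordan_sub//.
by move: E; rewrite !Rintegral_measure_add//; lra.
Qed.

Lemma cintegral_eq mu nu A g : measurable A -> bounded_measurable g ->
  charge_eq mu nu -> cintegral mu A g = cintegral nu A g.
Proof.
move=> mA bg mn; apply: cintegral_diff => //; try exact: finite_measure_lty.
by move=> X mX; rewrite mn// jordan_sub.
Qed.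

Lemma cintegral_add mu nu A g : measurable A -> bounded_measurable g ->
  cintegral (cadd mu nu) A g = cintegral mu A g + cintegral nu A g.
Proof.
move=> mA bg.
rewrite (@cintegral_diff _
  (measure_add (jordan_pos (hahnP mu)) (jordan_pos (hahnP nu)))
  (measure_add (jordan_neg (hahnP mu)) (jordan_neg (hahnP nu)))) //;
  try (apply: measure_add_lty; exact: finite_measure_lty).
  rewrite !Rintegral_measure_add//; try exact: finite_measure_lty.
  by rewrite /cintegral; lra.
move=> X mX; have : (jordan_neg (hahnP mu)) X \is a fin_num.
  exact: fin_num_measure.
rewrite [X in _ = (X - _)%E]measure_addE [X in _ = (_ - X)%E]measure_addE => fX.
rewrite [LHS]caddE (jordan_sub mu mX) (jordan_sub nu mX).
by rewrite oppeD ?fin_num_adde_defr// addeACA.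
Qed.

Lemma cintegral_opp mu A g : measurable A -> bounded_measurable g ->
  cintegral (copp mu) A g = - cintegral mu A g.
Proof.
move=> mA bg.
rewrite (@cintegral_diff _ (jordan_neg (hahnP mu)) (jordan_pos (hahnP mu))) //;
  try exact: finite_measure_lty.
  by rewrite /cintegral opprB.
move=> X mX; have fX : (jordan_neg (hahnP mu)) X \is a fin_num.
  exact: fin_num_measure.
rewrite [LHS]coppE (jordan_sub mu mX).
by rewrite oppeB ?fin_num_adde_defl ?fin_numN// addeC.
Qed.

Lemma cintegral_sub mu nu A g : measurable A -> bounded_measurable g ->
  cintegral (csub mu nu) A g = cintegral mu A g - cintegral nu A g.
Proof. by move=> mA bg; rewrite cintegral_add// cintegral_opp. Qed.

Lemma cintegral_scale c mu A g : 0 <= c -> measurable A -> bounded_measurable g ->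
  cintegral (cscale c mu) A g = c * cintegral mu A g.
Proof.
move=> c0 mA bg.
rewrite (@cintegral_diff _ (mscale (NngNum c0) (jordan_pos (hahnP mu)))
  (mscale (NngNum c0) (jordan_neg (hahnP mu)))) //.
- rewrite !Rintegral_mscale//; try exact: finite_measure_lty.
  by rewrite /cintegral mulrBr.
- by rewrite /mscale lte_mul_pinfty//; exact: finite_measure_lty.
- by rewrite /mscale lte_mul_pinfty//; exact: finite_measure_lty.
move=> X mX; have fX : (jordan_neg (hahnP mu)) X \is a fin_num.
  exact: fin_num_measure.
rewrite [LHS]cscaleE /mscale /= (jordan_sub mu mX) muleBr//.
by rewrite fin_num_adde_defl ?fin_numN.
Qed.

Lemma cpushE (h : Omega -> Omega) mu :
  measurable_fun [set: B] (h : B -> B) ->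
  forall X, cpush h mu X = mu (h @^-1` X).
Proof. by move=> mh X; rewrite /cpush; case: pselect. Qed.

Lemma bounded_measurable_comp g (h : Omega -> Omega) :
  measurable_fun [set: B] (h : B -> B) -> bounded_measurable g ->
  bounded_measurable (g \o h).
Proof.
move=> mh [mg [c gc]]; split; first exact: (measurableT_comp mg mh).
by exists c => x; exact: gc.
Qed.

Lemma cintegral_push (h : Omega -> Omega) mu g :
  measurable_fun [set: B] (h : B -> B) -> bounded_measurable g ->
  cintegral (cpush h mu) setT g = cintegral mu setT (g \o h).
Proof.
move=> mh bg; have bgh := bounded_measurable_comp mh bg.
pose P := measure_function_pushforward__canonical__measure_function_Measure.
have PT (m : {finite_measure set B -> \bar R}) : (P _ _ _ _ _ m _ mh setT < +oo)%E.
  exact: (finite_measure_lty m).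
have PI (m : {finite_measure set B -> \bar R}) :
    \int[P _ _ _ _ _ m _ mh]_x g x = \int[m]_x (g \o h) x.
  rewrite /Rintegral integral_pushforward//; first exact: bounded_measurable_EFin.
  exact: (bounded_measurable_integrable (finite_measure_lty m) measurableT bgh).
rewrite (@cintegral_diff _ (P _ _ _ _ _ (jordan_pos (hahnP mu)) _ mh)
  (P _ _ _ _ _ (jordan_neg (hahnP mu)) _ mh)) ?PI//;
  [exact: PT|exact: PT|].
move=> X mX; rewrite cpushE// jordan_sub//.
by rewrite -[X in measurable X]setTI; apply: (mh).
Qed.

(** ** Monotonicity and norms *)

Lemma cintegral_cst mu A c : measurable A ->
  cintegral mu A (fun=> c) = c * fine (mu A).
Proof.
move=> mA; rewrite /cintegral !Rintegral_cst// jordan_sub// fineB ?fin_num_measure//.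
by rewrite mulrBr.
Qed.

Lemma cintegral_indic mu (A : set B) : measurable A ->
  cintegral mu setT (\1_A : B -> R) = fine (mu A).
Proof.
move=> mA; rewrite /cintegral /Rintegral !integral_indic// !setIT.
by rewrite (jordan_sub mu mA) fineB// fin_num_measure.
Qed.

Lemma bounded_measurable_indic (A : set B) : measurable A ->
  bounded_measurable (\1_A : B -> R).
Proof.
move=> mA; split; first exact: measurable_indic.
by exists 1 => x; rewrite indicE; case: (_ \in _); rewrite ?normr1 ?normr0.
Qed.

Lemma bounded_measurable_add g1 g2 : bounded_measurable g1 ->
  bounded_measurable g2 -> bounded_measurable (fun x => g1 x + g2 x).
Proof.
move=> [m1 [c1 b1]] [m2 [c2 b2]]; split; first exact: measurable_funD.
by exists (c1 + c2) => x; rewrite (le_trans (ler_normD _ _))// lerD.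
Qed.

Lemma bounded_measurable_mul g1 g2 : bounded_measurable g1 ->
  bounded_measurable g2 -> bounded_measurable (fun x => g1 x * g2 x).
Proof.
move=> [m1 [c1 b1]] [m2 [c2 b2]]; split; first exact: measurable_funM.
by exists (c1 * c2) => x; rewrite normrM ler_pM.
Qed.

Lemma bounded_measurable_cst c : bounded_measurable (fun=> c).
Proof. by split; [exact: measurable_cst|exists `|c|]. Qed.

Lemma bounded_measurable_scale c g : bounded_measurable g ->
  bounded_measurable (fun x => c * g x).
Proof. exact/bounded_measurable_mul/bounded_measurable_cst. Qed.

Lemma cintegral_funZ mu A c g : measurable A -> bounded_measurable g ->
  cintegral mu A (fun x => c * g x) = c * cintegral mu A g.
Proof.
move=> mA bg; rewrite /cintegral !RintegralZl//; first by rewrite mulrBr.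
- exact: bounded_measurable_integrable (finite_measure_lty _) _ _.
- exact: bounded_measurable_integrable (finite_measure_lty _) _ _.
Qed.

Lemma cintegral_funD mu A g1 g2 : measurable A -> bounded_measurable g1 ->
  bounded_measurable g2 ->
  cintegral mu A (fun x => g1 x + g2 x) = cintegral mu A g1 + cintegral mu A g2.
Proof.
move=> mA b1 b2; rewrite /cintegral !RintegralD//;
  try exact: bounded_measurable_integrable (finite_measure_lty _) _ _.
by lra.
Qed.

Lemma cintegral_pos mu A g : charge_pos mu ->
  measurable A -> bounded_measurable g ->
  cintegral mu A g = \int[jordan_pos (hahnP mu)]_(x in A) g x.
Proof.
move=> mu0 mA bg; rewrite /cintegral.
suff -> : \int[jordan_neg (hahnP mu)]_(x in A) g x = 0 by rewrite subr0.
have [_ [mN Nneg] _ _] := hahnP mu.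
have jn0 X : measurable X -> jordan_neg (hahnP mu) X = 0%E.
  move=> mX; rewrite jordan_negE cjordan_negE /crestr0 mem_set//= /crestr.
  have mXN := measurableI _ _ mX mN.
  have : mu (X `&` hahn_neg mu) = 0%E by apply/eqP; rewrite eq_le mu0 ?Nneg.
  by move=> ->; rewrite oppe0.
rewrite /Rintegral (@eq_measure_integral _ _ _ _ mzero) ?integral_measure_zero//.
by move=> X mX _; exact: (jn0 X mX).
Qed.

Lemma cintegral_ge0 mu A g : charge_pos mu -> measurable A ->
  bounded_measurable g -> (forall x, A x -> 0 <= g x) -> 0 <= cintegral mu A g.
Proof. by move=> mu0 mA bg g0; rewrite cintegral_pos// Rintegral_ge0. Qed.

Lemma le_cintegral mu A g1 g2 : charge_pos mu -> measurable A ->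
  bounded_measurable g1 -> bounded_measurable g2 ->
  (forall x, A x -> g1 x <= g2 x) -> cintegral mu A g1 <= cintegral mu A g2.
Proof.
move=> mu0 mA b1 b2 g12; rewrite !cintegral_pos//.
apply: le_Rintegral => //;
  exact: bounded_measurable_integrable (finite_measure_lty _) _ _.
Qed.

Lemma TVnormE mu : TVnorm mu =
  fine (jordan_pos (hahnP mu) setT) + fine (jordan_neg (hahnP mu) setT).
Proof. by rewrite /TVnorm /charge_variation fineD// fin_num_measure. Qed.

Lemma TVnorm_ge0 mu : 0 <= TVnorm mu.
Proof. by rewrite TVnormE addr_ge0// fine_ge0. Qed.

Lemma cintegral_le_TV mu g c : measurable_fun [set: B] g ->
  (forall x, `|g x| <= c) -> `|cintegral mu setT g| <= c * TVnorm mu.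
Proof.
move=> mg gc; have bg : bounded_measurable g by split => //; exists c.
have bgn : bounded_measurable (fun x => `|g x|).
  split; first exact: measurableT_comp.
  by exists c => x; rewrite normr_id.
have I (m : {finite_measure set B -> \bar R}) :
    `|\int[m]_(x in setT) g x| <= c * fine (m setT).
  rewrite (le_trans (le_normr_Rintegral _ _))//.
    exact: bounded_measurable_integrable (finite_measure_lty m) _ _.
  rewrite -Rintegral_cst//; apply: le_Rintegral => //.
    exact: bounded_measurable_integrable (finite_measure_lty m) _ _.
  apply: bounded_measurable_integrable (finite_measure_lty m) _ _ => //.
  exact: bounded_measurable_cst.
rewrite TVnormE mulrDr /cintegral (le_trans (ler_normB _ _))// lerD//; exact: I.
Qed.

Lemma TVnorm_pos mu : charge_pos mu -> TVnorm mu = fine (mu setT).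
Proof.
move=> mu0; have := @cintegral_pos mu setT (fun=> 1) mu0 measurableT (bounded_measurable_cst 1).
rewrite cintegral_cst// mul1r => ->; rewrite Rintegral_cst// mul1r TVnormE.
suff -> : jordan_neg (hahnP mu) setT = 0%E by rewrite addr0.
have [_ [mN Nneg] _ _] := hahnP mu.
rewrite jordan_negE cjordan_negE /crestr0 mem_set//= /crestr setTI.
suff -> : mu (hahn_neg mu) = 0%E by rewrite oppe0.
by apply/eqP; rewrite eq_le mu0 ?Nneg.
Qed.

End integration_against_charges.

(** * The phase space as a metric space *)

Section euclidean_norm.
Context (R : realType) (d : nat).
Implicit Types x y : 'rV[R]_d.

Lemma enorm_ge0 x : 0 <= enorm x.
Proof. exact: sqrtr_ge0. Qed.

Lemma enorm_sqr x : enorm x ^+ 2 = \sum_i x 0 i ^+ 2.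
Proof. by rewrite sqr_sqrtr// sumr_ge0// => i _; rewrite sqr_ge0. Qed.

Lemma enorm0 : enorm (0 : 'rV[R]_d) = 0.
Proof.
by rewrite /enorm big1 ?sqrtr0// => i _; rewrite mxE expr0n.
Qed.

Lemma enormN x : enorm (- x) = enorm x.
Proof. by congr Num.sqrt; apply: eq_bigr => i _; rewrite mxE sqrrN. Qed.

Lemma enormB x y : enorm (x - y) = enorm (y - x).
Proof. by rewrite -enormN opprB. Qed.

Lemma coord_le_enorm x i : `|x 0 i| <= enorm x.
Proof.
rewrite -sqrtr_sqr ler_sqrt ?sumr_ge0//; last by move=> j _; rewrite sqr_ge0.
by rewrite (bigD1 i)//= lerDl sumr_ge0// => j _; rewrite sqr_ge0.
Qed.

Lemma enorm_sqr_le x c : 0 <= c -> \sum_i x 0 i ^+ 2 <= c ^+ 2 -> enorm x <= c.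
Proof. by move=> c0 xc; rewrite -(ger0_norm c0) -sqrtr_sqr ler_wsqrtr. Qed.

Lemma cauchy_schwarz x y : \sum_i x 0 i * y 0 i <= enorm x * enorm y.
Proof.
have [x0|x0] := eqVneq (enorm x) 0.
  rewrite x0 mul0r big1// => i _.
  have := coord_le_enorm x i; rewrite x0 normr_le0 => /eqP ->.
  by rewrite mul0r.
have [y0|y0] := eqVneq (enorm y) 0.
  rewrite y0 mulr0 big1// => i _.
  have := coord_le_enorm y i; rewrite y0 normr_le0 => /eqP ->.
  by rewrite mulr0.
have a0 : 0 < enorm x by rewrite lt_neqAle eq_sym x0 enorm_ge0.
have b0 : 0 < enorm y by rewrite lt_neqAle eq_sym y0 enorm_ge0.
set a := enorm x in a0 *; set b := enorm y in b0 *.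
apply: (@le_trans _ _
  (\sum_i ((b / a / 2) * x 0 i ^+ 2 + (a / b / 2) * y 0 i ^+ 2))).
  apply: ler_sum => i _; rewrite -subr_ge0.
  have -> : b / a / 2 * x 0 i ^+ 2 + a / b / 2 * y 0 i ^+ 2 - x 0 i * y 0 i =
    (b * x 0 i - a * y 0 i) ^+ 2 / (2 * a * b).
    by field; rewrite !gt_eqF.
  by rewrite divr_ge0 ?sqr_ge0// !mulr_ge0// ltW.
rewrite big_split/= -!mulr_sumr -!enorm_sqr -/a -/b.
by rewrite le_eqVlt; apply/orP; left; apply/eqP; field; rewrite !gt_eqF.
Qed.

Lemma enormD x y : enorm (x + y) <= enorm x + enorm y.
Proof.
apply: enorm_sqr_le; first by rewrite addr_ge0 ?enorm_ge0.
have -> : \sum_i (x + y) 0 i ^+ 2 =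
    \sum_i x 0 i ^+ 2 + 2 * (\sum_i x 0 i * y 0 i) + \sum_i y 0 i ^+ 2.
  rewrite mulr_sumr -!big_split/=; apply: eq_bigr => i _; rewrite mxE; ring.
by rewrite -!enorm_sqr; have := cauchy_schwarz x y; nra.
Qed.

Lemma enorm_le_sum x : enorm x <= \sum_i `|x 0 i|.
Proof.
apply: enorm_sqr_le; first by rewrite sumr_ge0.
rewrite expr2 mulr_suml ler_sum// => i _.
rewrite -real_normK ?num_real// expr2 ler_wpM2l//.
by rewrite (bigD1 i)//= lerDl sumr_ge0.
Qed.

Lemma enorm_le_coord x c : (forall i, `|x 0 i| <= c) -> enorm x <= d%:R * c.
Proof.
move=> xc; rewrite (le_trans (enorm_le_sum x))//.
rewrite (le_trans (ler_sum _ (fun i _ => xc i)))// sumr_const card_ord.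
by rewrite mulr_natl lexx.
Qed.

(** The topology of 'rV comes from the sup norm, which is equivalent to the
    Euclidean one up to the factor d. *)
Lemma openP_enorm (U : set 'rV[R]_d) :
  open U <-> forall x, U x ->
    exists2 r, 0 < r & forall y, enorm (x - y) < r -> U y.
Proof.
rewrite openE; split => [oU x /oU|oU x /oU [r r0 rU]].
  move=> /nbhs_ballP[e /= e0 eU]; exists e => // y xy; apply: eU.
  split => // i j; rewrite ord1; apply: le_lt_trans xy.
  by have := coord_le_enorm (x - y) j; rewrite !mxE.
apply/nbhs_ballP; exists (r / d.+1%:R) => /=; first by rewrite divr_gt0.
move=> y [_ xy]; apply: rU.
apply: (@le_lt_trans _ _ (d%:R * (r / d.+1%:R))).
  by apply: enorm_le_coord => i; rewrite !mxE ltW//; exact: xy.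
rewrite mulrCA gtr_pMr// ltr_pdivrMr// mul1r ltr_nat//.
Qed.

End euclidean_norm.

Section covering.
Context (R : realType) (d : nat) (k : domain).
Local Notation Omega := (phase_space R d k).
Local Notation pi := (@cover_map R d k).
Implicit Types (a b c : Omega) (x y z : 'rV[R]_d).

(** The deck group of the covering is the d-fold power of this subgroup of R;
    both phase spaces are treated through it. *)
Definition deck : set R :=
  match k with Euclidean => [set 0] | Torus => [set r | r \is a Num.int] end.

Lemma deck0 : deck 0.
Proof. by rewrite /deck; case: k => //=; rewrite rpred0. Qed.

Lemma deckB r s : deck r -> deck s -> deck (r - s).
Proof.
rewrite /deck; case: k => /= [-> ->|]; first by rewrite subr0.
exact: rpredB.
Qed.

Lemma deckN r : deck r -> deck (- r).
Proof. by move=> /(deckB deck0); rewrite sub0r. Qed.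

Lemma deckD r s : deck r -> deck s -> deck (r + s).
Proof. by move=> rd /deckN; rewrite -{2}(opprK s); exact: deckB. Qed.

Lemma deck_lt1 r : deck r -> `|r| < 1 -> r = 0.
Proof.
rewrite /deck; case: k => /= [//|] /intrP[n ->]; rewrite -intr_norm.
by rewrite (_ : 1 = 1%:~R)// ltr_int; case: n => [[|n]|[|n]].
Qed.

(** The deck group is closed and discrete: this is why the distance on the torus
    separates points and why hyperplanes have closed images. *)
Lemma deck_isolated r : ~ deck r ->
  exists2 e, 0 < e & forall s, deck s -> e <= `|s - r|.
Proof.
rewrite /deck; case: k => /= [r0|rI].
  exists `|r|; first by rewrite normr_gt0; apply/eqP.
  by move=> s ->; rewrite sub0r normrN.
have /andP[fr rf] := floor_itv r.
have fr' : (Num.floor r)%:~R < r.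
  by rewrite lt_neqAle fr andbT; apply/eqP => E; apply: rI; rewrite -E intr_int.
exists (Num.min (r - (Num.floor r)%:~R) ((Num.floor r + 1)%:~R - r)).
  by rewrite lt_min !subr_gt0 fr'.
move=> s /intrP[n ->]; have [nr|rn] := leP n (Num.floor r).
  rewrite ge_min; apply/orP; left; rewrite distrC ler_normr; apply/orP; left.
  by rewrite lerB// ler_int.
rewrite ge_min; apply/orP; right; rewrite ler_normr; apply/orP; left.
by rewrite lerB// ler_int -ltzD1 ltrD2r.
Qed.

Lemma cover_eq x y : (pi x = pi y) <-> forall i, deck (x 0 i - y 0 i).
Proof.
rewrite /cover_map /deck /phase_space; case: k.
  split => [-> i /=|xy]; first by rewrite subrr.
  by apply/rowP => i; apply/eqP; rewrite -subr_eq0; apply/eqP; exact: xy.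
split => [/eqmodP /forallP xy i /=|xy].
  by have := xy i; rewrite !mxE.
by apply/eqmodP/forallP => i; rewrite !mxE; exact: xy.
Qed.

Lemma cover_surj a : exists x, pi x = a.
Proof.
move: a; rewrite /cover_map /phase_space; case: k => a; first by exists a.
by exists (repr a); rewrite reprK.
Qed.

Lemma cover_openE (A : set Omega) : open A <-> open (pi @^-1` A).
Proof. by move: A; rewrite /cover_map /phase_space; case: k. Qed.

Lemma cover_shift x y z : pi x = pi y -> pi (z + (x - y)) = pi z.
Proof.
move=> /cover_eq xy; apply/cover_eq => i.
by rewrite mxE [z 0 i + _]addrC addrK !mxE; exact: xy.
Qed.

Let shift_diff x y u : u - (y + (u - x)) = x - y.
Proof. by apply/rowP => i; rewrite !mxE; ring. Qed.

Let shift_diff' x y u : x - (y + (x - u)) = u - y.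
Proof. by apply/rowP => i; rewrite !mxE; ring. Qed.

Lemma open_cover_image (U : set 'rV[R]_d) : open U -> open (pi @` U).
Proof.
move=> /openP_enorm oU; apply/cover_openE/openP_enorm => x [u Uu ux].
have [r r0 rU] := oU _ Uu; exists r => // y xy.
exists (y + (u - x)); last exact: cover_shift.
by apply: rU; rewrite shift_diff.
Qed.

(** ** The distance *)

Definition dists a b := [set enorm (z.1 - z.2) | z in
  [set z : 'rV[R]_d * 'rV[R]_d | pi z.1 = a /\ pi z.2 = b]].

Lemma dists_ge0 a b : lbound (dists a b) 0.
Proof. by move=> _ [z _ <-]; exact: enorm_ge0. Qed.

Lemma has_inf_dists a b : has_inf (dists a b).
Proof.
split; last by exists 0; exact: dists_ge0.
have [x xa] := cover_surj a; have [y yb] := cover_surj b.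
by exists (enorm (x - y)); exists (x, y).
Qed.

Lemma dist_ge0 a b : 0 <= dist a b.
Proof. by apply: lb_le_inf; [case: (has_inf_dists a b)|exact: dists_ge0]. Qed.

Lemma dist_cover x y : dist (pi x) (pi y) <= enorm (x - y).
Proof. by apply: ge_inf; [exists 0; exact: dists_ge0|exists (x, y)]. Qed.

(** Deck translations are isometries, so one of the two lifts in the definition
    of the distance may be prescribed. *)
Lemma dist_lift x b r : dist (pi x) b < r ->
  exists2 y, pi y = b & enorm (x - y) < r.
Proof.
move=> /(inf_lt (has_inf_dists _ _).1) [_ [[x' y'] /= [x'x y'b] <-] xyr].
exists (y' + (x - x')); first by rewrite cover_shift.
by rewrite shift_diff'.
Qed.

Lemma dist_refl a : dist a a = 0.
Proof.
have [x <-] := cover_surj a; apply/eqP; rewrite eq_le dist_ge0 andbT.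
by rewrite (le_trans (dist_cover x x))// subrr enorm0.
Qed.

Lemma dist_sym a b : dist a b = dist b a.
Proof.
suff H (u v : Omega) : dist u v <= dist v u by apply/eqP; rewrite eq_le !H.
apply/ler_addgt0Pr => e e0; have [x <-] := cover_surj v.
have [y <- xy] : exists2 y, pi y = u & enorm (x - y) < dist (pi x) u + e.
  by apply: dist_lift; rewrite ltrDl.
by rewrite (le_trans (dist_cover _ _))// enormB ltW.
Qed.

Lemma dist_triangle b a c : dist a c <= dist a b + dist b c.
Proof.
apply/ler_addgt0Pr => e e0; have [x <-] := cover_surj a.
have [y yb xy] : exists2 y, pi y = b & enorm (x - y) < dist (pi x) b + e / 2.
  by apply: dist_lift; rewrite ltrDl divr_gt0.
subst b.
have [z <- yz] : exists2 z, pi z = c & enorm (y - z) < dist (pi y) c + e / 2.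
  by apply: dist_lift; rewrite ltrDl divr_gt0.
rewrite (le_trans (dist_cover _ _))//.
have -> : x - z = (x - y) + (y - z) by rewrite addrA subrK.
by rewrite (le_trans (enormD _ _))//; lra.
Qed.

Lemma dist_eq0 a b : dist a b = 0 -> a = b.
Proof.
have [x <-] := cover_surj a; have [y <-] := cover_surj b => d0.
apply/cover_eq => i; apply: contrapT => /deck_isolated[e e0 he].
have [z zy xz] : exists2 z, pi z = pi y & enorm (x - z) < e.
  by apply: dist_lift; rewrite d0.
have /cover_eq/(_ i) := zy => /he.
have -> : z 0 i - y 0 i - (x 0 i - y 0 i) = - (x - z) 0 i by rewrite !mxE; ring.
by rewrite normrN leNgt (le_lt_trans (coord_le_enorm _ _)).
Qed.

Lemma openP_dist (A : set Omega) :
  open A <-> forall a, A a -> exists2 r, 0 < r & forall b, dist a b < r -> A b.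
Proof.
rewrite cover_openE openP_enorm; split => oA a Aa.
  have [x xa] := cover_surj a; subst a.
  have [r r0 rA] := oA _ Aa; exists r => // b /dist_lift[y <-]; exact: rA.
have [r r0 rA] := oA _ Aa; exists r => // y xy; apply: rA.
exact: le_lt_trans (dist_cover _ _) xy.
Qed.

Lemma open_ball_dist a r : open [set b | dist a b < r].
Proof.
apply/openP_dist => b /= abr; exists (r - dist a b); first by rewrite subr_gt0.
by move=> c bc; rewrite (le_lt_trans (dist_triangle b _ _))// -ltrBrDl.
Qed.

End covering.

(** * Approximation of Borel sets *)

Lemma dist_max_le (R : realDomainType) (a b s t : R) :
  `|Num.max a b - Num.max s t| <= `|a - s| + `|b - t|.
Proof.
have := ler_norm (a - s); have := ler_norm (s - a).
have := ler_norm (b - t); have := ler_norm (t - b).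
rewrite (distrC s) (distrC t) ler_norml => ? ? ? ?.
by case: (leP a b) => ?; case: (leP s t) => ?; lra.
Qed.

Section approximation_of_sets.
Context (R : realType) (disp : measure_display) (T : measurableType disp).
Context (m : {measure set T -> \bar R}).
Hypothesis mT : (m setT < +oo)%E.
Implicit Types (A : set T) (psi : T -> R).

Lemma measure_vanishing (F : nat -> set T) e : 0 < e ->
  (forall n, measurable (F n)) -> nonincreasing_seq F ->
  \bigcap_n F n = set0 -> exists n, (m (F n) < e%:E)%E.
Proof.
move=> e0 mF dF F0.
have : m \o F @ \oo --> 0%E.
  rewrite -(measure0 m) -F0; apply: nonincreasing_cvg_mu => //.
  - by rewrite (le_lt_trans _ mT)// le_measure ?inE.
  - exact: bigcap_measurable.
have e0' : (0%E < e%:E)%E by rewrite lte_fin.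
move=> cF; have : \forall n \near \oo, (m (F n) < e%:E)%E.
  exact: (cF _ (open_ereal_lt' e0')).
by move=> /filter_ex.
Qed.

Definition indic_gap psi A := (\int[m]_x `|psi x - \1_A x|%:E)%E.

Context (H : set (T -> R)).
Hypothesis Hm : forall psi, H psi -> measurable_fun setT psi.
Hypothesis H0 : H (cst 0).
Hypothesis HC : forall psi, H psi -> H (fun x => 1 - psi x).
Hypothesis HU : forall psi1 psi2, H psi1 -> H psi2 ->
  H (fun x => Num.max (psi1 x) (psi2 x)).

Definition approximable A :=
  forall e : R, 0 < e -> exists2 psi, H psi & (indic_gap psi A <= e%:E)%E.

Let measurable_gap psi A : H psi -> measurable A ->
  measurable_fun setT (fun x => `|psi x - \1_A x|%:E).
Proof.
move=> Hpsi mA; apply/measurable_EFinP; apply: measurableT_comp => //.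
by apply: measurable_funB; [exact: Hm|exact: measurable_indic].
Qed.

Lemma approximable0 : approximable set0.
Proof.
move=> e e0; exists (cst 0) => //; rewrite /indic_gap integral0_eq ?lee_fin ?ltW//.
by move=> x _; rewrite indic0 subr0 normr0.
Qed.

Lemma approximableC A : approximable A -> approximable (~` A).
Proof.
move=> aA e /aA[psi Hpsi gap]; exists (fun x => 1 - psi x); first exact: HC.
apply: le_trans gap; rewrite le_eqVlt; apply/orP; left; apply/eqP.
apply: eq_integral => x _; congr EFin.
rewrite !indicE in_setC; case: (x \in A) => /=.
  by rewrite subr0 distrC.
by rewrite subr0 addrAC subrr sub0r normrN.
Qed.

Lemma approximableU A1 A2 : measurable A1 -> measurable A2 ->
  approximable A1 -> approximable A2 -> approximable (A1 `|` A2).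
Proof.
move=> mA1 mA2 a1 a2 e e0; have e2 : 0 < e / 2 by rewrite divr_gt0.
have [psi1 H1 g1] := a1 _ e2; have [psi2 H2 g2] := a2 _ e2.
exists (fun x => Num.max (psi1 x) (psi2 x)); first exact: HU.
apply: (@le_trans _ _ (indic_gap psi1 A1 + indic_gap psi2 A2)%E); last first.
  by rewrite [e]splitr EFinD leeD.
rewrite /indic_gap -ge0_integralD//; try exact: measurable_gap.
apply: ge0_le_integral => //.
- by apply: measurable_gap; [exact: HU|exact: measurableU].
- by apply: emeasurable_funD; exact: measurable_gap.
move=> x _; rewrite -EFinD lee_fin.
have -> : \1_(A1 `|` A2) x = Num.max (\1_A1 x) (\1_A2 x) :> R.
  rewrite !indicE in_setU maxEle.
  by case: (x \in A1); case: (x \in A2); rewrite /= ?lexx ?ler01 ?ler10.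
exact: dist_max_le.
Qed.

Lemma approximable_bigcup (A : nat -> set T) : (forall n, measurable (A n)) ->
  (forall n, approximable (A n)) -> approximable (\bigcup_n A n).
Proof.
move=> mA aA e e0; have e2 : 0 < e / 2 by rewrite divr_gt0.
pose U n := \big[setU/set0]_(i < n) A i.
have mU n : measurable (U n) by exact: bigsetU_measurable.
have aU n : approximable (U n).
  rewrite /U; elim: n => [|n ih]; first by rewrite big_ord0; exact: approximable0.
  by rewrite big_ord_recr/=; apply: approximableU => //; exact: mU.
have mUA : measurable (\bigcup_n A n) by exact: bigcup_measurable.
have UA n : U n `<=` \bigcup_n A n.
  by move=> x; rewrite /U -bigcup_mkord => -[i _ Aix]; exists i.
have [n nU] : exists n, (m (\bigcup_n A n `\` U n) < (e / 2)%:E)%E.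
  apply: measure_vanishing => //.
  - by move=> n; exact: measurableD.
  - move=> i j ij; apply/subsetPset; apply: setDS.
    by apply: subset_bigsetU.
  - apply/seteqP; split => // x xU.
    have [[n _ Anx] _] := xU 0%N I; have [_] := xU n.+1 I; apply.
    by rewrite /U big_ord_recr/=; right.
have [psi Hpsi g] := aU n _ e2; exists psi => //.
apply: (@le_trans _ _ (indic_gap psi (U n) + m (\bigcup_n A n `\` U n))%E); last first.
  by rewrite [e]splitr EFinD leeD// ltW.
have mD : measurable (\bigcup_n A n `\` U n) by exact: measurableD.
have -> : m (\bigcup_n A n `\` U n) =
    (\int[m]_x (\1_(\bigcup_n A n `\` U n) x)%:E)%E.
  by rewrite integral_indic// setIT.
rewrite /indic_gap.
rewrite -ge0_integralD//; try exact: measurable_gap; last first.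
  exact/measurable_EFinP/measurable_indic.
apply: ge0_le_integral => //.
- exact: measurable_gap.
- apply: emeasurable_funD; first exact: measurable_gap.
  exact/measurable_EFinP/measurable_indic.
move=> x _; rewrite -EFinD lee_fin.
have -> : psi x - \1_(\bigcup_n A n) x =
    (psi x - \1_(U n) x) - \1_(\bigcup_n A n `\` U n) x.
  rewrite -addrA -opprD; congr (_ - _); rewrite !indicE in_setD.
  case: (boolP (x \in U n)) => [xU|xU] /=; last by rewrite andbT add0r.
  by rewrite andbF addr0 mem_set//; exact: UA (set_mem xU).
by rewrite (le_trans (ler_normB _ _))// lerD2l ger0_norm.
Qed.

(** Complements, maxima and continuity from above make the approximable sets a
    sigma-algebra, so that only generators have to be approximated. *)
Lemma approximable_sigma (G : set (set T)) :
  (forall A, <<s G >> A -> measurable A) -> (forall A, G A -> approximable A) ->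
  forall A, <<s G >> A -> approximable A.
Proof.
move=> mG aG A GA; suff [] : measurable A /\ approximable A by [].
move: A GA; apply: smallest_sub; last first.
  by move=> A GA; split; [apply: mG; exact: sub_sigma_algebra|exact: aG].
split => /=.
- by split; [exact: measurable0|exact: approximable0].
- move=> A [mA aA]; rewrite setTD; split; first exact: measurableC.
  exact: approximableC.
- move=> A mA; split; first by apply: bigcup_measurable => i _; exact: (mA i).1.
  by apply: approximable_bigcup => i; [exact: (mA i).1|exact: (mA i).2].
Qed.

End approximation_of_sets.

Section borel_maps.
Context (R : realType) (d : nat) (k : domain).
Local Notation Omega := (phase_space R d k).
Local Notation B := (borel R d k).
Local Notation pi := (@cover_map R d k).
Implicit Types (a b c : Omega) (x y z : 'rV[R]_d).

Lemma open_borel (A : set Omega) : open A -> measurable (A : set B).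
Proof. exact: sub_sigma_algebra. Qed.

Lemma lipschitz_measurable (g : Omega -> R) L :
  (forall a b, `|g a - g b| <= L * dist a b) ->
  measurable_fun [set: B] (g : B -> R).
Proof.
move=> gL; apply: (measurability _ (RGenOInfty.measurableE R)).
move=> _ [_ [x ->] <-]; rewrite setTI; apply: open_borel; apply/openP_dist => a /=.
rewrite in_itv/= andbT => xga; have L1 : 0 < `|L| + 1 by rewrite ltr_wpDl.
exists ((g a - x) / (`|L| + 1)); first by rewrite divr_gt0 ?subr_gt0.
move=> b; rewrite ltr_pdivlMr// in_itv/= andbT => ab.
have := gL a b; rewrite ler_norml => /andP[_ gab].
have : L * dist a b <= dist a b * (`|L| + 1).
  rewrite mulrC ler_wpM2l ?dist_ge0//; have := ler_norm L; lra.
lra.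
Qed.

Lemma lipschitz_map_measurable (h : Omega -> Omega) L :
  (forall a b, dist (h a) (h b) <= L * dist a b) ->
  measurable_fun [set: B] (h : B -> B).
Proof.
move=> hL; apply: (@measurability _ _ B B setT h (@open Omega)) => //.
move=> _ [U oU <-]; rewrite setTI; apply: open_borel; apply/openP_dist => a /= Uha.
have [r r0 rU] := (openP_dist _).1 oU _ Uha.
have L1 : 0 < `|L| + 1 by rewrite ltr_wpDl.
exists (r / (`|L| + 1)); first by rewrite divr_gt0.
move=> b; rewrite ltr_pdivlMr// => ab; apply: rU; apply: le_lt_trans ab.
rewrite (le_trans (hL _ _))// mulrC ler_wpM2l ?dist_ge0//.
by have := ler_norm L; lra.
Qed.

(** ** Approximation by Lipschitz functions *)

Definition lipschitz_unit (psi : Omega -> R) :=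
  (forall a, 0 <= psi a <= 1) /\
  exists2 L, 0 <= L & forall a b, `|psi a - psi b| <= L * dist a b.

Lemma lipschitz_unit_measurable psi : lipschitz_unit psi ->
  measurable_fun [set: B] (psi : B -> R).
Proof. by move=> [_ [L _]]; exact: lipschitz_measurable. Qed.

Lemma lipschitz_unit_bounded psi : lipschitz_unit psi ->
  bounded_measurable (psi : B -> R).
Proof.
move=> H; split; first exact: lipschitz_unit_measurable.
by exists 1 => a; have /andP[? ?] := H.1 a; rewrite ger0_norm.
Qed.

Lemma lipschitz_unitC psi : lipschitz_unit psi ->
  lipschitz_unit (fun a => 1 - psi a).
Proof.
move=> [p01 [L L0 pL]]; split.
  by move=> a; have /andP[? ?] := p01 a; apply/andP; split; lra.
exists L => // a b; have -> : 1 - psi a - (1 - psi b) = - (psi a - psi b) by ring.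
by rewrite normrN.
Qed.

Lemma lipschitz_unit_max psi1 psi2 : lipschitz_unit psi1 -> lipschitz_unit psi2 ->
  lipschitz_unit (fun a => Num.max (psi1 a) (psi2 a)).
Proof.
move=> [p1 [L1 L10 pL1]] [p2 [L2 L20 pL2]]; split.
  move=> a; have /andP[? ?] := p1 a; have /andP[? ?] := p2 a.
  by rewrite le_max ge_max; apply/andP; split; [apply/orP; left|apply/andP].
exists (L1 + L2) => [|a b]; first by rewrite addr_ge0.
by rewrite (le_trans (dist_max_le _ _ _ _))// mulrDl lerD.
Qed.

(** Distance to a set, truncated so that it is also meaningful for the empty
    set. *)
Definition setdist (A : set Omega) a : R := inf ([set dist a b | b in A] `|` [set 1]).

Lemma has_inf_setdist A a : has_inf ([set dist a b | b in A] `|` [set 1]).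
Proof.
split; first by exists 1; right.
by exists 0 => _ [[b _ <-]|->]; rewrite ?dist_ge0.
Qed.

Lemma setdist_ge0 A a : 0 <= setdist A a.
Proof.
apply: lb_le_inf; first by exists 1; right.
by move=> _ [[b _ <-]|->]; rewrite ?dist_ge0.
Qed.

Lemma setdist_le1 A a : setdist A a <= 1.
Proof. by apply: ge_inf; [exact: (has_inf_setdist A a).2|right]. Qed.

Lemma setdist_mem A a : A a -> setdist A a = 0.
Proof.
move=> Aa; apply/eqP; rewrite eq_le setdist_ge0 andbT.
apply: ge_inf; first exact: (has_inf_setdist A a).2.
by left; exists a => //; exact: dist_refl.
Qed.

Lemma setdist_lip A a b : `|setdist A a - setdist A b| <= 1 * dist a b.
Proof.
suff H (u v : Omega) : setdist A u <= setdist A v + dist u v.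
  rewrite mul1r ler_norml; apply/andP; split.
    by have := H b a; rewrite dist_sym; lra.
  by have := H a b; lra.
rewrite -lerBlDr; apply: lb_le_inf; first by exists 1; right.
move=> _ [[w Aw <-]|->]; rewrite lerBlDr.
  rewrite addrC (le_trans _ (dist_triangle v _ _))//.
  apply: ge_inf; first exact: (has_inf_setdist A u).2.
  by left; exists w.
by rewrite (le_trans (setdist_le1 _ _))// lerDl dist_ge0.
Qed.

Lemma setdist_gt0 A a : open (~` A) -> ~ A a -> 0 < setdist A a.
Proof.
move=> /openP_dist oA Aa; have [r r0 rA] := oA a Aa.
apply: (@lt_le_trans _ _ (Num.min r 1)); first by rewrite lt_min r0 ltr01.
apply: lb_le_inf; first by exists 1; right.
move=> _ [[b Ab <-]|->]; rewrite ge_min ?lexx ?orbT//.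
by apply/orP; left; rewrite leNgt; apply/negP => /rA.
Qed.

(** It suffices to approximate open sets U, and there the functions
    min (1, n dist (., ~U)) increase to the indicator. *)
Lemma lipschitz_indic_gap (m : {measure set B -> \bar R}) A e :
  (m setT < +oo)%E -> measurable A -> 0 < e ->
  exists2 psi, lipschitz_unit psi & (indic_gap m psi A <= e%:E)%E.
Proof.
move=> mT mA e0; suff H : approximable m (lipschitz_unit : set (B -> R)) A.
  exact: H.
move: A mA; apply: (@approximable_sigma _ _ _ _ mT _ _ _ _ _ (@open Omega)) => //.
- exact: lipschitz_unit_measurable.
- split; first by move=> a; rewrite lexx ler01.
  by exists 0 => // a b; rewrite subrr normr0 mul0r.
- exact: lipschitz_unitC.
- exact: lipschitz_unit_max.
move=> U oU {}e {}e0; have mU := open_borel oU.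
(* V n is the set where the n-th approximation of the indicator of U differs
   from it. *)
pose V n : set B := [set a | n.+1%:R * setdist (~` U) a < 1] `&` U.
have mV n : measurable (V n).
  apply: measurableI => //; apply: open_borel; apply/openP_dist => a /= aV.
  have n0 : 0 < n.+1%:R :> R by [].
  exists ((1 - n.+1%:R * setdist (~` U) a) / n.+1%:R).
    by rewrite divr_gt0// subr_gt0.
  move=> b; rewrite ltr_pdivlMr// => ab.
  have := setdist_lip (~` U) b a; rewrite mul1r dist_sym ler_norml => /andP[_].
  by rewrite -(ler_pM2l n0); lra.
have [n nV] : exists n, (m (V n) < e%:E)%E.
  apply: measure_vanishing => //.
    move=> i j ij; apply/subsetPset => a [/= aV Ua]; split => //=.
    apply: le_lt_trans aV; rewrite ler_wpM2r ?setdist_ge0// ler_nat//.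
  apply/seteqP; split => // a aV; have [_ Ua] := aV 0%N I.
  have sa : 0 < setdist (~` U) a.
    by apply: setdist_gt0; [rewrite setCK|exact].
  have [n na] : exists n, (setdist (~` U) a)^-1 < n%:R.
    exists (Num.Def.archi_bound (setdist (~` U) a)^-1).
    by apply: archi_boundP; rewrite invr_ge0 ltW.
  have [/= + _] := aV n I; rewrite ltNge => /negP; apply.
  rewrite -[X in X <= _](mulVf (lt0r_neq0 sa)) ler_wpM2r ?(ltW sa)//.
  by rewrite (le_trans (ltW na))// ler_nat.
have n0 : 0 < n.+1%:R :> R by [].
pose psi a := Num.min 1 (n.+1%:R * setdist (~` U) a).
have psiU : lipschitz_unit psi.
  split.
    move=> a; rewrite /psi le_min ge_min lexx ler01/= andbT.
    by rewrite mulr_ge0 ?setdist_ge0.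
  exists n.+1%:R => // a b.
  have := setdist_lip (~` U) a b; rewrite mul1r ler_norml => /andP[].
  rewrite /psi; set s := setdist _ a; set t := setdist _ b => h1 h2.
  have {h1} := h1; rewrite -(ler_pM2l n0) => h1.
  have {h2} := h2; rewrite -(ler_pM2l n0) => h2.
  rewrite ler_norml; case: (leP 1 (n.+1%:R * s)) => ?;
  by case: (leP 1 (n.+1%:R * t)) => ?; lra.
exists psi => //; apply: le_trans (ltW nV).
rewrite /indic_gap -(setIT (V n)) -integral_indic//.
apply: ge0_le_integral => //.
- apply/measurable_EFinP; apply: measurableT_comp => //.
  by apply: measurable_funB; [exact: lipschitz_unit_measurable|exact: measurable_indic].
- exact/measurable_EFinP/measurable_indic.
move=> a _; rewrite lee_fin !indicE.
have [aV|aV] := boolP (a \in V n).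
  have /andP[? ?] := psiU.1 a.
  by rewrite ler_norml; case: (a \in U) => /=; lra.
rewrite normr_le0 subr_eq0 /psi.
have [aU|aU] := boolP (a \in U).
  rewrite minEle; case: ifPn => //; rewrite -ltNge => ha.
  by move: aV; rewrite notin_setE; case; split => //; rewrite inE in aU.
rewrite setdist_mem ?mulr0; last by rewrite notin_setE in aU.
by rewrite minEle ler10.
Qed.

End borel_maps.

(** * Dyadic cells and the Lebesgue measure *)

Section boxes.
Context (R : realType) (d : nat) (k : domain).
Local Notation Omega := (phase_space R d k).
Local Notation B := (borel R d k).
Local Notation pi := (@cover_map R d k).
Local Notation deck := (@deck R k).
Implicit Types (x y z lo hi : 'rV[R]_d).

(** A half-open slab is an open slab and a hyperplane; the image of the
    hyperplane is closed because the deck group is discrete. *)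
Lemma measurable_cover_slab (i : 'I_d) (s t : R) :
  measurable (pi @` [set x : 'rV[R]_d | s <= x 0 i < t] : set B).
Proof.
have [st|ts] := ltP s t; last first.
  rewrite (_ : [set x : 'rV[R]_d | _] = set0) ?image_set0; first exact: measurable0.
  by apply/seteqP; split => // x /=; lra.
have -> : pi @` [set x : 'rV[R]_d | s <= x 0 i < t] =
    pi @` [set x : 'rV[R]_d | s < x 0 i < t] `|` pi @` [set x : 'rV[R]_d | x 0 i = s].
  rewrite -image_setU; congr (_ @` _); apply/seteqP; split => x /=.
    move=> /andP[]; rewrite le_eqVlt => /orP[/eqP <-|-> ->]; first by right.
    by left.
  by move=> [/andP[/ltW -> ->]//|->]; rewrite lexx.
apply: measurableU.
  apply: open_borel; apply: open_cover_image; apply/openP_enorm => x /= /andP[sx xt].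
  exists (Num.min (x 0 i - s) (t - x 0 i)); first by rewrite lt_min !subr_gt0 sx.
  move=> y; rewrite lt_min => /andP[h1 h2].
  have := coord_le_enorm (x - y) i; rewrite !mxE ler_norml => /andP[h3 h4].
  by apply/andP; split; lra.
rewrite -[X in measurable X]setCK; apply: measurableC; apply: open_borel.
apply/openP_dist => a; have [x <-] := cover_surj a => ax.
have xs : ~ deck (x 0 i - s).
  move=> dx; apply: ax; exists (\row_j if j == i then s else x 0 j).
    by rewrite /= mxE eqxx.
  apply/cover_eq => j; rewrite mxE; case: ifPn => [/eqP ->|_].
    by rewrite -opprB; exact: deckN.
  by rewrite subrr; exact: deck0.
have [e e0 he] := deck_isolated xs; exists e => // b /dist_lift[z <- xz] [w ws wz].
have /he : deck (z 0 i - s) by rewrite -ws; move/cover_eq : (esym wz); apply.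
have -> : z 0 i - s - (x 0 i - s) = - (x - z) 0 i by rewrite !mxE; ring.
by rewrite normrN leNgt (le_lt_trans (coord_le_enorm _ _)).
Qed.

Lemma measurable_cover_box lo hi : measurable (pi @` box lo hi : set B).
Proof.
have -> : pi @` box lo hi =
    \bigcap_(i in [set: 'I_d]) (pi @` [set x : 'rV[R]_d | lo 0 i <= x 0 i < hi 0 i]).
  apply/seteqP; split => [_ [x xb <-] i _|a aS]; first by exists x => //=.
  have /choice[g gP] : forall i, exists x, lo 0 i <= x 0 i < hi 0 i /\ pi x = a.
    by move=> i; have [x ? ?] := aS i I; exists x.
  exists (\row_i g i 0 i); first by move=> i; rewrite mxE; exact: (gP i).1.
  have [x xa] := cover_surj a; rewrite -xa; apply/cover_eq => i; rewrite mxE.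
  have : pi (g i) = pi x by rewrite (gP i).2.
  by move=> /cover_eq.
by apply: fin_bigcap_measurable => // i _; exact: measurable_cover_slab.
Qed.

Lemma cover_box_inj lo hi : (forall i, hi 0 i - lo 0 i <= 1) ->
  set_inj (box lo hi) pi.
Proof.
move=> small x y; rewrite !inE => xb yb /cover_eq xy; apply/rowP => i.
apply/eqP; rewrite -subr_eq0; apply/eqP; apply: (deck_lt1 (xy i)).
have /andP[? ?] := xb i; have /andP[? ?] := yb i; have := small i.
by rewrite ltr_norml => ?; apply/andP; split; lra.
Qed.

(** ** Dyadic cells *)

(** On the torus the chosen lift has its coordinates in [0, 1[, so that a dyadic
    cell is the injective image of a single dyadic cube. *)
Definition frac_lift (r : R) : R :=
  match k with Euclidean => r | Torus => r - (Num.floor r)%:~R end.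

Lemma frac_lift_deck r : deck (r - frac_lift r).
Proof.
rewrite /frac_lift /deck; case: k => /=; first by rewrite subrr.
by rewrite subKr intr_int.
Qed.

Lemma frac_lift_torus r : k = Torus -> 0 <= frac_lift r < 1.
Proof.
rewrite /frac_lift => ->; have /andP[? ?] := floor_itv r.
by rewrite subr_ge0 ltrBlDl; apply/andP; split => //; rewrite -intrD1.
Qed.

Lemma frac_lift_eq r s : deck (r - s) -> frac_lift r = frac_lift s.
Proof.
move=> rs; have E : deck (frac_lift r - frac_lift s).
  have -> : frac_lift r - frac_lift s =
     (r - s) - (r - frac_lift r) + (s - frac_lift s) by ring.
  by apply: deckD; [apply: deckB => //|]; exact: frac_lift_deck.
apply/eqP; rewrite -subr_eq0; apply/eqP; apply: (deck_lt1 E).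
move: E; rewrite /deck /frac_lift; case: k => /=; first by move=> ->; rewrite normr0 ltr01.
move=> _; have /andP[] := floor_itv r; have /andP[] := floor_itv s.
by rewrite !intrD1 ltr_norml => ? ? ? ?; apply/andP; split; lra.
Qed.

Definition section (a : Omega) : 'rV[R]_d :=
  \row_i frac_lift (sval (cid (cover_surj a)) 0 i).

Lemma sectionK a : pi (section a) = a.
Proof.
rewrite /section; case: cid => x /= <-; apply/cover_eq => i; rewrite mxE.
by rewrite -opprB; apply/deckN/frac_lift_deck.
Qed.

Lemma section_cover x i : section (pi x) 0 i = frac_lift (x 0 i).
Proof.
rewrite /section mxE; case: cid => y /= /cover_eq yx; exact: frac_lift_eq.
Qed.

Lemma section_torus a i : k = Torus -> 0 <= section a 0 i < 1.
Proof. by rewrite mxE; exact: frac_lift_torus. Qed.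

Definition cell_index n (a : Omega) : {ffun 'I_d -> int} :=
  [ffun i => Num.floor (2 ^+ n * section a 0 i)].

Definition cell n (a : Omega) : set Omega :=
  [set b | cell_index n b = cell_index n a].

Let floor_eq (r s : R) : (Num.floor r)%:~R <= s < (Num.floor r + 1)%:~R ->
  Num.floor s = Num.floor r.
Proof. exact: floor_def. Qed.

Lemma cell_indexS n a b : cell_index n.+1 a = cell_index n.+1 b ->
  cell_index n a = cell_index n b.
Proof.
move=> /ffunP ab; apply/ffunP => i; have := ab i; rewrite !ffunE exprS -!mulrA.
set r := 2 ^+ n * _; set s := 2 ^+ n * _ => rs; apply: floor_eq.
have /andP[r1 r2] := floor_itv (2 * r); have /andP[s1 s2] := floor_itv (2 * s).
have /andP[u1 u2] := floor_itv s; rewrite rs in r1 r2.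
have v1 : 2 * Num.floor s <= Num.floor (2 * s).
  by rewrite floor_ge_int intrM ler_pM2l.
have v2 : Num.floor (2 * s) + 1 <= 2 * (Num.floor s + 1).
  rewrite lezD1 -(ltr_int R); apply: le_lt_trans s1 _.
  by rewrite intrM ltr_pM2l.
rewrite -(ler_int R) intrM in v1; rewrite -(ler_int R) [in leRHS]intrM in v2.
by apply/andP; split; rewrite ?intrD1 in r1 r2 s1 s2 u1 u2 v1 v2 *; lra.
Qed.

Lemma cell_index_le n m a b : (n <= m)%N -> cell_index m a = cell_index m b ->
  cell_index n a = cell_index n b.
Proof.
move=> /subnKC <-; elim: (m - n)%N => [|j ih]; first by rewrite addn0.
by rewrite addnS => /cell_indexS /ih.
Qed.

Lemma dist_cell n a b : cell n a b -> dist a b <= d%:R * (2 ^+ n)^-1.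
Proof.
move=> /ffunP ab; rewrite -(sectionK a) -(sectionK b).
apply: le_trans (dist_cover _ _ _) _; apply: enorm_le_coord => i.
have p0 : 0 < 2 ^+ n :> R by rewrite exprn_gt0.
rewrite !mxE -!/(frac_lift _) -(ler_pM2l p0) mulfV ?gt_eqF//.
have := ab i; rewrite !ffunE [section b 0 i]mxE [section a 0 i]mxE => E.
have /andP[r1 r2] := floor_itv (2 ^+ n * frac_lift (sval (cid (cover_surj a)) 0 i)).
have /andP[s1 s2] := floor_itv (2 ^+ n * frac_lift (sval (cid (cover_surj b)) 0 i)).
rewrite E in s1 s2; rewrite !intrD1 in r2 s2.
rewrite -[X in X * _]gtr0_norm// -normrM mulrBr ler_norml.
by apply/andP; split; lra.
Qed.

Definition cell_lo n a : 'rV[R]_d := \row_i ((cell_index n a i)%:~R / 2 ^+ n).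
Definition cell_hi n a : 'rV[R]_d := \row_i (((cell_index n a i) + 1)%:~R / 2 ^+ n).

(** On the torus the cube lies in the unit cube, where taking fractional parts
    does nothing. *)
Lemma cell_box n a : cell n a = pi @` box (cell_lo n a) (cell_hi n a).
Proof.
have p0 : 0 < 2 ^+ n :> R by rewrite exprn_gt0.
apply/seteqP; split => [b ab|_ [x xb <-]].
  exists (section b); last exact: sectionK.
  move=> i; rewrite [cell_lo n a 0 i]mxE [cell_hi n a 0 i]mxE -ab ffunE.
  rewrite ler_pdivrMr// ltr_pdivlMr// mulrC; exact: floor_itv.
apply/ffunP => i; have := xb i.
rewrite [cell_lo n a 0 i]mxE [cell_hi n a 0 i]mxE.
rewrite [cell_index n (pi x) i]ffunE section_cover.
rewrite ler_pdivrMr// ltr_pdivlMr// [x 0 i * _]mulrC => xi.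
suff -> : frac_lift (x 0 i) = x 0 i by exact: floor_def.
have [E|E] : k = Euclidean \/ k = Torus by case: (k); [left|right].
  by rewrite /frac_lift E.
have /andP[s0 s1] := section_torus a i E.
have i0 : 0 <= cell_index n a i.
  by rewrite ffunE floor_ge_int mulr_ge0// ltW.
have i1 : cell_index n a i + 1 <= 2 ^+ n.
  rewrite ffunE lezD1 -(ltr_int R) rmorphXn/=.
  have /andP[h _] := floor_itv (2 ^+ n * section a 0 i); apply: le_lt_trans h _.
  by rewrite gtr_pMr.
rewrite /frac_lift E; suff -> : Num.floor (x 0 i) = 0 by rewrite subr0.
apply: floor_def; have /andP[x0 x1] := xi.
rewrite -(ler_int R) in i0; rewrite -(ler_int R) rmorphXn/= in i1.
rewrite mulr0z add0r mulr1z; apply/andP; split.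
  by rewrite -(pmulr_rge0 _ p0) (le_trans i0).
by rewrite -(ltr_pM2l p0) mulr1 (lt_le_trans x1).
Qed.

End boxes.

Section comparison_with_lebesgue.
Context (R : realType) (d : nat) (k : domain).
Local Notation Omega := (phase_space R d k).
Local Notation B := (borel R d k).
Local Notation pi := (@cover_map R d k).
Implicit Types (a b : Omega) (x y z lo hi : 'rV[R]_d).

Lemma measurable_cell n a : measurable (cell n a : set B).
Proof. by rewrite cell_box; exact: measurable_cover_box. Qed.

Lemma cell_refl n a : cell n a a.
Proof. by []. Qed.

Let pow2_gt0 n : 0 < 2 ^+ n :> R. Proof. by rewrite exprn_gt0. Qed.

Lemma lebesgue_cell (lam : set B -> \bar R) n a : is_lebesgue lam ->
  lam (cell n a) = (((2 ^+ n)^-1) ^+ d)%:E.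
Proof.
move=> lamL; rewrite cell_box.
have E i : cell_hi n a 0 i - cell_lo n a 0 i = (2 ^+ n)^-1.
  by rewrite [cell_lo n a 0 i]mxE [cell_hi n a 0 i]mxE intrD1 -mulrBl addrC addKr mul1r.
rewrite lamL.
- by congr EFin; under eq_bigr do rewrite E; rewrite prodr_const card_ord.
- by move=> i; rewrite -subr_ge0 E invr_ge0 ltW.
- apply: cover_box_inj => i; rewrite E invf_le1//.
  by rewrite exprn_ege1// ler1n.
Qed.

(** Unions of cells of level n; they form an algebra that grows with n. *)
Definition dyadic n (A : set Omega) := forall a b, cell n a b -> A a -> A b.

Lemma cell_sym n a b : cell n a b -> cell n b a.
Proof. by rewrite /cell /= => ->. Qed.

Lemma dyadic_le n m A : (n <= m)%N -> dyadic n A -> dyadic m A.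
Proof. by move=> nm nA a b ab; apply: nA; exact: cell_index_le nm ab. Qed.

Lemma dyadicC n A : dyadic n A -> dyadic n (~` A).
Proof. by move=> nA a b ab nAa Ab; apply: nAa; exact: nA (cell_sym ab) Ab. Qed.

Lemma dyadicU n A1 A2 : dyadic n A1 -> dyadic n A2 -> dyadic n (A1 `|` A2).
Proof.
by move=> n1 n2 a b ab [A1a|A2a]; [left; exact: n1 A1a|right; exact: n2 A2a].
Qed.

Lemma dyadicI n A1 A2 : dyadic n A1 -> dyadic n A2 -> dyadic n (A1 `&` A2).
Proof.
by move=> n1 n2 a b ab [A1a A2a]; split; [exact: n1 A1a|exact: n2 A2a].
Qed.

Lemma dyadic_cell n a : dyadic n (cell n a).
Proof. by move=> b c; rewrite /cell /= => ->. Qed.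

(** The cells of level n are numbered by pickle, in order to use countable
    additivity. *)
Definition piece n A (j : nat) : set Omega :=
  [set a | A a /\ pickle (cell_index n a) = j].

Lemma piece_bigcup n A : A = \bigcup_j piece n A j.
Proof.
apply/seteqP; split => [a Aa|a [j _ []]//].
by exists (pickle (cell_index n a)).
Qed.

Lemma piece_trivIset n A : trivIset setT (piece n A).
Proof. by move=> i j _ _ [a [[_ <-] [_ <-]]]. Qed.

Lemma piece_cell n A j a : piece n A j a -> piece n A j = A `&` cell n a.
Proof.
move=> [Aa ja]; apply/seteqP; split => [b [Ab jb]|b [Ab ab]].
  by split => //; apply: (pcan_inj pickleK); rewrite ja jb.
by split => //; rewrite ab.
Qed.

Lemma measurable_piece n (A : set B) j : measurable A ->
  measurable (piece n A j : set B).
Proof.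
move=> mA; have [->|/set0P[a /piece_cell ->]] := eqVneq (piece n A j) set0.
  exact: measurable0.
by apply: measurableI => //; exact: measurable_cell.
Qed.

Lemma measurable_dyadic n A : dyadic n A -> measurable (A : set B).
Proof.
move=> nA; rewrite (piece_bigcup n A); apply: bigcup_measurable => j _.
have [->|/set0P[a aP]] := eqVneq (piece n A j) set0; first exact: measurable0.
rewrite (piece_cell aP) setIidr; first exact: measurable_cell.
by move=> b ab; apply: nA ab _; exact: aP.1.
Qed.

Lemma measure_pieces (m : {measure set B -> \bar R}) n (A : set B) :
  measurable A -> m A = (\sum_(j <oo) m (piece n A j))%E.
Proof.
move=> mA; rewrite [in LHS](piece_bigcup n A) measure_bigcup//.
- by apply: eq_eseriesl => j; rewrite in_setT.
- by move=> j _; exact: measurable_piece.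
- exact: piece_trivIset.
Qed.

Section comparison.
Context (lam m : {measure set B -> \bar R}) (n0 : nat) (C : R).
Hypotheses (lamL : is_lebesgue lam) (C0 : 0 <= C).
Hypothesis mcell : forall n a, (n0 <= n)%N ->
  (m (cell n a) <= C%:E * lam (cell n a))%E.

Let le_dyadic n A : (n0 <= n)%N -> dyadic n A -> (m A <= C%:E * lam A)%E.
Proof.
move=> n0n nA; have mA := measurable_dyadic nA.
rewrite !(measure_pieces _ n mA) -nneseriesZl//.
apply: lee_nneseries => // j _.
have [->|/set0P[a aP]] := eqVneq (piece n A j) set0; first by rewrite !measure0 mule0.
rewrite (piece_cell aP) setIidr; first exact: mcell.
by move=> b ab; apply: nA ab _; exact: aP.1.
Qed.

(** In one cell both measures are finite.  There A is approximated in L^1 of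
    their sum by unions of smaller cells, to which the bound on cells extends by
    additivity. *)
Let le_in_cell (A : set B) a : measurable A -> A `<=` cell n0 a ->
  (m A <= C%:E * lam A)%E.
Proof.
move=> mA Aa; set W : set B := cell n0 a; have mW : measurable W := measurable_cell _ _.
pose mm : {measure set B -> \bar R} := mrestr (measure_add m lam) mW.
have mmE X : mm X = (m (X `&` W) + lam (X `&` W))%E by exact: (measure_addE m lam (X `&` W)).
have lamW : (lam W < +oo)%E by rewrite lebesgue_cell ?ltry.
have mWy : (m W < +oo)%E.
  by rewrite (le_lt_trans (mcell a (leqnn _)))// lte_mul_pinfty.
have mmT : (mm setT < +oo)%E by rewrite mmE setTI lte_add_pinfty.
pose H : set (B -> R) := [set psi | exists2 n, (n0 <= n)%N &
  exists2 D, dyadic n D & psi = \1_D].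
have Hmeas psi : H psi -> measurable_fun setT psi.
  by move=> [n _ [D nD ->]]; apply: measurable_indic; exact: measurable_dyadic nD.
have H0 : H (cst 0).
  by exists n0 => //; exists set0 => //; rewrite indic0.
have HC psi : H psi -> H (fun b => 1 - psi b).
  move=> [n n0n [D nD ->]]; exists n => //; exists (~` D); first exact: dyadicC.
  apply/funext => b; rewrite !indicE in_setC; case: (b \in D) => /=; ring.
have HU psi1 psi2 : H psi1 -> H psi2 -> H (fun b => Num.max (psi1 b) (psi2 b)).
  move=> [n1 n01 [D1 nD1 ->]] [n2 n02 [D2 nD2 ->]].
  exists (maxn n1 n2); first by rewrite leq_max n01.
  exists (D1 `|` D2).
    by apply: dyadicU; [apply: dyadic_le nD1; rewrite leq_maxl|
                        apply: dyadic_le nD2; rewrite leq_maxr].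
  apply/funext => b; rewrite !indicE in_setU maxEle.
  by case: (b \in D1); case: (b \in D2); rewrite /= ?lexx ?ler01 ?ler10.
have HA : approximable mm H A.
  move: (A) mA.
  apply: (approximable_sigma mmT Hmeas H0 HC HU (G := @open Omega)) => //.
  move=> U oU; pose D n : set B := [set b | cell (n0 + n) b `<=` U].
  have dD n : dyadic (n0 + n) (D n).
    by move=> b c bc /= bU e ce; apply: bU; move: ce bc; rewrite /cell/= => ->.
  have -> : U = \bigcup_n D n.
    apply/seteqP; split => [b Ub|b [n _]]; last by apply; exact: cell_refl.
    have [r r0 rU] := (openP_dist _).1 oU _ Ub.
    have [n nr] : exists n, d%:R * (2 ^+ n)^-1 < r.
      exists (Num.Def.archi_bound (d%:R / r)).
      set j := Num.Def.archi_bound _; rewrite ltr_pdivrMr// mulrC -ltr_pdivrMr//.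
      apply: (@lt_le_trans _ _ j%:R); first by apply: archi_boundP; rewrite divr_ge0// ltW.
      by rewrite -natrX ler_nat ltnW// ltn_expl.
    exists n => // c bc; apply: rU; apply: le_lt_trans (dist_cell bc) _.
    apply: le_lt_trans nr; rewrite ler_wpM2l// lef_pV2 ?posrE//.
    by rewrite ler_weXn2l ?ler1n// leq_addl.
  apply: (approximable_bigcup mmT Hmeas H0 HU).
  - by move=> n; exact: measurable_dyadic (dD n).
  - move=> n e e0; exists (\1_(D n)).
      by exists (n0 + n)%N; [exact: leq_addr|exists (D n)].
    rewrite /indic_gap integral0_eq ?lee_fin ?ltW// => b _.
    by rewrite subrr normr0.
apply/lee_addgt0Pr => e e0.
have e' : 0 < e / (C + 1) by rewrite divr_gt0// ltr_wpDl.
have [_ [n n0n [D nD ->]] gap] := HA _ e'.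
have mD := measurable_dyadic nD.
have gapI (X : set B) : measurable X -> (forall b, X b -> `|\1_D b - \1_A b| = 1 :> R) ->
    (mm X <= (e / (C + 1))%:E)%E.
  move=> mX hX; apply: le_trans gap.
  have -> : mm X = (\int[mm]_b (\1_X b)%:E)%E by rewrite integral_indic// setIT.
  apply: ge0_le_integral => //.
  - exact/measurable_EFinP/measurable_indic.
  - apply/measurable_EFinP; apply: measurableT_comp => //.
    by apply: measurable_funB; exact: measurable_indic.
  move=> b _; rewrite lee_fin [X in X <= _]indicE.
  have [bX|_] := boolP (b \in X); last exact: normr_ge0.
  by rewrite hX//; exact: set_mem.
have g1 : (m (A `\` D) <= (e / (C + 1))%:E)%E.
  have : (mm (A `\` D) <= (e / (C + 1))%:E)%E.
    apply: gapI; first exact: measurableD.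
    by move=> b [Ab nDb]; rewrite !indicE (mem_set Ab) (memNset nDb) sub0r normrN normr1.
  rewrite mmE (_ : _ `&` W = A `\` D); last by apply: setIidl => b [/Aa].
  by apply: le_trans; rewrite leeDl.
have g2 : (lam ((D `\` A) `&` W) <= (e / (C + 1))%:E)%E.
  have : (mm (D `\` A) <= (e / (C + 1))%:E)%E.
    apply: gapI; first exact: measurableD.
    by move=> b [Db nAb]; rewrite !indicE (mem_set Db) (memNset nAb) subr0 normr1.
  by rewrite mmE; apply: le_trans; rewrite leeDr.
have mDW : measurable (D `&` W : set B) by exact: measurableI.
have s1 : (m A <= m (D `&` W) + m (A `\` D))%E.
  rewrite (le_trans _ (measureU2 _ _ _))//; last exact: measurableD.
  apply: le_measure; rewrite ?inE//; first by apply: measurableU => //; exact: measurableD.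
  move=> b Ab; have [Db|nDb] := pselect (D b); last by right.
  by left; split => //; exact: Aa.
have s2 : (lam (D `&` W) <= lam A + lam ((D `\` A) `&` W))%E.
  have mDA : measurable ((D `\` A) `&` W : set B).
    by apply: measurableI => //; exact: measurableD.
  rewrite (le_trans _ (measureU2 _ _ _))//.
  apply: le_measure; rewrite ?inE//; first exact: measurableU.
  by move=> b [Db Wb]; have [Ab|nAb] := pselect (A b); [left|right].
have s3 : (m (D `&` W) <= C%:E * lam (D `&` W))%E.
  by apply: (@le_dyadic n) => //; apply: dyadicI => //; apply: dyadic_le n0n _; exact: dyadic_cell.
apply: (le_trans s1); apply: (@le_trans _ _ (C%:E * (lam A + (e / (C + 1))%:E) + (e / (C + 1))%:E)%E).
  rewrite leeD//; apply: (le_trans s3); rewrite lee_wpmul2l ?lee_fin//.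
  by apply: (le_trans s2); rewrite leeD2l.
rewrite ge0_muleDr//; last by rewrite lee_fin ltW.
rewrite -addeA leeD2l// -EFinM -EFinD lee_fin.
by rewrite le_eqVlt; apply/orP; left; apply/eqP; field; rewrite gt_eqF// ltr_wpDl.
Qed.

(** Countable additivity reduces the claim to the subsets of one cell. *)
Lemma le_lebesgue (A : set B) : measurable A -> (m A <= C%:E * lam A)%E.
Proof.
move=> mA; rewrite !(measure_pieces _ n0 mA) -nneseriesZl//.
apply: lee_nneseries => // j _.
have [->|/set0P[a aP]] := eqVneq (piece n0 A j) set0; first by rewrite !measure0 mule0.
apply: (@le_in_cell _ a); first exact: measurable_piece.
by rewrite (piece_cell aP); exact: subIsetr.
Qed.

End comparison.

(** The preimage of a dyadic cell of side s has a diameter of order kappa * s,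
    so it lies in a box of comparable side; from cells the bound extends to Borel
    sets by le_lebesgue.  This stands in for the change of variables formula. *)
Lemma lebesgue_preimage_le (lam : {measure set B -> \bar R}) kappa
    (h : Omega -> Omega) : (0 < d)%N -> is_lebesgue lam -> 0 < kappa ->
  measurable_fun [set: B] (h : B -> B) ->
  (forall a b, dist a b <= kappa * dist (h a) (h b)) ->
  forall A : set B, measurable A ->
    (lam (h @^-1` A) <= ((4 * kappa * d%:R) ^+ d)%:E * lam A)%E.
Proof.
move=> d0 lamL k0 mh hk.
have d0' : 0 < d%:R :> R by rewrite ltr0n.
pose m := measure_function_pushforward__canonical__measure_function_Measure lam mh.
(* From level n0 on, the boxes that contain preimages of cells have side at most
   1, hence embed in the torus. *)
have [n0 hn0] : exists n0, 4 * kappa * d%:R <= 2 ^+ n0.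
  set r := 4 * kappa * d%:R; exists (Num.Def.archi_bound r).
  apply: (@le_trans _ _ (Num.Def.archi_bound r)%:R).
    by apply/ltW/archi_boundP; rewrite !mulr_ge0// ltW.
  by rewrite -natrX ler_nat ltnW// ltn_expl.
apply: (@le_lebesgue lam m n0) => //; first by rewrite exprn_ge0// !mulr_ge0// ltW.
move=> n a n0n; rewrite (lebesgue_cell n a lamL) -EFinM -exprMn.
rewrite -[m _]/(lam (h @^-1` cell n a)).
have [->|/set0P[b0 hb0]] := eqVneq (h @^-1` cell n a) set0.
  rewrite measure0 lee_fin exprn_ge0// mulr_ge0// ?invr_ge0 ?(ltW (pow2_gt0 _))//.
  by rewrite !mulr_ge0// ltW.
have [x0 xb0] := cover_surj b0.
(* Twice the bound on the diameter of the preimage, to have strict inequalities. *)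
pose rho := 2 * kappa * d%:R / 2 ^+ n.
have rho0 : 0 < rho by rewrite divr_gt0// !mulr_gt0.
pose lo : 'rV[R]_d := \row_i (x0 0 i - rho); pose hi : 'rV[R]_d := \row_i (x0 0 i + rho).
have hlo i : hi 0 i - lo 0 i = 4 * kappa * d%:R / 2 ^+ n.
  by rewrite !mxE /rho; field; rewrite gt_eqF.
have -> : (4 * kappa * d%:R / 2 ^+ n) ^+ d = \prod_i (hi 0 i - lo 0 i).
  by under eq_bigr do rewrite hlo; rewrite prodr_const card_ord.
rewrite -lamL.
- apply: le_measure; rewrite ?inE.
  + by rewrite -[X in measurable X]setTI; apply: (mh) => //; exact: measurable_cell.
  + exact: measurable_cover_box.
  move=> b hb; have : dist (pi x0) b < rho.
    rewrite xb0 (le_lt_trans (hk _ _))//.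
    have : dist (h b0) (h b) <= d%:R * (2 ^+ n)^-1.
      apply: dist_cell; move: hb hb0; rewrite /cell/= => -> ->//.
    rewrite -(ler_pM2l k0) => /le_lt_trans; apply.
    rewrite /rho !mulrA ltr_pM2r ?invr_gt0// ltr_pM2r//.
    lra.
  move=> /dist_lift[y <- xy]; exists y => // i; rewrite !mxE.
  have := coord_le_enorm (x0 - y) i; rewrite !mxE ler_norml => /andP[? ?].
  by apply/andP; split; lra.
- by move=> i; rewrite -subr_ge0 hlo divr_ge0// ?(ltW (pow2_gt0 _))// !mulr_ge0// ltW.
- apply: cover_box_inj => i; rewrite hlo ler_pdivrMr// mul1r.
  by apply: (le_trans hn0); rewrite ler_weXn2l ?ler1n.
Qed.

(** ** Measure of balls *)

Lemma lebesgue_ball_lty (lam : {measure set B -> \bar R}) (r : R) : is_lebesgue lam ->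
  0 < r -> (lam [set a | (dist (pi 0) a < r)%R] < +oo)%E.
Proof.
move=> lamL r0; have mball := open_borel (open_ball_dist (pi 0) r).
have bnd lo hi : (forall i, lo 0 i <= hi 0 i) -> set_inj (box lo hi) pi ->
    [set a | dist (pi 0) a < r] `<=` pi @` box lo hi ->
    (lam [set a | (dist (pi 0) a < r)%R] < +oo)%E.
  move=> lohi inj sub; apply: (@le_lt_trans _ _ (lam (pi @` box lo hi))).
    by apply: le_measure; rewrite ?inE//; exact: measurable_cover_box.
  by rewrite lamL// ltry.
have [E|E] : k = Euclidean \/ k = Torus by case: (k); [left|right].
  apply: (bnd (const_mx (- r)) (const_mx r)).
  - by move=> i; rewrite !mxE; lra.
  - move=> x y _ _ /cover_eq; rewrite /deck E /= => xy.
    by apply/rowP => i; apply/eqP; rewrite -subr_eq0; apply/eqP.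
  move=> a /= /dist_lift[x <- xr]; exists x => // i; rewrite !mxE.
  have := coord_le_enorm (0 - x) i; rewrite !mxE ler_norml => /andP[? ?].
  by apply/andP; split; lra.
apply: (bnd (const_mx 0) (const_mx 1)).
- by move=> i; rewrite !mxE ler01.
- by apply: cover_box_inj => i; rewrite !mxE subr0.
move=> a _; exists (section a); last exact: sectionK.
move=> i; have := section_torus a i E; rewrite [const_mx 0 0 i]mxE [const_mx 1 0 i]mxE//.
Qed.

End comparison_with_lebesgue.

(** * Gronwall estimates and the flow *)

Section gronwall.
Context (R : realType).
Implicit Types (n dn : R -> R) (s t c : R).

(** The function exp (- c r) n(r) is nonincreasing. *)
Lemma gronwall n dn s t c : s <= t ->
  {within `[s, t], continuous n} ->
  (forall r, s < r < t -> is_derive r (1 : R) n (dn r)) ->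
  (forall r, s < r < t -> dn r <= c * n r) ->
  n t <= expR (c * (t - s)) * n s.
Proof.
rewrite le_eqVlt => /predU1P[->|st] cn dern dnc.
  by rewrite subrr mulr0 expR0 mul1r.
pose e r : R := expR (- c * r); pose f r : R := e r * n r.
have dere r : is_derive r (1 : R) e (e r * - c).
  have dZ : is_derive r (1 : R) (fun r => - c * r) (- c).
    have := is_deriveZ (- c) (is_derive_id r (1 : R)).
    by rewrite /GRing.scale /= mulr1.
  exact: (is_derive1_comp (is_derive_expR _) dZ).
have [] := @MVT R f (fun r => e r *: dn r + n r *: (e r * - c)) s t st.
- move=> r; rewrite in_itv/= => rst; have := dern _ rst => dnr.
  exact: (@is_deriveM _ _ e n r 1 _ _ (dere r) dnr).
- move=> r; apply: continuousM; last exact: cn.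
  apply: continuous_subspaceT => {}r.
  apply: differentiable_continuous; apply/derivable1_diffP.
  by case: (dere r).
move=> r; rewrite in_itv/= => rst E.
have : f t - f s <= 0.
  rewrite E mulr_le0_ge0 ?subr_ge0 ?(ltW st)// /GRing.scale/=.
  have -> : e r * dn r + n r * (e r * - c) = e r * (dn r - c * n r) by ring.
  by rewrite mulr_ge0_le0 ?expR_ge0// subr_le0 dnc.
rewrite subr_le0 /f /e => h.
have := ler_wpM2l (expR_ge0 (c * t)) h; rewrite !mulrA -!expRD.
have -> : c * t + - c * t = 0 by ring.
by rewrite expR0 mul1r; congr (_ <= expR _ * _); ring.
Qed.

(** Gronwall's lemma backward in time, i.e. for - n. *)
Lemma gronwall_lower n dn s t c : s <= t ->
  {within `[s, t], continuous n} ->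
  (forall r, s < r < t -> is_derive r (1 : R) n (dn r)) ->
  (forall r, s < r < t -> - c * n r <= dn r) ->
  n s <= expR (c * (t - s)) * n t.
Proof.
move=> st cn dern dnc.
have h : (- n) t <= expR (- c * (t - s)) * (- n) s.
  apply: (@gronwall (- n) (fun r => - dn r) s t (- c) st).
  - by move=> r; apply: continuousN; exact: cn.
  - by move=> r rst; apply: is_deriveN; exact: dern.
  - by move=> r /dnc; rewrite opprfctE; lra.
move: h; rewrite !opprfctE mulrN lerN2 => h.
have := ler_wpM2l (expR_ge0 (c * (t - s))) h; rewrite mulrA -expRD.
by rewrite mulNr addrN expR0 mul1r.
Qed.

(** By compactness, locally bounded quantities are bounded on segments. *)
Lemma segment_bounded (a b : R) (Q : R -> R -> Prop) :
  (forall r K K', K <= K' -> Q r K -> Q r K') ->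
  (forall t, a <= t <= b -> exists2 delta, 0 < delta & exists K,
     forall r, a <= r <= b -> `|r - t| < delta -> Q r K) ->
  exists K, forall r, a <= r <= b -> Q r K.
Proof.
move=> Qmono loc.
have : \forall K \near pinfty_nbhs R,
    `[a, b]%classic `<=` (fun r => a <= r <= b -> Q r K).
  apply: ((compact_near_coveringP _).1 (@segment_compact _ a b) _ (pinfty_nbhs R)
    (fun K r => a <= r <= b -> Q r K)) => t.
  rewrite /= ?in_itv/= => /loc[delta d0 [K QK]].
  exists ([set r | `|t - r| < delta], [set K' | K < K']).
    split => /=; first exact: (nbhsx_ballx t delta d0).
    by exists K; split => //; exact: num_real.
  move=> [r K'] /= [tr KK'] rab; apply: (Qmono r K); first exact: ltW.
  by apply: QK; rewrite // distrC.
move=> /filter_ex[K QK]; exists K => r rab; exact: QK.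
Qed.

(** Lebesgue's covering lemma on a segment. *)
Lemma segment_uniform (a b : R) (P : R -> R -> Prop) :
  (forall t, a <= t <= b -> exists2 delta, 0 < delta &
     forall r r', a <= r <= b -> a <= r' <= b ->
       `|r - t| < delta -> `|r' - t| < delta -> P r r') ->
  exists2 delta, 0 < delta &
    forall r r', a <= r <= b -> a <= r' <= b -> `|r - r'| < delta -> P r r'.
Proof.
move=> loc.
have H : \forall e \near (0^'+ : set_system R), `[a, b]%classic `<=`
   (fun r => forall r', a <= r <= b -> a <= r' <= b -> `|r - r'| < e -> P r r').
  apply: ((compact_near_coveringP _).1 (@segment_compact _ a b) _ (0^'+ : set_system R)
    (fun e r => forall r', a <= r <= b -> a <= r' <= b -> `|r - r'| < e -> P r r')) => t.
  rewrite /= ?in_itv/= => /loc[delta d0 Pd].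
  have d2 : 0 < delta / 2 by rewrite divr_gt0.
  exists ([set r | `|t - r| < delta / 2], [set e | e < delta / 2]).
    split => /=; first exact: (nbhsx_ballx t _ d2).
    exact: nbhs_right_lt.
  move=> [r e] /= [tr ed] r' rab r'ab rr'; apply: Pd => //.
    by rewrite distrC; lra.
  have -> : r' - t = - (r - r') - (t - r) by ring.
  by rewrite (le_lt_trans (ler_normB _ _))// normrN; lra.
have [delta [d0 Pd]] : exists delta, 0 < delta /\
    forall r, a <= r <= b -> forall r', a <= r <= b ->
    a <= r' <= b -> `|r - r'| < delta -> P r r'.
  have : \forall delta \near (0^'+ : set_system R), 0 < delta /\
    forall r, a <= r <= b -> forall r', a <= r <= b ->
    a <= r' <= b -> `|r - r'| < delta -> P r r'.
    near=> delta; split; first by near: delta; exact: nbhs_right_gt.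
    have Hd : `[a, b]%classic `<=` (fun r => forall r', a <= r <= b ->
      a <= r' <= b -> `|r - r'| < delta -> P r r') by near: delta; exact: H.
    by move=> r rab; apply: Hd; rewrite /= in_itv.
  by move=> /filter_ex.
by exists delta => // r r' ? ? ?; apply: (Pd r).
Unshelve. all: by end_near. Qed.

End gronwall.

Section velocity.
Context (R : realType) (d : nat) (k : domain).
Local Notation Omega := (phase_space R d k).
Local Notation B := (borel R d k).
Local Notation pi := (@cover_map R d k).

Lemma BLnorm_bounds (V : zmodType) (N : V -> R) (g : Omega -> V) (K : R) :
  N 0 = 0 -> (BLnorm N g <= K%:E)%E ->
  (forall a, N (g a) <= K) /\ forall a b, N (g a - g b) <= K * dist a b.
Proof.
move=> N0; rewrite /BLnorm ge_max => /andP[gs gl]; split => [a|a b].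
  by rewrite -lee_fin; apply: le_trans gs; apply: ereal_sup_ubound; exists a.
have [ab|ab] := eqVneq (dist a b) 0.
  by rewrite (dist_eq0 ab) subrr N0 dist_refl mulr0.
have ab0 : 0 < dist a b by rewrite lt_neqAle eq_sym ab dist_ge0.
rewrite -ler_pdivrMr// -lee_fin; apply: le_trans gl.
by apply: ereal_sup_ubound; exists (a, b).
Qed.

Lemma BL_bounds (V : zmodType) (N : V -> R) (g : Omega -> V) :
  N 0 = 0 -> BL N g -> exists2 K, 0 <= K &
  (forall a, N (g a) <= K) /\ forall a b, N (g a - g b) <= K * dist a b.
Proof.
move=> N0 gBL; have [K [K0 KBL]] : exists K, 0 <= K /\ (BLnorm N g <= K%:E)%E.
  move: gBL; rewrite /BL; case: (BLnorm _ _) => [r _|//|_].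
    by exists `|r|; split => //; rewrite lee_fin ler_norm.
  by exists 0; rewrite leNye.
by exists K => //; exact: BLnorm_bounds.
Qed.

Context (v : R -> Omega -> 'rV[R]_d).
Hypotheses (v2 : V2 v) (v3 : V3 v).

Definition velocity_bound (T K : R) := [/\ 0 <= K,
  forall t a, 0 <= t <= T -> enorm (v t a) <= K &
  forall t a b, 0 <= t <= T -> enorm (v t a - v t b) <= K * dist a b].

(** Near each time the velocity stays within distance 1, in the BL norm, of a
    bounded Lipschitz field; compactness of [0, T] makes the constants uniform. *)
Lemma velocity_bounded T : exists K, velocity_bound T K.
Proof.
pose Q t K := [/\ 0 <= K, forall a, enorm (v t a) <= K &
  forall a b, enorm (v t a - v t b) <= K * dist a b].
have [|t /andP[t0 tT]|K QK] := @segment_bounded R 0 T Q.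
- move=> r K K' KK' [K0 h1 h2]; split; first exact: le_trans KK'.
    by move=> a; exact: le_trans KK'.
  by move=> a b; rewrite (le_trans (h2 _ _))// ler_wpM2r// dist_ge0.
- have [delta d0 hd] := v3 t0 ltr01; exists delta => //.
  have [K K0 [h1 h2]] := BL_bounds (enorm0 R d) (v2 t0).
  exists (K + 1) => r /andP[r0 _] /(hd _ r0) /ltW /(BLnorm_bounds (enorm0 R d))[h3 h4]; split.
  + by rewrite addr_ge0.
  + move=> a; rewrite -(subrK (v t a) (v r a)) addrC (le_trans (enormD _ _))//.
    by rewrite lerD.
  move=> a b; have -> : v r a - v r b =
      (v t a - v t b) + ((v r a - v t a) - (v r b - v t b)).
    by apply/rowP => i; rewrite !mxE; ring.
  by rewrite (le_trans (enormD _ _))// mulrDl lerD.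
have [T0|T0] := leP 0 T; last first.
  by exists 0; split => // t a b *; lra.
exists K; split.
- by have [] := QK 0; rewrite ?lexx.
- by move=> t a /QK[].
- by move=> t a b /QK[].
Qed.

(** ** Integral curves *)

Definition integral_curve s (y : R -> 'rV[R]_d) :=
  {within `[s, +oo[, continuous y} /\
  forall t, s < t -> is_derive t (1 : R) y (v t (pi (y t))).

(** The velocity depends on the projection of the curve only, so deck
    translations map integral curves to integral curves. *)
Lemma integral_curve_shift s y x x' : pi x = pi x' -> integral_curve s y ->
  integral_curve s (fun t => y t + (x - x')).
Proof.
move=> xx' [cy dy]; split.
  move=> t; apply: cvgD; [exact: cy|exact: cvg_cst].
move=> t st; rewrite (cover_shift _ xx'); have dyt := dy _ st.
by have := is_deriveD dyt (is_derive_cst (x - x') t 1); rewrite addr0.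
Qed.

Lemma integral_curveW s s' y : s <= s' -> integral_curve s y -> integral_curve s' y.
Proof.
move=> ss' [cy dy]; split => [|t s't]; last by apply: dy; exact: le_lt_trans s't.
apply: continuous_subspaceW cy => t /=; rewrite !in_itv/= !andbT.
exact: le_trans.
Qed.

Lemma integral_curve_coord s y i t : integral_curve s y -> s < t ->
  is_derive t (1 : R) (fun r => y r 0 i) (v t (pi (y t)) 0 i).
Proof.
move=> [_ dy] st; have dyt := dy _ st.
have [der E] : derivable y t 1 /\ 'D_1 y t = v t (pi (y t)) by split; case: dyt.
apply: DeriveDef; first exact: (derivable_mxP y t 1).1.
by rewrite -E derive_mx// mxE.
Qed.

Lemma continuous_curve_coord s t y i : integral_curve s y ->
  {within `[s, t], continuous (fun r => y r 0 i)}.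
Proof.
move=> [cy _]; have cy' : {within `[s, t], continuous y}.
  apply: continuous_subspaceW cy => r /=; rewrite !in_itv/= andbT.
  by move=> /andP[].
move=> r; apply: (@continuous_comp (subspace `[s, t]) 'rV[R]_d R y
  (fun M => M 0 i) r (cy' r)).
exact: coord_continuous.
Qed.

Let sqdist (y y' : R -> 'rV[R]_d) (r : R) : R := \sum_i (y r 0 i - y' r 0 i) ^+ 2.

Let sqdistE y y' r : sqdist y y' r = enorm (y r - y' r) ^+ 2.
Proof. by rewrite enorm_sqr; apply: eq_bigr => i _; rewrite !mxE. Qed.

Let sqdist_derive s y y' r : integral_curve s y -> integral_curve s y' -> s < r ->
  is_derive r (1 : R) (sqdist y y')
    (\sum_i 2 * (y r - y' r) 0 i * (v r (pi (y r)) - v r (pi (y' r))) 0 i).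
Proof.
move=> cy cy' sr.
have -> : sqdist y y' = \sum_i (fun r => y r 0 i - y' r 0 i) ^+ 2.
  by apply/funext => x; rewrite fct_sumE.
apply: is_derive_sum => i.
have h := is_deriveB (integral_curve_coord i cy sr) (integral_curve_coord i cy' sr).
apply: (@is_derive_eq _ _ _ _ _ _ _ _ (is_deriveX 2 h)).
by rewrite /= expr1 !mxE.
Qed.

Let sqdist_continuous s t y y' : integral_curve s y -> integral_curve s y' ->
  {within `[s, t], continuous (sqdist y y')}.
Proof.
move=> cy cy'.
have -> : sqdist y y' = \sum_i (fun r => (y r 0 i - y' r 0 i) ^+ 2).
  by apply/funext => x; rewrite fct_sumE.
elim/big_ind : _ => [r|f g cf cg r|i _ r]; first exact: cvg_cst.
  by apply: continuousD; [exact: cf|exact: cg].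
apply: (@continuous_comp (subspace `[s, t]) R R
  (fun r => y r 0 i - y' r 0 i) (fun x => x ^+ 2)).
  by apply: continuousB; exact: continuous_curve_coord.
exact: exprn_continuous.
Qed.

Let expR_sqr_le (x y c : R) : 0 <= x -> 0 <= y ->
  x ^+ 2 <= expR (2 * c) * y ^+ 2 -> x <= expR c * y.
Proof.
move=> x0 y0; have -> : 2 * c = c + c by ring.
rewrite expRD -expr2 -exprMn ler_sqr ?nnegrE//.
by rewrite mulr_ge0 ?expR_ge0.
Qed.

(** Gronwall's lemma is applied to the squared distance, which is
    differentiable everywhere.  The second estimate bounds the inverse of the
    flow. *)
Lemma integral_curve_gronwall T K s t y y' : velocity_bound T K -> 0 <= s <= t ->
  t <= T -> integral_curve s y -> integral_curve s y' ->
  enorm (y t - y' t) <= expR (K * (t - s)) * enorm (y s - y' s) /\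
  enorm (y s - y' s) <= expR (K * (t - s)) * enorm (y t - y' t).
Proof.
move=> [K0 _ KL] /andP[s0 st] tT cy cy'.
have bnd r : s < r < t ->
    `|\sum_i 2 * (y r - y' r) 0 i * (v r (pi (y r)) - v r (pi (y' r))) 0 i| <=
    2 * K * sqdist y y' r.
  move=> /andP[sr rt]; rewrite sqdistE.
  under eq_bigr do rewrite -mulrA; rewrite -mulr_sumr normrM ger0_norm// -mulrA.
  rewrite ler_wpM2l//; set w := y r - y' r; set u := v r _ - v r _.
  have uw : enorm u <= K * enorm w.
    apply: le_trans (KL r (pi (y r)) (pi (y' r)) _) _; first by lra.
    by rewrite ler_wpM2l// dist_cover.
  have wu : enorm w * enorm u <= K * enorm w ^+ 2.
    by rewrite expr2 mulrCA ler_wpM2l// enorm_ge0.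
  rewrite ler_norml; apply/andP; split; last exact: le_trans (cauchy_schwarz _ _) wu.
  have := cauchy_schwarz (- w) u; rewrite enormN.
  under eq_bigr do rewrite mxE mulNr; rewrite sumrN; lra.
have dn r : s < r < t -> is_derive r (1 : R) (sqdist y y')
    (\sum_i 2 * (y r - y' r) 0 i * (v r (pi (y r)) - v r (pi (y' r))) 0 i).
  by move=> /andP[sr _]; exact: (sqdist_derive cy cy' sr).
have cn := sqdist_continuous cy cy'.
split; apply: expR_sqr_le; rewrite ?enorm_ge0// -!sqdistE mulrA.
  apply: (gronwall st (cn t) dn) => r /bnd; rewrite ler_norml => /andP[] //.
apply: (gronwall_lower st (cn t) dn) => r /bnd; rewrite ler_norml => /andP[].
by rewrite mulNr.
Qed.

Lemma integral_curve_speed T K s t y : velocity_bound T K -> 0 <= s <= t ->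
  t <= T -> integral_curve s y -> enorm (y t - y s) <= d%:R * (K * (t - s)).
Proof.
move=> [K0 KV _] /andP[s0]; rewrite le_eqVlt => /predU1P[->|st] tT cy.
  by rewrite !subrr enorm0 !mulr0.
apply: enorm_le_coord => i; rewrite !mxE.
have [] := @MVT R (fun r => y r 0 i) (fun r => v r (pi (y r)) 0 i) s t st.
- move=> r; rewrite in_itv/= => /andP[sr _]; exact: integral_curve_coord cy sr.
- exact: continuous_curve_coord.
move=> r; rewrite in_itv/= => /andP[sr rt] ->.
rewrite normrM [X in _ * X]gtr0_norm ?subr_gt0// ler_wpM2r//; first by rewrite subr_ge0 ltW.
by apply: le_trans (coord_le_enorm _ _) _; apply: KV; lra.
Qed.

(** ** The flow *)

Context (Phi : R -> R -> Omega -> Omega).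
Hypothesis flowP : is_flow v Phi.

Lemma flow_curve s a : 0 <= s -> exists y, [/\ pi (y s) = a,
  integral_curve s y & forall t, s <= t -> Phi s t a = pi (y t)].
Proof. by move=> s0; have [y [? ? ? ?]] := flowP s0 a; exists y. Qed.

Lemma flow_id s a : 0 <= s -> Phi s s a = a.
Proof. by move=> /(flow_curve a)[y [ys _ ->]]. Qed.

Section bounds.
Context (T K : R).
Hypothesis TK : velocity_bound T K.
Let E := expR (K * T).

Lemma flow_factor_gt0 : 0 < E. Proof. exact: expR_gt0. Qed.

Let le_factor s t r : 0 <= s <= t -> t <= T -> 0 <= r ->
  expR (K * (t - s)) * r <= E * r.
Proof.
move=> st tT r0; rewrite ler_wpM2r// ler_expR.
by have [K0 _ _] := TK; rewrite ler_wpM2l//; lra.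
Qed.

(** One of the two curves is moved by a deck translation, to start at a lift
    that almost realizes the distance of the initial points. *)
Lemma flow_lipschitz s t a b : 0 <= s <= t -> t <= T ->
  dist (Phi s t a) (Phi s t b) <= E * dist a b.
Proof.
move=> /[dup] st /andP[s0 st'] tT.
have [y [ya cy Py]] := flow_curve a s0; have [z [zb cz Pz]] := flow_curve b s0.
rewrite -ler_pdivrMl ?flow_factor_gt0//; apply/ler_addgt0Pr => e e0.
have [x xb yx] : exists2 x, pi x = b & enorm (y s - x) < dist a b + e.
  by apply: dist_lift; rewrite ya ltrDl.
rewrite ler_pdivrMl ?flow_factor_gt0//.
pose z' r := z r + (x - z s).
have xz : pi x = pi (z s) by rewrite xb zb.
have cz' : integral_curve s z' by exact: integral_curve_shift.
have [h _] := integral_curve_gronwall TK st tT cy cz'.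
have zs : z' s = x by rewrite /z' addrC subrK.
rewrite zs in h; rewrite Py// Pz//.
have -> : pi (z t) = pi (z' t) by rewrite /z' cover_shift.
apply: le_trans (dist_cover _ _ _) _; apply: (le_trans h).
apply: (le_trans (le_factor st tT (enorm_ge0 _))).
by rewrite ler_wpM2l ?ltW// flow_factor_gt0.
Qed.

(** As in flow_lipschitz, but the lifts are matched at the final time. *)
Lemma flow_expansive s t a b : 0 <= s <= t -> t <= T ->
  dist a b <= E * dist (Phi s t a) (Phi s t b).
Proof.
move=> /[dup] st /andP[s0 st'] tT.
have [y [ya cy Py]] := flow_curve a s0; have [z [zb cz Pz]] := flow_curve b s0.
rewrite -ler_pdivrMl ?flow_factor_gt0//; apply/ler_addgt0Pr => e e0.
have [x xb yx] : exists2 x, pi x = Phi s t b &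
    enorm (y t - x) < dist (Phi s t a) (Phi s t b) + e.
  by apply: dist_lift; rewrite Py// ltrDl.
rewrite ler_pdivrMl ?flow_factor_gt0//.
pose z' r := z r + (x - z t).
have xz : pi x = pi (z t) by rewrite xb Pz.
have cz' : integral_curve s z' by exact: integral_curve_shift.
have [_ h] := integral_curve_gronwall TK st tT cy cz'.
have zt : z' t = x by rewrite /z' addrC subrK.
rewrite zt in h.
have -> : dist a b = dist (pi (y s)) (pi (z' s)) by rewrite ya /z' cover_shift// zb.
apply: le_trans (dist_cover _ _ _) _; apply: (le_trans h).
apply: (le_trans (le_factor st tT (enorm_ge0 _))).
by rewrite ler_wpM2l ?ltW// flow_factor_gt0.
Qed.

Lemma flow_measurable s t : 0 <= s <= t -> t <= T ->
  measurable_fun [set: B] (Phi s t : B -> B).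
Proof.
by move=> st tT; apply: (@lipschitz_map_measurable _ _ _ _ E) => a b; exact: flow_lipschitz.
Qed.

(** Uniqueness of integral curves, from Gronwall's estimate. *)
Lemma flow_comp r s t a : 0 <= r <= s -> s <= t -> t <= T ->
  Phi s t (Phi r s a) = Phi r t a.
Proof.
move=> /andP[r0 rs] st tT; have s0 := le_trans r0 rs.
have [y [ya cy Py]] := flow_curve a r0.
have [z [zb cz Pz]] := flow_curve (Phi r s a) s0.
have xz : pi (y s) = pi (z s) by rewrite zb Py.
pose z' q := z q + (y s - z s).
have cz' : integral_curve s z' by exact: integral_curve_shift.
have cy' := integral_curveW rs cy.
have zs : z' s = y s by rewrite /z' addrC subrK.
have [|h _] := integral_curve_gronwall TK _ tT cy' cz'; first by rewrite s0.
move: h; rewrite zs subrr enorm0 mulr0 => h.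
rewrite Pz// Py ?(le_trans rs)//.
have -> : pi (z t) = pi (z' t) by rewrite /z' cover_shift.
apply/esym/(dist_eq0 (k := k))/eqP; rewrite eq_le dist_ge0 andbT.
exact: le_trans (dist_cover _ _ _) h.
Qed.

Lemma flow_time s s' t a : 0 <= s <= s' -> s' <= t -> t <= T ->
  dist (Phi s t a) (Phi s' t a) <= E * (d%:R * (K * (s' - s))).
Proof.
move=> /[dup] ss /andP[s0 ss'] s't tT; have s'0 := le_trans s0 ss'.
rewrite -(flow_comp _ ss s't tT).
apply: le_trans; first by apply: flow_lipschitz tT; rewrite s'0.
rewrite ler_pM2l ?flow_factor_gt0//.
have [y [ya cy Py]] := flow_curve a s0; rewrite Py// -[X in dist _ X]ya.
apply: le_trans (dist_cover _ _ _) _.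
by apply: integral_curve_speed TK ss _ cy; exact: le_trans tT.
Qed.

End bounds.
End velocity.

(** * The flat norm *)

Section flat_metric.
Context (R : realType) (d : nat) (k : domain).
Local Notation Omega := (phase_space R d k).
Local Notation B := (borel R d k).
Local Notation M := (signed_measure R d k).
Implicit Types (mu nu m : M) (g : Omega -> R).

Definition flat_test g := (forall a, `|g a| <= 1) /\
  (forall a b, `|g a - g b| <= dist a b).

Lemma flat_testP g :
  ((supnorm Num.norm g <= 1)%E /\ (lipconst Num.norm g <= 1)%E) <-> flat_test g.
Proof.
split => [[gs gl]|[gs gl]]; split.
- move=> a; rewrite -lee_fin; apply: le_trans gs.
  by apply: ereal_sup_ubound; exists a.
- move=> a b; have [ab|ab] := eqVneq (dist a b) 0.
    by rewrite ab (dist_eq0 ab) subrr normr0.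
  have ab0 : 0 < dist a b by rewrite lt_neqAle eq_sym ab dist_ge0.
  rewrite -[leRHS]mul1r -ler_pdivrMr// -lee_fin; apply: le_trans gl.
  by apply: ereal_sup_ubound; exists (a, b).
- by apply: ge_ereal_sup => _ [a _ <-]; rewrite lee_fin.
- apply: ge_ereal_sup => _ [[a b] _ <-]; rewrite lee_fin /=.
  have [ab|ab] := eqVneq (dist a b) 0; first by rewrite ab invr0 mulr0.
  by rewrite ler_pdivrMr ?mul1r// lt_neqAle eq_sym ab dist_ge0.
Qed.

Lemma flat_test_measurable g : flat_test g -> measurable_fun [set: B] (g : B -> R).
Proof.
by move=> [_ gl]; apply: (@lipschitz_measurable _ _ _ g 1) => a b; rewrite mul1r.
Qed.

Lemma flat_test_bounded g : flat_test g -> bounded_measurable (g : B -> R).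
Proof.
by move=> gt; split; [exact: flat_test_measurable|exists 1; exact: gt.1].
Qed.

Lemma flat_testN g : flat_test g -> flat_test (fun a => - g a).
Proof.
move=> [gs gl]; split => [a|a b]; first by rewrite normrN.
by rewrite -opprD normrN.
Qed.

Lemma flat_test0 : flat_test (fun=> 0).
Proof. by split => [a|a b]; rewrite ?subr0 normr0// ?ler01 ?dist_ge0. Qed.

Lemma FMnorm_ub mu : ubound [set cintegral mu setT g | g in
    [set g | (supnorm Num.norm g <= 1)%E /\ (lipconst Num.norm g <= 1)%E]] (TVnorm mu).
Proof.
move=> _ [g /flat_testP gt <-]; apply: le_trans (ler_norm _) _.
rewrite -[leRHS]mul1r; apply: cintegral_le_TV; [exact: flat_test_measurable|exact: gt.1].
Qed.

Lemma cintegral_le_FM mu g : flat_test g -> `|cintegral mu setT g| <= FMnorm mu.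
Proof.
move=> gt; have H g' : flat_test g' -> cintegral mu setT g' <= FMnorm mu.
  move=> g't; apply: ub_le_sup; first by exists (TVnorm mu); exact: FMnorm_ub.
  by exists g' => //; exact/flat_testP.
rewrite ler_norml H// andbT lerNl.
have := H _ (flat_testN gt).
have -> : (fun a => - g a) = (fun a => -1 * g a) by apply/funext => a; rewrite mulN1r.
by rewrite cintegral_funZ ?mulN1r//; exact: flat_test_bounded.
Qed.

Lemma FMnorm_le mu c : (forall g, flat_test g -> cintegral mu setT g <= c) ->
  FMnorm mu <= c.
Proof.
move=> H; apply: ge_sup; last by move=> _ [g /flat_testP gt <-]; exact: H.
by exists (cintegral mu setT (fun=> 0)); exists (fun=> 0) => //; apply/flat_testP/flat_test0.
Qed.

Lemma FMnorm_eq mu nu : charge_eq mu nu -> FMnorm mu = FMnorm nu.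
Proof.
suff H m1 m2 : charge_eq m1 m2 -> FMnorm m1 <= FMnorm m2.
  by move=> mn; apply/eqP; rewrite eq_le !H// => A mA; rewrite mn.
move=> mm; apply: FMnorm_le => g gt.
rewrite (cintegral_eq _ (flat_test_bounded gt) mm)//.
by apply: le_trans (ler_norm _) (cintegral_le_FM _ gt).
Qed.

Lemma cintegral_le_FM_scaled mu g c : 0 < c -> (forall a, `|g a| <= c) ->
  (forall a b, `|g a - g b| <= c * dist a b) ->
  `|cintegral mu setT g| <= c * FMnorm mu.
Proof.
move=> c0 gs gl; have gt : flat_test (fun a => c^-1 * g a).
  split => [a|a b]; rewrite -?mulrBr normrM gtr0_norm ?invr_gt0//.
    by rewrite ler_pdivrMl ?mulr1.
  by rewrite ler_pdivrMl.
have := cintegral_le_FM mu gt; rewrite cintegral_funZ//.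
  by rewrite normrM gtr0_norm ?invr_gt0// ler_pdivrMl.
split; last by exists c.
exact: lipschitz_measurable gl.
Qed.

Lemma FMnorm_push (h : Omega -> Omega) mu c : 1 <= c ->
  (forall a b, dist (h a) (h b) <= c * dist a b) ->
  FMnorm (cpush h mu) <= c * FMnorm mu.
Proof.
move=> c1 hc; have mh := lipschitz_map_measurable hc.
have c0 : 0 < c by apply: lt_le_trans c1.
apply: FMnorm_le => g gt; rewrite (cintegral_push _ mh (flat_test_bounded gt)).
apply: le_trans (ler_norm _) _; apply: cintegral_le_FM_scaled => //.
  by move=> a; apply: le_trans c1; exact: gt.1.
by move=> a b; apply: le_trans (gt.2 _ _) _.
Qed.

(** A test function changes by at most c along h1 and h2. *)
Lemma FMnorm_push_sub (h1 h2 : Omega -> Omega) mu c :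
  measurable_fun [set: B] (h1 : B -> B) -> measurable_fun [set: B] (h2 : B -> B) ->
  (forall a, dist (h1 a) (h2 a) <= c) ->
  FMnorm (csub (cpush h1 mu) (cpush h2 mu)) <= c * TVnorm mu.
Proof.
move=> m1 m2 h12; apply: FMnorm_le => g gt; have bg := flat_test_bounded gt.
rewrite cintegral_sub// !cintegral_push//.
have b1 := bounded_measurable_comp m1 bg; have b2 := bounded_measurable_comp m2 bg.
have -> : cintegral mu setT (g \o h1) - cintegral mu setT (g \o h2) =
    cintegral mu setT (fun a => (g \o h1) a + -1 * (g \o h2) a).
  rewrite cintegral_funD//; last exact: bounded_measurable_scale.
  by rewrite cintegral_funZ// mulN1r.
apply: le_trans (ler_norm _) _; apply: cintegral_le_TV.
  by have [] := bounded_measurable_add b1 (bounded_measurable_scale (-1) b2).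
by move=> a; rewrite mulN1r; apply: le_trans (gt.2 _ _) _.
Qed.

(** Constants are test functions, so the mass of a positive measure is
    controlled by the flat norm. *)
Lemma TVnorm_le_FM mu nu : charge_pos mu ->
  TVnorm mu <= TVnorm nu + FMnorm (csub mu nu).
Proof.
move=> mu0; have g1 : flat_test (fun=> 1).
  by split => [a|a b]; rewrite ?normr1// subrr normr0 dist_ge0.
have b1 := flat_test_bounded g1.
rewrite TVnorm_pos// -[leLHS]mul1r -(cintegral_cst mu 1 measurableT).
have := cintegral_le_FM (csub mu nu) g1; rewrite cintegral_sub// ler_norml => /andP[_ h1].
have : cintegral nu setT (fun=> 1) <= TVnorm nu.
  apply: le_trans (ler_norm _) _; rewrite -[leRHS]mul1r; apply: cintegral_le_TV.
    exact: b1.1.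
  by move=> a; rewrite normr1.
lra.
Qed.

(** ** The completion *)

Section completion.
Context (E : completeNormedModType R) (iota : M -> E).
Hypothesis iotaP : is_FM_completion iota.

Lemma norm_iota mu : `|iota mu| = FMnorm mu.
Proof. by case: iotaP. Qed.

Lemma iota_add mu nu : iota (cadd mu nu) = iota mu + iota nu.
Proof. by case: iotaP. Qed.

Lemma iota_scale c mu : iota (cscale c mu) = c *: iota mu.
Proof. by case: iotaP. Qed.

Lemma FMnorm_null mu : (forall A, measurable A -> mu A = 0%E) -> FMnorm mu = 0.
Proof.
move=> mu0; rewrite -(normr0 E) -[0 in RHS](scale0r (iota mu)) -iota_scale norm_iota.
by apply: FMnorm_eq => A mA; rewrite cscaleE mul0e mu0.
Qed.

Lemma iota_opp mu : iota (copp mu) = - iota mu.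
Proof.
apply/eqP; rewrite -subr_eq0 opprK -iota_add -normr_eq0 norm_iota; apply/eqP.
apply: FMnorm_null => A mA; rewrite caddE coppE addeC subee//.
exact: fin_num_measure.
Qed.

Lemma iota_sub mu nu : iota (csub mu nu) = iota mu - iota nu.
Proof. by rewrite iota_add iota_opp. Qed.

Lemma FMnorm_sub mu nu : FMnorm (csub mu nu) = `|iota mu - iota nu|.
Proof. by rewrite -iota_sub norm_iota. Qed.

Lemma iota_eq mu nu : charge_eq mu nu -> iota mu = iota nu.
Proof.
move=> mn; apply/eqP; rewrite -subr_eq0 -normr_eq0 -FMnorm_sub; apply/eqP.
apply: FMnorm_null => A mA; rewrite caddE coppE mn// subee//.
exact: fin_num_measure.
Qed.

End completion.

(** ** Closedness of the positive cone *)

Lemma cintegral_le_variation mu (g : B -> R) : bounded_measurable g ->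
  (`|cintegral mu setT g|%:E <= \int[measure_add (jordan_pos (hahnP mu))
     (jordan_neg (hahnP mu))]_x `|g x|%:E)%E.
Proof.
move=> bg; have bgn : bounded_measurable (fun x => `|g x|).
  case: bg => mg [c gc]; split; first exact: measurableT_comp.
  by exists c => x; rewrite normr_id.
set jp := jordan_pos _; set jn := jordan_neg _.
have jpi := bounded_measurable_integrable (finite_measure_lty jp) measurableT bg.
have jni := bounded_measurable_integrable (finite_measure_lty jn) measurableT bg.
rewrite ge0_integral_measure_add//; last exact: bounded_measurable_EFin.
rewrite /cintegral -/jp -/jn.
apply: (@le_trans _ _ ((`|\int[jp]_x g x| + `|\int[jn]_x g x|)%:E)).
  by rewrite lee_fin ler_normB.
rewrite EFinD !EFin_normr_Rintegral// leeD// (le_trans (le_abse_integral _ _ _))//;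
exact: measurable_int jpi || exact: measurable_int jni.
Qed.

Lemma variation_lty mu :
  (measure_add (jordan_pos (hahnP mu)) (jordan_neg (hahnP mu)) setT < +oo)%E.
Proof. by apply: measure_add_lty; exact: finite_measure_lty. Qed.

(** The value of mu at A is a limit of integrals of nonnegative Lipschitz
    functions, and these pass to the limit in the flat norm. *)
Lemma charge_pos_closed mu :
  (forall e, 0 < e -> exists2 m, charge_pos m & FMnorm (csub m mu) <= e) ->
  charge_pos mu.
Proof.
move=> H A mA; rewrite -[mu A]fineK ?fin_num_measure// lee_fin.
rewrite -[fine _]mul1r -(cintegral_cst mu 1 mA).
apply/ler_addgt0Pr => e e0; have [psi psiL gap] := lipschitz_indic_gap (variation_lty mu) mA e0.
have bpsi := lipschitz_unit_bounded psiL.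
have bA := bounded_measurable_indic mA.
have E1 : cintegral mu A (fun=> 1) = cintegral mu setT (\1_A : B -> R).
  by rewrite cintegral_cst// mul1r cintegral_indic.
have h1 : `|cintegral mu setT (fun x => psi x + -1 * \1_A x)| <= e.
  rewrite -lee_fin; apply: le_trans gap; apply: le_trans.
    apply: cintegral_le_variation; apply: bounded_measurable_add => //.
    exact: bounded_measurable_scale.
  by under eq_integral do rewrite mulN1r.
rewrite E1; have h2 : 0 <= cintegral mu setT psi.
  apply/ler_addgt0Pr => e' e'0; have [p01 [L L0 pL]] := psiL.
  have L1 : 0 < L + 1 by rewrite ltr_wpDl.
  have [m m0 mmu] := H (e' / (L + 1)) (divr_gt0 e'0 L1).
  have h3 : `|cintegral (csub m mu) setT psi| <= (L + 1) * FMnorm (csub m mu).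
    apply: cintegral_le_FM_scaled => // [a|a b].
      by have /andP[? ?] := p01 a; rewrite ger0_norm//; lra.
    by apply: le_trans (pL a b) _; rewrite ler_wpM2r ?dist_ge0//; lra.
  rewrite cintegral_sub// in h3.
  have h4 : (L + 1) * FMnorm (csub m mu) <= e' by rewrite mulrC -ler_pdivlMr.
  have := cintegral_ge0 m0 measurableT bpsi (fun x _ => proj1 (andP (p01 x))).
  move=> h5; move: (le_trans h3 h4); rewrite ler_norml; lra.
move: h1; rewrite cintegral_funD//; last exact: bounded_measurable_scale.
rewrite cintegral_funZ// ler_norml; lra.
Qed.

End flat_metric.

(** * Duality between L^p bounds and test functions *)

Section density.
Context (R : realType) (d : nat) (k : domain).
Local Notation Omega := (phase_space R d k).
Local Notation B := (borel R d k).
Local Notation M := (signed_measure R d k).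
Context (lam : {sigma_finite_measure set B -> \bar R}).
Implicit Types (m : M) (g : B -> R).

Lemma bounded_measurable_bounded g : bounded_measurable g ->
  [bounded g x | x in [set: B]].
Proof.
move=> [_ [c gc]]; exists c; split; first by rewrite num_real.
by move=> y cy x _; rewrite /= (le_trans (gc x)) ?ltW.
Qed.

Lemma integrable_density_mul m g : m `<< lam -> bounded_measurable g ->
  lam.-integrable setT (fun x => ((g x)%:E * Radon_Nikodym m lam x)%E).
Proof.
move=> mlam bg; have := integrableMl measurableT (Radon_Nikodym_integrable mlam)
  bg.1 (bounded_measurable_bounded bg).
by apply: eq_integrable => // x _; rewrite /= muleC.
Qed.

(** The two Jordan parts have densities, whose difference is the density of m
    almost everywhere. *)
Lemma cintegral_density m g : m `<< lam -> bounded_measurable g ->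
  ((cintegral m setT g)%:E = \int[lam]_x ((g x)%:E * Radon_Nikodym m lam x))%E.
Proof.
move=> mlam bg.
have jpl := jordan_pos_dominates (hahnP m) mlam.
have jnl := jordan_neg_dominates (hahnP m) mlam.
set jp := jordan_pos (hahnP m) in jpl *; set jn := jordan_neg (hahnP m) in jnl *.
pose cp : M := charge_of_finite_measure jp; pose cn : M := charge_of_finite_measure jn.
have cpl : cp `<< lam by [].
have cnl : cn `<< lam by [].
have ip := bounded_measurable_integrable (finite_measure_lty jp) measurableT bg.
have jn' := bounded_measurable_integrable (finite_measure_lty jn) measurableT bg.
rewrite /cintegral -/jp -/jn EFinB /Rintegral !fineK ?integrable_fin_num//.
rewrite -(Radon_Nikodym_change_of_variables jpl measurableT ip).
rewrite -(Radon_Nikodym_change_of_variables jnl measurableT jn').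
rewrite -integralB//; [|exact: integrable_density_mul cpl bg|
  exact: integrable_density_mul cnl bg].
have AE : ae_eq lam setT (Radon_Nikodym m lam)
    (fun x => Radon_Nikodym cp lam x - Radon_Nikodym cn lam x)%E.
  apply: integral_ae_eq => //.
  - exact: Radon_Nikodym_integrable.
  - apply: emeasurable_funB.
      exact: measurable_int (Radon_Nikodym_integrable cpl).
    exact: measurable_int (Radon_Nikodym_integrable cnl).
  move=> A _ mA; rewrite -Radon_Nikodym_integral// integralB//.
  - rewrite -(Radon_Nikodym_integral cpl mA) -(Radon_Nikodym_integral cnl mA).
    exact: jordan_sub.
  - exact: (integrableS measurableT _ _ (Radon_Nikodym_integrable cpl)).
  - exact: (integrableS measurableT _ _ (Radon_Nikodym_integrable cnl)).
apply: ae_eq_integral => //.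
- apply: emeasurable_funB.
    exact: measurable_int (integrable_density_mul cpl bg).
  exact: measurable_int (integrable_density_mul cnl bg).
- exact: measurable_int (integrable_density_mul mlam bg).
apply: filterS AE => x /(_ I) E _; rewrite E muleBr//.
by rewrite fin_num_adde_defr// Radon_Nikodym_fin_num.
Qed.

(** The conjugate exponent of p > 1 is finite; this is what makes Lipschitz
    functions dense among the test functions below. *)
Definition conjugate_exponents (p : \bar R) (q : R) : Prop :=
  match p with
  | p0%:E => [/\ 1 < p0, 1 < q & p0^-1 + q^-1 = 1]
  | +oo%E => q = 1
  | -oo%E => False
  end.

Lemma conjugate_exponents_exist p : (1 < p)%E -> exists q, conjugate_exponents p q.
Proof.
case: p => [p0|_|//]; last by exists 1.
rewrite lte_fin => p1; exists (p0 / (p0 - 1)); split => //.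
  by rewrite ltr_pdivlMr ?subr_gt0//; lra.
field; lra.
Qed.

Lemma conjugate_exponents_ge1 p q : conjugate_exponents p q -> 1 <= q.
Proof. by case: p => [p0 [_ /ltW]|->|]. Qed.

Local Notation N q g := (Lnorm lam q%:E (EFin \o (g : B -> R))).

(** For a positive measure m and conjugate exponents p and q this says that the
    density of m has L^p norm at most K, without mentioning the density.  In this
    form the bound is stable under sums, under push-forward and under limits in
    the flat norm. *)
Definition dual_ball (q K : R) m := forall g, bounded_measurable g ->
  (forall x, 0 <= g x) -> (`|cintegral m setT g|%:E <= K%:E * N q g)%E.

Lemma dual_ball_add q K1 K2 m1 m2 : 0 <= K1 -> 0 <= K2 ->
  dual_ball q K1 m1 -> dual_ball q K2 m2 -> dual_ball q (K1 + K2) (cadd m1 m2).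
Proof.
move=> K10 K20 h1 h2 g bg g0; rewrite cintegral_add// EFinD ge0_muleDl ?lee_fin//.
apply: le_trans (leeD (h1 g bg g0) (h2 g bg g0)).
by rewrite -EFinD lee_fin ler_normD.
Qed.

Lemma dual_ball_scale q K c m : 0 <= c -> dual_ball q K m ->
  dual_ball q (c * K) (cscale c m).
Proof.
move=> c0 h g bg g0; rewrite cintegral_scale// normrM ger0_norm// !EFinM -muleA.
by apply: lee_wpmul2l; [rewrite lee_fin|exact: h].
Qed.

Lemma dual_ball_eq q K m1 m2 : charge_eq m1 m2 -> dual_ball q K m1 ->
  dual_ball q K m2.
Proof.
move=> m12 h g bg g0; rewrite (cintegral_eq _ bg (nu := m1))//; first exact: h.
by move=> A mA; rewrite m12.
Qed.

Lemma dual_ball_le q K K' m : K <= K' -> dual_ball q K m -> dual_ball q K' m.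
Proof.
move=> KK' h g bg g0; apply: le_trans (h g bg g0) _.
by apply: lee_wpmul2r; [exact: Lnorm_ge0|rewrite lee_fin].
Qed.

(** By the hypothesis on h, the L^q norm of g o h is at most C^(1/q) times that
    of g. *)
Lemma dual_ball_push q K C (h : Omega -> Omega) m : 1 <= q -> 0 <= K -> 0 <= C ->
  measurable_fun [set: B] (h : B -> B) ->
  (forall A : set B, measurable A -> (lam (h @^-1` A) <= C%:E * lam A)%E) ->
  dual_ball q K m -> dual_ball q (C `^ q^-1 * K) (cpush h m).
Proof.
move=> q1 K0 C0 mh hC hm g bg g0; have bgh := bounded_measurable_comp mh bg.
rewrite (cintegral_push _ mh bg); apply: le_trans (hm _ bgh (fun x => g0 _)) _.
rewrite mulrC EFinM -muleA; apply: lee_wpmul2l; first by rewrite lee_fin.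
have q0 : 0 < q by apply: lt_le_trans q1.
rewrite unlock.
pose F x := (`|(g x)%:E| `^ q)%E.
have F0 x : (0 <= F x)%E by exact: poweR_ge0.
have mF : measurable_fun [set: B] F.
  apply: (measurableT_comp (measurable_poweR _)).
  by apply: measurableT_comp => //; apply/measurable_EFinP; exact: bg.1.
have intF : (\int[lam]_x F (h x) <= C%:E * \int[lam]_x F x)%E.
  pose hl := measure_function_pushforward__canonical__measure_function_Measure lam mh.
  have -> : (\int[lam]_x F (h x) = \int[hl]_x F x)%E.
    by rewrite ge0_integral_pushforward.
  have -> : (C%:E * \int[lam]_x F x = \int[mscale (NngNum C0) lam]_x F x)%E.
    by rewrite ge0_integral_mscale.
  exact: ge0_le_measure_integral.
rewrite -poweR_EFin.
rewrite -poweRM//; last by apply: integral_ge0 => x _; exact: F0.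
apply: gt0_ler_poweR.
- by rewrite invr_ge0 ltW.
- by rewrite in_itv/= leey andbT; apply: integral_ge0 => x _; exact: F0.
- rewrite in_itv/= leey andbT; apply: mule_ge0 => //.
  by apply: integral_ge0 => x _; exact: F0.
- exact: intF.
Qed.

Lemma hoelder_dual_ball p q K m : 0 <= K -> conjugate_exponents p q ->
  (Lpnorm lam p m <= K%:E)%E -> dual_ball q K m.
Proof.
move=> K0 pq; rewrite /Lpnorm; case: ifPn => [/asboolP mlam|_]; last by rewrite leNgt ltry.
set phi := Radon_Nikodym m lam => phiK g bg g0.
pose phir x : R := fine (phi x).
have phiE x : phi x = (phir x)%:E by rewrite fineK// Radon_Nikodym_fin_num.
have mphi : measurable_fun [set: B] phir.
  apply: measurableT_comp => //.
  exact: measurable_int (Radon_Nikodym_integrable mlam).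
have -> : `|cintegral m setT g|%:E = `|(cintegral m setT g)%:E|%E by [].
rewrite cintegral_density//.
apply: (@le_trans _ _ (\int[lam]_x `|(g x)%:E * phi x|)%E).
  apply: le_abse_integral => //.
  exact: measurable_int (integrable_density_mul mlam bg).
have phifun : phi = EFin \o phir by apply/funext => x; exact: phiE.
move: pq phiK; case: p => [p0 [p1 q1 pq]|->|//] phiK.
  have := @hoelder _ _ _ lam phir g p0 q mphi bg.1.
  move=> /(_ _ _ pq) hh; have {}hh := hh (lt_trans ltr01 p1) (lt_trans ltr01 q1).
  apply: (@le_trans _ _ (Lnorm lam 1%E (EFin \o (phir \* g)%R))).
    rewrite Lnorm1 le_eqVlt; apply/orP; left; apply/eqP; apply: eq_integral => x _.
    by rewrite phiE -EFinM mulrC.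
  apply: (le_trans hh); apply: lee_wpmul2r; first exact: Lnorm_ge0.
  by rewrite -phifun.
have phiae : \forall x \ae lam, (`|phi x| <= K%:E)%E.
  move: phiK; rewrite unlock /=; case: ifPn => [_ /ess_supP //|].
  rewrite -leNgt => lam0 _; exists setT; split => //.
  by apply/eqP; rewrite eq_le lam0 measure_ge0.
have mg : measurable_fun [set: B] (fun x => `|(EFin \o g) x|)%E.
  by apply: measurableT_comp => //; apply/measurable_EFinP; exact: bg.1.
rewrite Lnorm1 -ge0_integralZl//.
apply: ae_ge0_le_integral => //.
- apply: measurableT_comp => //.
  exact: measurable_int (integrable_density_mul mlam bg).
- by move=> x _; apply: mule_ge0; rewrite ?lee_fin.
- exact: measurable_funeM.
apply: filterS phiae => x phix _; rewrite abseM muleC.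
by apply: lee_wpmul2r.
Qed.

Lemma density_ae_ge0 m : m `<< lam -> charge_pos m ->
  {ae lam, forall x, (0 <= Radon_Nikodym m lam x)%E}.
Proof.
move=> mlam m0; set phi := Radon_Nikodym m lam.
have mphi : measurable_fun [set: B] phi.
  exact: measurable_int (Radon_Nikodym_integrable mlam).
pose A : set B := [set x | (phi x < 0)%E].
have mA : measurable A.
  rewrite /A -[X in measurable X]setTI.
  by apply: emeasurable_fun_infty_o.
have E : (\int[lam]_(x in A) `|phi x| = - m A)%E.
  rewrite (Radon_Nikodym_integral mlam mA) -integralN/=.
    by apply: eq_integral => x; rewrite inE => xA; rewrite lee0_abs// ltW.
  rewrite fin_num_adde_defl// fin_numN; apply: integrable_neg_fin_num => //.
  by apply: integrableS (Radon_Nikodym_integrable mlam).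
have : (\int[lam]_(x in A) `|phi x| = 0)%E.
  have : (0 <= \int[lam]_(x in A) `|phi x|)%E by exact: integral_ge0.
  rewrite E oppe_ge0 => mA0; apply/eqP.
  by rewrite oppe_eq0 eq_le mA0 m0.
have mphiA : measurable_fun A phi by exact: measurable_funTS.
move=> /(ae_eq_integral_abs lam mA mphiA).1; apply: filterS => x /= xA.
by rewrite leNgt; apply/negP => /[dup] /xA ->; rewrite ltxx.
Qed.

Let ball n : set B := [set a | dist (@cover_map R d k 0) a < n.+1%:R].

Let ball_le i j : (i <= j)%N -> ball i `<=` ball j.
Proof. by move=> ij a /lt_le_trans; apply; rewrite ler_nat. Qed.

Let ball_archi (r : R) a : exists n, r <= n%:R /\ ball n a.
Proof.
pose s := Num.max (dist (@cover_map R d k 0) a) `|r|.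
have s0 : 0 <= s by rewrite le_max normr_ge0 orbT.
have := archi_boundP s0; set n := Num.Def.archi_bound s => sn.
exists n; split.
  apply: le_trans (ler_norm r) _; apply: le_trans _ (ltW sn).
  by rewrite le_max lexx orbT.
rewrite /ball/=; apply: (@le_lt_trans _ _ s); first by rewrite le_max lexx.
by apply: lt_le_trans sn _; rewrite ler_nat.
Qed.

Section lebesgue_density.
Hypothesis lamL : is_lebesgue lam.

Let mball n : measurable (ball n).
Proof. exact: open_borel (open_ball_dist _ _). Qed.

Let ball_lty n : (lam (ball n) < +oo)%E.
Proof. exact: lebesgue_ball_lty. Qed.

Lemma dual_ball_dominates q K m : 0 < q -> dual_ball q K m -> m `<< lam.
Proof.
move=> q0 mK; apply/null_content_dominatesP => A mA lamA.
have bA := bounded_measurable_indic mA.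
have := mK _ bA (fun x => _); rewrite cintegral_indic//.
have -> : N q (\1_A) = 0%E.
  rewrite unlock (_ : (\int[lam]_x _)%E = 0%E); first by rewrite poweR0r// invr_neq0// gt_eqF.
  have <- : (\int[lam]_x (\1_A x)%:E = 0)%E by rewrite integral_indic// setIT.
  apply: eq_integral => x _ /=.
  by rewrite indicE; case: (_ \in _); rewrite ?normr1 ?normr0 ?powR1// powR0// gt_eqF.
move=> h; have {}h := h (fun x => ltac:(rewrite indicE; exact: ler0n)).
move: h; rewrite mule0 lee_fin normr_le0 => /eqP h.
by rewrite -(fineK (fin_num_measure m _ mA)) h.
Qed.

(** The converse of Hoelder's inequality.  For finite p the density phi is
    truncated to phi_n, bounded and with bounded support; the test function
    phi_n ^ (p - 1) gives int phi_n ^ p <= K (int phi_n ^ p) ^ (1 / q) with a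
    finite integral, hence int phi_n ^ p <= K ^ p, and n tends to infinity.  For
    infinite p the test functions are the indicators of the sets of finite
    measure where phi >= K + 1 / j. *)
Lemma dual_ball_Lpnorm p q K m : conjugate_exponents p q -> 0 <= K ->
  charge_pos m -> dual_ball q K m -> (Lpnorm lam p m <= K%:E)%E.
Proof.
move=> pq K0 m0 mK.
have q0 : 0 < q := lt_le_trans ltr01 (conjugate_exponents_ge1 pq).
have mlam := dual_ball_dominates q0 mK.
rewrite /Lpnorm ifT; last exact/asboolP.
set phi := Radon_Nikodym m lam.
have mphi : measurable_fun [set: B] phi.
  exact: measurable_int (Radon_Nikodym_integrable mlam).
pose psi x : R := `|fine (phi x)|.
have phipsi : {ae lam, forall x, phi x = (psi x)%:E}.
  apply: filterS (density_ae_ge0 mlam m0) => x phi0.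
  by rewrite /psi ger0_norm ?fine_ge0// fineK// Radon_Nikodym_fin_num.
have psi0 x : 0 <= psi x by exact: normr_ge0.
have mpsi : measurable_fun [set: B] psi.
  by apply: measurableT_comp => //; apply: measurableT_comp.
have pairing g : bounded_measurable g ->
    ((cintegral m setT g)%:E = \int[lam]_x (g x * psi x)%:E)%E.
  move=> bg; rewrite cintegral_density//; apply: ae_eq_integral => //.
  - exact: measurable_int (integrable_density_mul mlam bg).
  - by apply/measurable_EFinP; apply: measurable_funM => //; exact: bg.1.
  by apply: filterS phipsi => x E _; rewrite -/phi E EFinM.
move: pq; case: p => [p0 [p1 q1 pq]|q1|//].
  have p00 : 0 < p0 by apply: lt_trans p1.
  have pq' : (p0 - 1) * q = p0.
    have : p0^-1 * (p0 * q) + q^-1 * (p0 * q) = p0 * q by rewrite -mulrDl pq mul1r.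
    have -> : p0^-1 * (p0 * q) = q by rewrite mulKf// gt_eqF.
    have -> : q^-1 * (p0 * q) = p0 by rewrite mulrC mulfK// gt_eqF.
    lra.
  pose phn n x : R := Num.min (psi x) n%:R * \1_(ball n) x.
  have phn0 n x : 0 <= phn n x.
    by rewrite mulr_ge0 ?le_min ?psi0 ?ler0n// indicE ler0n.
  have phn_le n x : phn n x <= psi x.
    rewrite /phn indicE; case: (_ \in _); rewrite ?mulr1 ?mulr0//.
    by rewrite ge_min lexx.
  have phn_n n x : phn n x <= n%:R.
    rewrite /phn indicE; case: (_ \in _); rewrite ?mulr1 ?mulr0//.
    by rewrite ge_min lexx orbT.
  have mphn n : measurable_fun [set: B] (phn n).
    apply: measurable_funM; last exact: measurable_indic.
    by apply: measurable_minr.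
  pose g n x := phn n x `^ (p0 - 1).
  have bg n : bounded_measurable (g n).
    split; first exact: (measurableT_comp (measurable_powR _) (mphn n)).
    exists (n%:R `^ (p0 - 1)) => x; rewrite ger0_norm ?powR_ge0//.
    by apply: ge0_ler_powR; rewrite ?nnegrE ?subr_ge0 ?(ltW p1).
  pose I n := (\int[lam]_x (phn n x `^ p0)%:E)%E.
  have mI n : measurable_fun [set: B] (fun x => (phn n x `^ p0)%:E).
    by apply/measurable_EFinP; exact: (measurableT_comp (measurable_powR _) (mphn n)).
  have I0 n : (0 <= I n)%E by apply: integral_ge0 => x _; rewrite lee_fin powR_ge0.
  have Ifin n : (I n < +oo)%E.
    apply: (@le_lt_trans _ _ (\int[lam]_x ((n%:R `^ p0)%:E * (\1_(ball n) x)%:E))%E).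
      apply: ge0_le_integral => //.
      - by move=> x _; rewrite lee_fin powR_ge0.
      - by apply/measurable_EFinP; apply: measurable_funM => //; exact: measurable_indic.
      move=> x _; rewrite -EFinM lee_fin /phn indicE; case: (_ \in _).
        rewrite !mulr1; apply: ge0_ler_powR; rewrite ?nnegrE ?(ltW p00)//.
          by rewrite le_min psi0 ler0n.
        by rewrite ge_min lexx orbT.
      by rewrite !mulr0 powR0// gt_eqF.
    rewrite ge0_integralZl ?lee_fin ?powR_ge0//; last first.
      exact/measurable_EFinP/measurable_indic.
    rewrite integral_indic// setIT; apply: lte_mul_pinfty => //.
    exact: ball_lty.
  have Ile n : (I n <= (K `^ p0)%:E)%E.
    have h1 : (I n <= (cintegral m setT (g n))%:E)%E.
      rewrite pairing//; apply: ge0_le_integral => //.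
      - by move=> x _; rewrite lee_fin powR_ge0.
      - by apply/measurable_EFinP; apply: measurable_funM => //; exact: (bg n).1.
      move=> x _; rewrite lee_fin /g.
      have {1}-> : p0 = (p0 - 1) + 1 by rewrite subrK.
      rewrite powRD; last by rewrite subrK gt_eqF.
      by rewrite powRr1// ler_wpM2l// powR_ge0.
    have h2 : ((cintegral m setT (g n))%:E <= K%:E * I n `^ q^-1)%E.
      apply: le_trans (le_trans (mK _ (bg n) (fun x => powR_ge0 _ _)) _).
        by rewrite lee_fin ler_norm.
      rewrite unlock; apply: lee_wpmul2l; first by rewrite lee_fin.
      have gq x : (`|(g n x)%:E| `^ q)%E = (phn n x `^ p0)%:E.
        by rewrite abse_EFin ger0_norm ?powR_ge0// poweR_EFin /g -powRrM pq'.
      have -> : (\int[lam]_x (`|(EFin \o g n) x| `^ q))%E = I n.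
        by apply: eq_integral => x _; exact: gq.
      exact: lexx.
    have := le_trans h1 h2; have := Ifin n; have := I0 n.
    case: (I n) => [r|//|//]; rewrite lee_fin => r0 _.
    rewrite poweR_EFin -EFinM !lee_fin.
    move: r0; rewrite le_eqVlt => /predU1P[<- _|r0 rK]; first exact: powR_ge0.
    have rp : r `^ p0^-1 <= K.
      rewrite -(ler_pM2r (powR_gt0 q^-1 r0)) -powRD ?pq ?oner_eq0//.
      by rewrite powRr1// ltW.
    have -> : r = (r `^ p0^-1) `^ p0 by rewrite -powRrM mulVf ?gt_eqF// powRr1// ltW.
    by apply: ge0_ler_powR; rewrite ?nnegrE ?powR_ge0// ltW.
  have Ilim : (\int[lam]_x (psi x `^ p0)%:E <= (K `^ p0)%:E)%E.
    pose G n x := (phn n x `^ p0)%:E.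
    have cG := @cvg_monotone_convergence _ _ _ lam setT measurableT G mI.
    have G0 n x : setT x -> (0 <= G n x)%E by rewrite lee_fin powR_ge0.
    have Gnd x : setT x -> {homo G^~ x : i j / (i <= j)%N >-> (i <= j)%E}.
      move=> _ i j ij; rewrite lee_fin; apply: ge0_ler_powR; rewrite ?nnegrE// ?(ltW p00)//.
      rewrite /phn !indicE; case: (boolP (x \in ball i)) => xi; last first.
        by rewrite mulr0; exact: phn0.
      rewrite mem_set; last exact: ball_le ij _ (set_mem xi).
      rewrite !mulr1 le_min ge_min lexx/= ge_min; apply/orP; right.
      by rewrite ler_nat.
    have {}cG := cG G0 Gnd.
    have Glim x : limn (G^~ x) = (psi x `^ p0)%:E.
      have [n [psin xn]] := ball_archi (psi x) x.
      apply/cvg_lim => //; apply: cvg_near_cst; exists n => // j /= nj.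
      rewrite /G /phn indicE mem_set; last exact: ball_le nj _ xn.
      rewrite mulr1; congr ((_ `^ _)%:E); apply/min_idPl.
      by apply: le_trans psin _; rewrite ler_nat.
    have -> : (\int[lam]_x (psi x `^ p0)%:E = \int[lam]_x limn (G^~ x))%E.
      by apply: eq_integral => x _; rewrite Glim.
    rewrite -(cvg_lim _ cG)//; apply: lime_le; first exact: cvgP cG.
    by apply: nearW => n; exact: Ile.
  rewrite unlock.
  have -> : (\int[lam]_x `|phi x| `^ p0 = \int[lam]_x (psi x `^ p0)%:E)%E.
    apply: ae_eq_integral => //.
    - apply: (measurableT_comp (measurable_poweR _)); exact: measurableT_comp.
    - by apply/measurable_EFinP; exact: (measurableT_comp (measurable_powR _) mpsi).
    apply: filterS phipsi => x E _.
    by rewrite E /= ger0_norm.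
  have -> : K%:E = ((K `^ p0)%:E `^ p0^-1)%E.
    by rewrite poweR_EFin -powRrM mulfV ?gt_eqF// powRr1.
  apply: gt0_ler_poweR => //.
  - by rewrite invr_ge0 ltW.
  - by rewrite in_itv/= leey andbT; apply: integral_ge0 => x _; rewrite lee_fin powR_ge0.
  - by rewrite in_itv/= leey andbT lee_fin powR_ge0.
have {q1} qE : q = 1 := q1; subst q; rewrite unlock; case: ifPn => [_|_]; last by rewrite lee_fin.
apply/ess_supP.
pose A j : set B := [set x | K + j.+1%:R^-1 <= psi x] `&` ball j.
have mA j : measurable (A j).
  apply: measurableI => //; rewrite -[X in measurable X]setTI.
  have -> : [set x | K + j.+1%:R^-1 <= psi x] = psi @^-1` `[K + j.+1%:R^-1, +oo[.
    by apply/seteqP; split => x /=; rewrite in_itv/= andbT.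
  by apply: mpsi => //; exact: measurable_itv.
have A0 j : lam (A j) = 0%E.
  have bA := bounded_measurable_indic (mA j).
  have h1 : ((K + j.+1%:R^-1)%:E * lam (A j) <= (cintegral m setT (\1_(A j) : B -> R))%:E)%E.
    have -> : lam (A j) = (\int[lam]_x (\1_(A j) x)%:E)%E by rewrite integral_indic// setIT.
    rewrite pairing// -ge0_integralZl//; last 2 first.
    - exact/measurable_EFinP/measurable_indic.
    - by rewrite lee_fin addr_ge0// invr_ge0.
    apply: ge0_le_integral => //.
    - by move=> x _; rewrite -EFinM lee_fin mulr_ge0 ?addr_ge0 ?invr_ge0// indicE ler0n.
    - by apply/measurable_EFinP; apply: measurable_funM => //; exact: measurable_indic.
    - by apply/measurable_EFinP; apply: measurable_funM => //; exact: measurable_indic.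
    move=> x _; rewrite -EFinM lee_fin mulrC indicE.
    case: (boolP (x \in A j)) => [/set_mem[/= h _]|_]; last by rewrite !mul0r.
    by rewrite !mul1r.
  have h2 : ((cintegral m setT (\1_(A j) : B -> R))%:E <= K%:E * lam (A j))%E.
    apply: le_trans (le_trans (mK _ bA _) _).
    - by rewrite lee_fin ler_norm.
    - by move=> x; rewrite indicE ler0n.
    rewrite Lnorm1; apply: lee_wpmul2l; first by rewrite lee_fin.
    have -> : lam (A j) = (\int[lam]_x (\1_(A j) x)%:E)%E by rewrite integral_indic// setIT.
    rewrite le_eqVlt; apply/orP; left; apply/eqP.
    by apply: eq_integral => x _ /=; rewrite ger0_norm// indicE ler0n.
  have : (lam (A j) < +oo)%E.
    by apply: le_lt_trans (ball_lty j); apply: le_measure; rewrite ?inE//; exact: subIsetr.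
  have := le_trans h1 h2; have : (0 <= lam (A j))%E by [].
  case: (lam (A j)) => [r|//|//]; rewrite lee_fin -!EFinM lee_fin => r0 h _.
  congr EFin; apply/eqP; rewrite eq_le r0 andbT.
  have j0 : 0 < j.+1%:R^-1 :> R by rewrite invr_gt0.
  by move: h; rewrite mulrDl gerDl (pmulr_rle0 _ j0).
have AN : lam.-negligible (\bigcup_j A j).
  by apply: negligible_bigcup => j; exists (A j); split => //; exact: A0.
have : {ae lam, forall x, ~ (\bigcup_j A j) x}.
  by apply: negligibleS AN => x /= /contrapT.
apply: filterS2 phipsi => x E; move=> nA /=; rewrite E /= lee_fin ger0_norm// leNgt.
apply/negP => Kx; apply: nA.
have [n [hn xn]] := ball_archi (psi x - K)^-1 x; exists n => //; split => //=.
rewrite -lerBrDl -[leRHS]invrK lef_pV2 ?posrE ?invr_gt0 ?subr_gt0//.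
by apply: le_trans hn _; rewrite ler_nat.
Qed.

End lebesgue_density.

End density.

(** * Flat limits of L^p bounds *)

Section closed_dual_ball.
Context (R : realType) (d : nat) (k : domain).
Local Notation Omega := (phase_space R d k).
Local Notation B := (borel R d k).
Local Notation M := (signed_measure R d k).
Context (lam : {sigma_finite_measure set B -> \bar R}).
Implicit Types (m : M) (g : B -> R).
Local Notation N q g := (Lnorm lam q%:E (EFin \o (g%R : B -> R))).

(** S is the integer part of t, truncated at n: the layer cake formula with unit
    steps. *)
Lemma count_levels (t : R) n : 0 <= t ->
  let S := \sum_(j < n) ((j.+1%:R <= t)%R%:R : R) in
  (n%:R <= t -> S = n%:R) /\ (t <= n%:R -> t - 1 <= S <= t).
Proof.
move=> t0 /=; elim: n => [|n [ih1 ih2]].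
  by rewrite big_ord0; split => // t1; apply/andP; split; lra.
rewrite big_ord_recr/=; split => nt.
  by rewrite nt ih1 ?natr1//; apply: le_trans nt; rewrite ler_nat.
have [tn|tn] := leP n.+1%:R t.
  rewrite ih1; last by apply: le_trans tn; rewrite ler_nat.
  move: nt tn; rewrite -natr1 mulr1n => ? ?.
  by apply/andP; split; lra.
rewrite addr0; have [/ih2//|nt'] := leP t n%:R.
rewrite ih1 ?(ltW nt')//; move: tn; rewrite -natr1 => tn.
by apply/andP; split; lra.
Qed.

Definition lipschitz (g : Omega -> R) :=
  exists2 L, 0 <= L & forall a b, `|g a - g b| <= L * dist a b.

Lemma lipschitz_bounded_measurable (g : Omega -> R) c : lipschitz g ->
  (forall a, `|g a| <= c) -> bounded_measurable (g : B -> R).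
Proof. by move=> [L _ gL] gc; split; [exact: lipschitz_measurable gL|exists c]. Qed.

Lemma lipschitzM (g1 g2 : Omega -> R) c : lipschitz g1 -> lipschitz g2 ->
  (forall a, `|g1 a| <= c) -> (forall a, `|g2 a| <= c) ->
  lipschitz (fun a => g1 a * g2 a).
Proof.
move=> [L1 L10 h1] [L2 L20 h2] c1 c2.
have c0 : 0 <= c by have := c1 point; apply: le_trans.
exists (c * L2 + c * L1) => [|a b]; first by rewrite addr_ge0// mulr_ge0.
have -> : g1 a * g2 a - g1 b * g2 b = g1 a * (g2 a - g2 b) + g2 b * (g1 a - g1 b).
  by ring.
rewrite (le_trans (ler_normD _ _))// !normrM mulrDl -!mulrA lerD// ler_pM//.
Qed.

Lemma lipschitz_mean n (psi : 'I_n -> Omega -> R) c : 0 <= c ->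
  (forall j, lipschitz_unit (psi j)) -> lipschitz (fun a => c * \sum_j psi j a).
Proof.
move=> c0 psiU; have /choice[L LP] : forall j, exists L, 0 <= L /\
    forall a b, `|psi j a - psi j b| <= L * dist a b.
  by move=> j; have [_ [L ? ?]] := psiU j; exists L.
exists (c * \sum_j L j).
  rewrite mulr_ge0// sumr_ge0// => j _; by case: (LP j).
move=> a b; rewrite -mulrBr normrM (ger0_norm c0) -mulrA ler_wpM2l//.
rewrite -sumrB mulr_suml (le_trans (ler_norm_sum _ _ _))// ler_sum// => j _.
by case: (LP j).
Qed.

(** A bounded function is the mean of the indicators of its superlevel sets, up
    to 1/n; hence it too is a limit in L^1 of Lipschitz functions. *)
Lemma lipschitz_approximation (V : {measure set B -> \bar R}) g (c : nat) e :
  (V setT < +oo)%E -> measurable_fun setT g -> (forall x, 0 <= g x <= c%:R) ->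
  0 < e -> exists psi : Omega -> R, [/\ lipschitz psi,
    forall a, 0 <= psi a <= c%:R &
    (\int[V]_x `|psi x - g x|%:E <= e%:E)%E].
Proof.
move=> VT mg gc e0; pose v := fine (V setT).
have v0 : 0 <= v by rewrite fine_ge0.
have VE : V setT = v%:E by rewrite fineK// ge0_fin_numE.
have [n n0 hn] : exists2 n : nat, (0 < n)%N & v / n%:R <= e / 2.
  pose n := (Num.Def.archi_bound (v / (e / 2))).
  exists n.+1 => //; have n0 : 0 < n.+1%:R :> R by [].
  rewrite ler_pdivrMr// mulrC -ler_pdivrMr ?divr_gt0//.
  apply: (@le_trans _ _ n%:R); last by rewrite ler_nat.
  by apply/ltW/archi_boundP; rewrite divr_ge0// divr_ge0// ltW.
have n0' : 0 < n%:R :> R by rewrite ltr0n.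
pose J := (c * n)%N.
pose A (j : 'I_J) : set B := [set x | j.+1%:R <= n%:R * g x].
have mA j : measurable (A j).
  have -> : A j = (fun x => n%:R * g x) @^-1` `[j.+1%:R, +oo[.
    by apply/seteqP; split => x /=; rewrite /A/= in_itv/= andbT.
  rewrite -[X in measurable X]setTI.
  by apply: (measurable_funM (measurable_cst _) mg) => //; exact: measurable_itv.
have e1 : 0 < e / 2 / J.+1%:R by rewrite !divr_gt0.
have [psi psiP] : exists psi : 'I_J -> Omega -> R, forall j,
    lipschitz_unit (psi j) /\ (indic_gap V (psi j : B -> R) (A j) <= (e / 2 / J.+1%:R)%:E)%E.
  have /choice[psi hpsi] : forall j, exists psi : Omega -> R,
    lipschitz_unit psi /\ (indic_gap V (psi : B -> R) (A j) <= (e / 2 / J.+1%:R)%:E)%E.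
    by move=> j; have [psi ? ?] := lipschitz_indic_gap VT (mA j) e1; exists psi.
  by exists psi.
have mgap j : measurable_fun [set: B] (fun x => `|psi j x - \1_(A j) x|%:E).
  apply/measurable_EFinP; apply: measurableT_comp => //.
  apply: measurable_funB; last exact: measurable_indic.
  exact: lipschitz_unit_measurable (psiP j).1.
exists (fun a => n%:R^-1 * \sum_j psi j a); split.
- by apply: lipschitz_mean => [|j]; [rewrite invr_ge0|exact: (psiP j).1].
- move=> a; rewrite mulr_ge0 ?invr_ge0 ?sumr_ge0//=; last first.
    by move=> j _; have /andP[] := (psiP j).1.1 a.
  rewrite ler_pdivrMl// mulrC -natrM -[X in X%:R]card_ord -sumr_const.
  by rewrite ler_sum// => j _; have /andP[] := (psiP j).1.1 a.
apply: (@le_trans _ _ (\int[V]_x (\sum_(j < J) `|psi j x - \1_(A j) x|%:E + (n%:R^-1)%:E))%E).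
  apply: ge0_le_integral => //.
  - apply/measurable_EFinP; apply: measurableT_comp => //.
    apply: measurable_funB => //; apply: measurable_funM => //.
    by apply: measurable_sum => j; exact: lipschitz_unit_measurable (psiP j).1.
  - by apply: emeasurable_funD => //; apply: emeasurable_sum => j _; exact: mgap.
  move=> x _; rewrite sumEFin -EFinD lee_fin.
  have -> : n%:R^-1 * (\sum_j psi j x) - g x =
     n%:R^-1 * (\sum_j (psi j x - \1_(A j) x)) +
     n%:R^-1 * (\sum_(j < J) ((j.+1%:R <= n%:R * g x)%R%:R : R) - n%:R * g x).
    rewrite sumrB mulrBr mulrBr mulKf ?gt_eqF//.
    have -> : \sum_(j < J) \1_(A j) x = \sum_(j < J) ((j.+1%:R <= n%:R * g x)%R%:R : R).
      apply: eq_bigr => j _; rewrite indicE; congr ((nat_of_bool _)%:R).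
      by apply/idP/idP => [/set_mem|h]; [|rewrite mem_set].
    by ring.
  rewrite (le_trans (ler_normD _ _))// lerD//.
    rewrite normrM ger0_norm ?invr_ge0//.
    apply: le_trans (_ : 1 * `|\sum_j (psi j x - \1_(A j) x)| <= _).
      by rewrite ler_wpM2r// invf_le1// ler1n.
    by rewrite mul1r; exact: ler_norm_sum.
  rewrite normrM ger0_norm ?invr_ge0// -[leRHS]mulr1 ler_wpM2l ?invr_ge0//.
  have /andP[g0 gc'] := gc x.
  have [_ /(_ _)/andP] := @count_levels (n%:R * g x) J (mulr_ge0 (ler0n _ _) g0).
  rewrite /J natrM mulrC ler_wpM2r// => /(_ isT)[h1 h2].
  by rewrite ler_norml [g x * _]mulrC in h1 h2 *; apply/andP; split; lra.
rewrite ge0_integralD//; last 2 first.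
- by move=> x _; rewrite sume_ge0.
- by apply: emeasurable_sum => j _; exact: mgap.
rewrite integral_cst// ge0_integral_sum//.
rewrite [e]splitr EFinD; apply: leeD; last first.
  by rewrite [V _]VE -EFinM lee_fin mulrC.
apply: (@le_trans _ _ (\sum_(j < J) (e / 2 / J.+1%:R)%:E)%E).
  by apply: lee_sum => j _; exact: (psiP j).2.
rewrite sumEFin lee_fin sumr_const card_ord -[leLHS]mulr_natr -[leLHS]mulrA ler_piMr//.
  by rewrite divr_ge0// ltW.
by rewrite mulrC ler_pdivrMr// mul1r ler_nat.
Qed.

(** Integrals of Lipschitz functions are continuous in the flat norm. *)
Lemma lipschitz_dual_bound q K m (g : Omega -> R) c : 0 <= K ->
  (forall e, 0 < e -> exists2 m', dual_ball lam q K m' & FMnorm (csub m' m) <= e) ->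
  lipschitz g -> (forall a, 0 <= g a <= c) ->
  (`|cintegral m setT g|%:E <= K%:E * N q g)%E.
Proof.
move=> K0 H [L L0 gL] gc; apply/lee_addgt0Pr => e e0.
have c0 : 0 <= c by have /andP[] := gc point; exact: le_trans.
have gc' a : `|g a| <= c by have /andP[? ?] := gc a; rewrite ger0_norm.
have D0 : 0 < c + L + 1 by rewrite ltr_wpDl// addr_ge0.
have bg := lipschitz_bounded_measurable (ex_intro2 _ _ L L0 gL) gc'.
have [m' mK mm] := H (e / (c + L + 1)) (divr_gt0 e0 D0).
have h : `|cintegral (csub m' m) setT g| <= e.
  apply: (@le_trans _ _ ((c + L + 1) * FMnorm (csub m' m))).
    apply: cintegral_le_FM_scaled => // [a|a b]; first by have := gc' a; lra.
    by apply: le_trans (gL a b) _; rewrite ler_wpM2r ?dist_ge0//; lra.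
  by rewrite mulrC -ler_pdivlMr.
rewrite cintegral_sub// in h.
apply: le_trans (leeD (mK _ bg (fun a => proj1 (andP (gc a)))) (lexx e%:E)).
rewrite -EFinD lee_fin.
have -> : cintegral m setT g = cintegral m' setT g -
   (cintegral m' setT g - cintegral m setT g) by ring.
by rewrite (le_trans (ler_normB _ _))// lerD2l.
Qed.

Definition cutoff (j : nat) (a : Omega) : R :=
  Num.min 1 (Num.max 0 (j.+1%:R - dist (@cover_map R d k 0) a)).

Lemma cutoff_unit j : lipschitz_unit (cutoff j).
Proof.
split; first by move=> a; rewrite /cutoff le_min ge_min ler01 le_max !lexx.
exists 1 => // a b; rewrite mul1r.
have h1 := dist_triangle a (@cover_map R d k 0) b.
have h2 := dist_triangle b (@cover_map R d k 0) a.
rewrite dist_sym in h2; rewrite [dist b a]dist_sym in h2.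
have d0 := dist_ge0 a b; rewrite /cutoff.
set s := dist _ a in h1 h2 *; set t := dist _ b in h1 h2 *.
have h2' : s <= t + dist a b by rewrite /s dist_sym.
rewrite ler_norml; case: (leP 0 (j.+1%:R - s)) => ?;
case: (leP 0 (j.+1%:R - t)) => ?; rewrite ?minEle;
by repeat case: ifPn => [?|]; rewrite -?ltNge => *; apply/andP; split; lra.
Qed.

Let norm_le_itv (a c e : R) : 0 <= a <= c -> c <= e -> `|a| <= e.
Proof. by move=> /andP[a0 ac] ce; rewrite ger0_norm// (le_trans ac). Qed.

Let norm_sub_itv (a b c : R) : 0 <= a <= c -> 0 <= b <= c -> `|a - b| <= c + 1.
Proof.
by move=> /andP[? ?] /andP[? ?]; rewrite ler_norml; apply/andP; split; lra.
Qed.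

Let norm_compl_itv (a : R) : 0 <= a <= 1 -> `|1 + -1 * a| <= 1.
Proof. by move=> /andP[? ?]; rewrite ger0_norm; lra. Qed.

(** The bound passes to the limit for Lipschitz test functions.  A bounded test
    function g is replaced by chi * psi, where the Lipschitz function psi is close
    to g in L^1 of both the variation of m and the Lebesgue measure of a ball,
    and the cutoff chi is supported in this ball and is 1 where m has almost all
    of its mass.  As psi - g is bounded and q is finite, closeness in L^1 gives
    closeness in L^q on the ball. *)
Lemma dual_ball_closed q K m : 1 <= q -> 0 <= K -> is_lebesgue lam ->
  (forall e, 0 < e -> exists2 m', dual_ball lam q K m' & FMnorm (csub m' m) <= e) ->
  dual_ball lam q K m.
Proof.
move=> q1 K0 lamL H g bg g0.
have q0 : 0 < q by apply: lt_le_trans q1.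
have [c gc] : exists c : nat, forall x, 0 <= g x <= c%:R.
  have [_ [c gc]] := bg; exists (Num.Def.archi_bound `|c|) => x; rewrite g0/=.
  apply: le_trans (ler_norm _) _; apply: le_trans (gc x) _.
  by apply: le_trans (ler_norm c) _; apply/ltW/archi_boundP.
apply/lee_addgt0Pr => eta eta0.
have K1 : 0 < K + 1 by rewrite ltr_wpDl.
have c1 : 0 < c%:R + 1 :> R by rewrite ltr_wpDl.
(* Since |psi - g| <= c + 1, one has |psi - g| ^ q <= D * |psi - g|. *)
pose D : R := (c%:R + 1) `^ (q - 1).
have D0 : 0 < D by exact: powR_gt0.
pose rho := eta / (2 * (K + 1)).
have rho0 : 0 < rho by rewrite divr_gt0// mulr_gt0.
pose e := Num.min (eta / (2 * (c%:R + 1))) (rho `^ q / D).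
have e0 : 0 < e by rewrite lt_min !divr_gt0 ?mulr_gt0 ?powR_gt0.
have e_eta : (c%:R + 1) * e <= eta / 2.
  have : e <= eta / (2 * (c%:R + 1)) by rewrite ge_min lexx.
  rewrite -(ler_pM2l c1) => /le_trans; apply.
  by rewrite le_eqVlt; apply/orP; left; apply/eqP; field; rewrite gt_eqF.
have e_rho : D * e <= rho `^ q.
  by rewrite mulrC -ler_pdivlMr// ge_min lexx orbT.
set V0 := measure_add (jordan_pos (hahnP m)) (jordan_neg (hahnP m)).
have V0T : (V0 setT < +oo)%E := variation_lty m.
pose far j : set B := [set a | (j%:R <= dist (@cover_map R d k 0) a)%R].
have mfar j : measurable (far j).
  rewrite -[X in measurable X]setCK; apply: measurableC.
  rewrite (_ : ~` far j = [set a | dist (@cover_map R d k 0) a < j%:R]).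
    exact: open_borel (open_ball_dist _ _).
  by apply/seteqP; split => a /=; [move/negP; rewrite -ltNge|rewrite ltNge => /negP].
have [j farj] : exists j, (V0 (far j) < e%:E)%E.
  apply: measure_vanishing => //.
    move=> i j ij; apply/subsetPset => a /=; apply: le_trans.
    by rewrite ler_nat.
  apply/seteqP; split => // a af.
  have := af (Num.Def.archi_bound (dist (@cover_map R d k 0) a)) I.
  by rewrite /far/= leNgt archi_boundP// dist_ge0.
pose W : set B := [set a | dist (@cover_map R d k 0) a < j.+1%:R].
have mW : measurable W by exact: open_borel (open_ball_dist _ _).
have lamW : (lam W < +oo)%E by exact: lebesgue_ball_lty.
pose lamr : {measure set B -> \bar R} := mrestr lam mW.
have lamrT : (lamr setT < +oo)%E by rewrite /lamr /= /mrestr setTI.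
pose V : {measure set B -> \bar R} := measure_add V0 lamr.
have VT : (V setT < +oo)%E by exact: measure_add_lty.
have [psi [psiL psic psig]] := lipschitz_approximation VT bg.1 gc e0.
have bpsi : bounded_measurable (psi : B -> R).
  apply: (lipschitz_bounded_measurable (c := c%:R) psiL) => a.
  by have /andP[? ?] := psic a; rewrite ger0_norm.
pose h x := psi x - g x.
have bh : bounded_measurable (h : B -> R).
  have := bounded_measurable_add bpsi (bounded_measurable_scale (-1) bg).
  by rewrite /h; under eq_fun do rewrite mulN1r.
have mh : measurable_fun [set: B] (fun x => `|h x|%:E).
  by apply/measurable_EFinP; apply: measurableT_comp => //; exact: bh.1.
have hsum : (\int[V0]_x `|h x|%:E + \int[lamr]_x `|h x|%:E <= e%:E)%E.
  by rewrite -ge0_integral_measure_add.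
have h_V0 : (\int[V0]_x `|h x|%:E <= e%:E)%E.
  by apply: le_trans hsum; rewrite leeDl// integral_ge0.
have h_lam : (\int[lamr]_x `|h x|%:E <= e%:E)%E.
  by apply: le_trans hsum; rewrite leeDr// integral_ge0.
pose chi := cutoff j.
have chiU : lipschitz_unit chi := cutoff_unit j.
have chi01 a : 0 <= chi a <= 1 := chiU.1 a.
have bchi := lipschitz_unit_bounded chiU.
have bchipsi := bounded_measurable_mul bchi bpsi.
have bchih := bounded_measurable_mul bchi bh.
have bchig := bounded_measurable_mul bchi bg.
have bchi1 : bounded_measurable (fun x => (1 + -1 * chi x) * g x : R).
  apply: bounded_measurable_mul => //; apply: bounded_measurable_add.
    exact: bounded_measurable_cst.
  exact: bounded_measurable_scale.
have T1 : (`|cintegral m setT (fun x => chi x * psi x)|%:E <=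
    K%:E * N q (fun x => chi x * psi x))%E.
  apply: (@lipschitz_dual_bound _ _ _ _ c%:R) => //.
    apply: (@lipschitzM _ _ (c%:R + 1)) => //.
    - exact: chiU.2.
    - by move=> a; apply: (norm_le_itv (chi01 a)); rewrite lerDr.
    - by move=> a; apply: (norm_le_itv (psic a)); rewrite lerDl.
  move=> a; have /andP[p0 pc] := psic a; have /andP[x0 x1] := chi01 a.
  rewrite mulr_ge0//= (le_trans _ pc)// -[leRHS]mul1r ler_wpM2r//.
have T2 : `|cintegral m setT (fun x => chi x * h x)| <= e.
  rewrite -lee_fin; apply: le_trans h_V0.
  apply: le_trans (cintegral_le_variation _ bchih) _.
  apply: ge0_le_integral => //.
    by apply/measurable_EFinP; apply: measurableT_comp => //; exact: bchih.1.
  move=> x _; rewrite lee_fin normrM -[leRHS]mul1r ler_wpM2r//.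
  by have /andP[? ?] := chi01 x; rewrite ger0_norm.
have T3 : `|cintegral m setT (fun x => (1 + -1 * chi x) * g x)| <= c%:R * e.
  rewrite -lee_fin; apply: le_trans (cintegral_le_variation _ bchi1) _.
  apply: (@le_trans _ _ (c%:R%:E * V0 (far j))%E); last first.
    by rewrite EFinM; apply: lee_wpmul2l => //; exact: ltW.
  have -> : V0 (far j) = (\int[V0]_x (\1_(far j) x)%:E)%E by rewrite integral_indic// setIT.
  rewrite -ge0_integralZl//; last exact/measurable_EFinP/measurable_indic.
  apply: ge0_le_integral => //.
  - by apply/measurable_EFinP; apply: measurableT_comp => //; exact: bchi1.1.
  - by apply/measurable_EFinP; apply: measurable_funM => //; exact: measurable_indic.
  move=> x _; rewrite -EFinM lee_fin indicE.
  have /andP[_ gcx] := gc x.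
  have [xf|xf] := boolP (x \in far j).
    rewrite mulr1 normrM (ger0_norm (g0 x)) -[leRHS]mul1r ler_pM//.
    exact: norm_compl_itv.
  have -> : chi x = 1.
    move: xf; rewrite notin_setE /far/= => /negP; rewrite -ltNge => xj.
    rewrite /chi /cutoff; apply/min_idPl; rewrite le_max; apply/orP; right.
    by rewrite -natr1 lerBrDl lerD2r ltW.
  by rewrite mulr1 subrr mul0r normr0 mulr0.
have Nh : (N q (fun x => chi x * h x) <= rho%:E)%E.
  have I1 : (\int[lam]_x (`|chi x * h x| `^ q)%:E <= (rho `^ q)%:E)%E.
    apply: (@le_trans _ _ (D%:E * \int[lamr]_x `|h x|%:E)%E); last first.
      apply: (@le_trans _ _ (D%:E * e%:E)%E); last by rewrite -EFinM lee_fin.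
      by apply: lee_wpmul2l; [rewrite lee_fin ltW|exact: h_lam].
    rewrite -ge0_integralZl//; last by rewrite lee_fin ltW.
    have mDh : measurable_fun [set: B] (fun x => D%:E * `|h x|%:E)%E.
      exact: measurable_funeM.
    apply: (@le_trans _ _ (\int[lamr]_(x in W) (D%:E * `|h x|%:E))%E); last first.
      by apply: ge0_subset_integral => // x _; rewrite mule_ge0// lee_fin ltW.
    have -> : (\int[lamr]_(x in W) (D%:E * `|h x|%:E) =
               \int[lam]_(x in W) (D%:E * `|h x|%:E))%E.
      apply: eq_measure_integral => X mX XW; rewrite /lamr /= /mrestr.
      by congr (lam _); exact: setIidl.
    rewrite [leRHS]integral_mkcond; apply: ge0_le_integral => //.
    - apply/measurable_EFinP; apply: (measurableT_comp (measurable_powR _)).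
      by apply: measurableT_comp => //; exact: bchih.1.
    - by apply/(measurable_restrictT _ mW)/measurable_funTS.
    move=> x _; rewrite /patch; case: ifPn => xW.
      rewrite -EFinM lee_fin; have /andP[x0 x1] := chi01 x.
      have hc : `|h x| <= c%:R + 1.
        exact: norm_sub_itv.
      apply: (@le_trans _ _ (`|h x| `^ q)).
        apply: ge0_ler_powR; rewrite ?nnegrE ?(ltW q0)//.
        by rewrite normrM -[leRHS]mul1r ler_wpM2r// ger0_norm.
      have {1}-> : q = (q - 1) + 1 by rewrite subrK.
      rewrite powRD; last by rewrite subrK gt_eqF.
      rewrite powRr1// ler_wpM2r//; apply: ge0_ler_powR; rewrite ?nnegrE ?subr_ge0//.
    have -> : chi x = 0.
      move: xW; rewrite notin_setE /W/= => /negP; rewrite -leNgt => xj.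
      rewrite /chi /cutoff (max_idPl _) ?subr_le0//.
      by apply/min_idPr.
    by rewrite mul0r normr0 powR0// gt_eqF.
  rewrite unlock.
  have -> : rho%:E = ((rho `^ q)%:E `^ q^-1)%E.
    by rewrite poweR_EFin -powRrM mulfV ?gt_eqF// powRr1// ltW.
  apply: gt0_ler_poweR.
  - by rewrite invr_ge0 ltW.
  - by rewrite in_itv/= leey andbT; apply: integral_ge0 => x _; rewrite lee_fin powR_ge0.
  - by rewrite in_itv/= leey andbT lee_fin powR_ge0.
  - exact: I1.
have Ng : (N q (fun x => chi x * g x) <= N q g)%E.
  rewrite unlock; apply: gt0_ler_poweR.
  - by rewrite invr_ge0 ltW.
  - by rewrite in_itv/= leey andbT; apply: integral_ge0 => x _; rewrite lee_fin powR_ge0.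
  - by rewrite in_itv/= leey andbT; apply: integral_ge0 => x _; rewrite lee_fin powR_ge0.
  apply: ge0_le_integral => //.
  - by move=> x _; exact: poweR_ge0.
  - apply: (measurableT_comp (measurable_poweR _)).
    by apply: measurableT_comp => //; apply/measurable_EFinP; exact: bchig.1.
  - apply: (measurableT_comp (measurable_poweR _)).
    by apply: measurableT_comp => //; apply/measurable_EFinP; exact: bg.1.
  move=> x _; rewrite lee_fin; apply: ge0_ler_powR; rewrite ?nnegrE ?(ltW q0)//.
  rewrite normrM -[leRHS]mul1r ler_wpM2r//.
  by have /andP[? ?] := chi01 x; rewrite ger0_norm.
have Npsi : (N q (fun x => chi x * psi x) <= N q g + rho%:E)%E.
  have -> : (EFin \o (fun x => chi x * psi x)) =
      EFin \o ((fun x => chi x * g x) \+ (fun x => chi x * h x))%R.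
    by apply/funext => x /=; congr EFin; rewrite /h; ring.
  apply: le_trans (minkowski_EFin lam bchig.1 bchih.1 q1) _.
  exact: leeD.
have split3 : `|cintegral m setT g| <= `|cintegral m setT (fun x => chi x * psi x)| +
    (c%:R + 1) * e.
  have gE : g = (fun x => (chi x * psi x + (-1 * (chi x * h x))) + (1 + -1 * chi x) * g x).
    by apply/funext => x; rewrite /h; ring.
  have bN := bounded_measurable_scale (-1) bchih.
  rewrite {1}gE cintegral_funD// ?cintegral_funD//; last exact: bounded_measurable_add.
  rewrite cintegral_funZ// mulN1r.
  rewrite (le_trans (ler_normD _ _))//.
  have := ler_normB (cintegral m setT (fun x => chi x * psi x))
    (cintegral m setT (fun x => chi x * h x)).
  by move=> ?; lra.
apply: (@le_trans _ _ (K%:E * (N q g + rho%:E) + (eta / 2)%:E)%E).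
  apply: (@le_trans _ _ (`|cintegral m setT (fun x => chi x * psi x)|%:E + (eta / 2)%:E)%E).
    by rewrite -EFinD lee_fin (le_trans split3)// lerD2l.
  rewrite leeD2r//; apply: le_trans T1 _.
  by apply: lee_wpmul2l; [rewrite lee_fin|exact: Npsi].
rewrite ge0_muleDr ?Lnorm_ge0//; last by rewrite lee_fin ltW.
rewrite -addeA leeD2l// -EFinM -EFinD lee_fin.
have : K * rho <= eta / 2.
  rewrite /rho mulrA ler_pdivrMr ?mulr_gt0//.
  have -> : eta / 2 * (2 * (K + 1)) = (K + 1) * eta by field.
  by rewrite ler_wpM2r ?ltW// ltrDl.
by lra.
Qed.

End closed_dual_ball.

(** * Bochner integrals and Riemann sums *)

Section bochner_estimate.
Context (R : realType) (E : normedModType R).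
Local Notation X := (measurableTypeR R).
Local Notation leb := (@lebesgue_measure R).

(** Monotonicity without measurability of the functions: the norm of the
    difference between a Bochner integrable function and a step function is only
    known to be a limit almost everywhere of measurable functions. *)
Lemma lee_lower_integral (D : set X) (f1 f2 : X -> \bar R) :
  (forall x, D x -> 0 <= f1 x)%E -> (forall x, D x -> f1 x <= f2 x)%E ->
  (\int[leb]_(x in D) f1 x <= \int[leb]_(x in D) f2 x)%E.
Proof.
move=> f10 f12; rewrite !ge0_integralE//; last first.
  by move=> x Dx; exact: le_trans (f10 _ Dx) (f12 _ Dx).
apply: le_ereal_sup => _ [h hf1 <-].
exists h => // x; apply: le_trans (hf1 x) _; rewrite /patch.
by case: ifPn => // /set_mem; exact: f12.
Qed.

Lemma measurable_step_norm n (A : 'I_n -> set X) (v : 'I_n -> E) (u : E) :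
  (forall i, measurable (A i)) ->
  measurable_fun setT (fun x => `|u + \sum_(i < n) \1_(A i) x *: v i|).
Proof.
elim: n A v u => [|n ih] A v u mA.
  by under eq_fun do rewrite big_ord0; exact: measurable_cst.
have E1 : (fun x => `|u + \sum_(i < n.+1) \1_(A i) x *: v i|) =
  (fun x => \1_(A ord0) x * `|(u + v ord0) + \sum_(i < n) \1_(A (lift ord0 i)) x *: v (lift ord0 i)|
   + (1 - \1_(A ord0) x) * `|u + \sum_(i < n) \1_(A (lift ord0 i)) x *: v (lift ord0 i)|).
  apply/funext => x; rewrite big_ord_recl [\1_(A ord0) x]indicE.
  by case: (x \in A ord0); rewrite /= ?scale1r ?scale0r ?add0r ?subrr ?mul0r ?addr0
    ?subr0 ?mul1r ?addrA ?add0r.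
rewrite E1; apply: measurable_funD; apply: measurable_funM.
- exact: measurable_indic.
- exact: ih.
- by apply: measurable_funB => //; exact: measurable_indic.
- exact: ih.
Qed.

(** The norm of the integral of a step function is at most the integral of its
    norm; the constant u makes the induction on the number of sets go through,
    by splitting the domain along the first one. *)
Lemma step_norm_integral n (A : 'I_n -> set X) (v : 'I_n -> E) (u : E) (D : set X) :
  (forall i, measurable (A i)) -> measurable D -> (leb D < +oo)%E ->
  (`|fine (leb D) *: u + \sum_(i < n) fine (leb (A i `&` D)) *: v i|%:E <=
   \int[leb]_(x in D) `|u + \sum_(i < n) \1_(A i) x *: v i|%:E)%E.
Proof.
elim: n A v u D => [|n ih] A v u D mA mD Dfin.
  rewrite big_ord0 addr0; under eq_integral do rewrite big_ord0 addr0.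
  rewrite integral_cst// normrZ ger0_norm ?fine_ge0// mulrC EFinM fineK//.
  by rewrite ge0_fin_numE.
set A0 := A ord0; have mA0 : measurable A0 by exact: mA.
have mI Z : measurable Z -> measurable (Z `&` (D `&` A0)) by move=> mZ; do 2 apply: measurableI => //.
have mDd : measurable (D `\` A0) by exact: measurableD.
have mDi : measurable (D `&` A0) by exact: measurableI.
have fin Z : measurable Z -> Z `<=` D -> leb Z \is a fin_num.
  move=> mZ ZD; rewrite ge0_fin_numE//; apply: le_lt_trans Dfin.
  by apply: le_measure; rewrite ?inE.
have lty Z : measurable Z -> Z `<=` D -> (leb Z < +oo)%E.
  by move=> mZ ZD; rewrite ltey_eq fin.
have splitD Z : measurable Z -> fine (leb (Z `&` D)) =
    fine (leb (Z `&` (D `&` A0))) + fine (leb (Z `&` (D `\` A0))).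
  move=> mZ; rewrite -fineD; last 2 first.
  - by apply: fin; [exact: mI|move=> x [_ []]].
  - by apply: fin; [exact: measurableI|move=> x [_ []]].
  congr fine; rewrite -measureU.
  - by rewrite -setIUr setDE -setIUr setUv setIT.
  - exact: mI.
  - exact: measurableI.
  - by apply/seteqP; split => // x [[_ [_ ?]] [_ [_ ]]].
have h1 := ih (fun i => A (lift ord0 i)) (fun i => v (lift ord0 i)) (u + v ord0)
  (D `&` A0) (fun i => mA _) mDi (lty _ mDi (@subIsetl _ _ _)).
have h2 := ih (fun i => A (lift ord0 i)) (fun i => v (lift ord0 i)) u
  (D `\` A0) (fun i => mA _) mDd (lty _ mDd (@subDsetl _ _ _)).
have -> : fine (leb D) *: u + \sum_(i < n.+1) fine (leb (A i `&` D)) *: v i =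
  (fine (leb (D `&` A0)) *: (u + v ord0) +
   \sum_(i < n) fine (leb (A (lift ord0 i) `&` (D `&` A0))) *: v (lift ord0 i)) +
  (fine (leb (D `\` A0)) *: u +
   \sum_(i < n) fine (leb (A (lift ord0 i) `&` (D `\` A0))) *: v (lift ord0 i)).
  rewrite big_ord_recl -/A0 addrACA -big_split/=.
  under [in RHS]eq_bigr do rewrite -scalerDl -splitD//.
  rewrite addrA; congr (_ + _).
  have := splitD setT measurableT; rewrite !setTI => ->.
  by rewrite scalerDl scalerDr -!addrA; congr (_ + _); rewrite addrC setIC.
have mF : measurable_fun setT
    (fun x => `|u + \sum_(i < n.+1) \1_(A i) x *: v i|%:E).
  by apply/measurable_EFinP; exact: measurable_step_norm.
rewrite -[in leRHS](setUIDK D A0) ge0_integral_setU//; last 2 first.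
- by rewrite setUIDK; exact: measurable_funTS.
- by apply/disj_setPS => x [[_ ?] []].
apply: (@le_trans _ _ (`|fine (leb (D `&` A0)) *: (u + v ord0) +
   \sum_(i < n) fine (leb (A (lift ord0 i) `&` (D `&` A0))) *: v (lift ord0 i)|%:E +
   `|fine (leb (D `\` A0)) *: u +
   \sum_(i < n) fine (leb (A (lift ord0 i) `&` (D `\` A0))) *: v (lift ord0 i)|%:E)%E).
  by rewrite -EFinD lee_fin ler_normD.
apply: leeD.
  apply: le_trans h1 _; rewrite le_eqVlt; apply/orP; left; apply/eqP.
  apply: eq_integral => x; rewrite inE => -[_ xA].
  by rewrite big_ord_recl indicE mem_set// scale1r addrA.
apply: le_trans h2 _; rewrite le_eqVlt; apply/orP; left; apply/eqP.
apply: eq_integral => x; rewrite inE => -[_ xA].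
by rewrite big_ord_recl indicE memNset// scale0r add0r.
Qed.

Section partition.
Context (tau : nat -> R).
Hypothesis tau_le : forall i, tau i <= tau i.+1.
Local Notation J i := (`[tau i, tau i.+1[%classic : set X).

Lemma partition_le i j : (i <= j)%N -> tau i <= tau j.
Proof.
move=> /subnKC <-; elim: (j - i)%N => [|n ih]; first by rewrite addn0.
by rewrite addnS (le_trans ih).
Qed.

Let lebJ i : leb (J i) = (tau i.+1 - tau i)%:E.
Proof.
rewrite lebesgue_measure_itv/= lte_fin; case: ltP => // h.
by rewrite (_ : tau i.+1 = tau i) ?subrr//; apply/eqP; rewrite eq_le h tau_le.
Qed.

Let mJ i : measurable (J i).
Proof. exact: measurable_itv. Qed.

Let splitJ m : (`[tau 0%N, tau m.+1[%classic : set X) = `[tau 0%N, tau m[ `|` J m.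
Proof.
have h0 := partition_le (leq0n m); have h1 := tau_le m.
apply/seteqP; split => x /=; rewrite !in_itv/=.
  by case: (ltP x (tau m)) => xm /andP[x0 x1]; [left|right]; apply/andP; split.
by case=> /andP[x0 x1]; apply/andP; split => //; lra.
Qed.

Let disjJ i j x : J i x -> J j x -> i = j.
Proof.
rewrite /= !in_itv/= => /andP[xi1 xi2] /andP[xj1 xj2].
case: (ltngtP i j) => // ij.
  by exfalso; have := partition_le ij; lra.
by exfalso; have := partition_le ij; lra.
Qed.

Let lty_itv m : (leb (`[tau 0%N, tau m[%classic : set X) < +oo)%E.
Proof. by rewrite lebesgue_measure_itv/=; case: ifP => _; rewrite ltry. Qed.

Lemma step_partition_norm n (A : 'I_n -> set X) (v : 'I_n -> E) (w : nat -> E) m :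
  (forall i, measurable (A i)) ->
  (`|\sum_(i < n) fine (leb (A i `&` `[tau 0%N, tau m[)) *: v i -
     \sum_(j < m) (tau j.+1 - tau j) *: w j|%:E <=
   \sum_(j < m) \int[leb]_(x in J j) `|- w j + \sum_(i < n) \1_(A i) x *: v i|%:E)%E.
Proof.
move=> mA; elim: m => [|m ih].
  rewrite !big_ord0 subr0 big1 ?normr0// => i _.
  by rewrite set_itvco0// setI0 measure0 scale0r.
rewrite !big_ord_recr/=.
have -> : \sum_(i < n) fine (leb (A i `&` `[tau 0%N, tau m.+1[)) *: v i =
  \sum_(i < n) fine (leb (A i `&` `[tau 0%N, tau m[)) *: v i +
  \sum_(i < n) fine (leb (A i `&` J m)) *: v i.
  rewrite -big_split; apply: eq_bigr => i _ /=; rewrite -scalerDl; congr (_ *: _).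
  have fin Z : measurable Z -> (leb Z < +oo)%E -> leb (A i `&` Z) \is a fin_num.
    move=> mZ Zy; rewrite ge0_fin_numE//; apply: le_lt_trans Zy.
    by apply: le_measure; rewrite ?inE//; exact: measurableI.
  rewrite -fineD ?fin ?lebJ ?ltry//; congr fine; rewrite splitJ setIUr measureU//.
  - by apply: measurableI => //; exact: measurable_itv.
  - exact: measurableI.
  apply/seteqP; split => // x [[_ /=]]; rewrite in_itv/= => /andP[_ xm] [_ /=].
  by rewrite in_itv/= leNgt xm.
have h := step_norm_integral v (- w m) mA (mJ m).
rewrite lebJ/= in h; have {}h := h (ltry _).
apply: le_trans (leeD ih h); rewrite -EFinD lee_fin.
rewrite opprD addrACA -[X in _ - _ + X]addrC -scalerN.
exact: ler_normD.
Qed.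

Let sum_lower_integral m (f : nat -> X -> R) (g : X -> \bar R) (D : set X) :
  (forall j, measurable_fun setT (f j)) -> (forall j x, 0 <= f j x) ->
  measurable D -> (forall j, (j < m)%N -> J j `<=` D) ->
  (forall x, D x -> 0 <= g x)%E ->
  (forall j x, (j < m)%N -> J j x -> (f j x)%:E <= g x)%E ->
  (\sum_(j < m) \int[leb]_(x in J j) (f j x)%:E <= \int[leb]_(x in D) g x)%E.
Proof.
move=> mf f0 mD JD g0 fg; rewrite [leRHS]integral_mkcond.
have -> : (\sum_(j < m) \int[leb]_(x in J j) (f j x)%:E =
    \int[leb]_x (\sum_(j < m) (f j x * \1_(J j) x)%:E))%E.
  rewrite ge0_integral_sum//.
  - apply: eq_bigr => j _; rewrite [LHS]integral_mkcond; apply: eq_integral => x _.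
    by rewrite patchE indicE; case: ifPn => _; rewrite ?mulr1 ?mulr0.
  - by move=> j; apply/measurable_EFinP; apply: measurable_funM.
  - by move=> j x _; rewrite lee_fin mulr_ge0// indicE.
apply: lee_lower_integral => x _.
  by apply: sume_ge0 => j _; rewrite lee_fin mulr_ge0// indicE.
have [[j jx]|nj] := pselect (exists j : 'I_m, J j x).
  rewrite (bigD1 j)//= big1 ?adde0; last first.
    move=> i ij; rewrite indicE memNset ?mulr0// => ix.
    by move/eqP: ij; apply; apply: val_inj; exact: disjJ ix jx.
  rewrite indicE (mem_set jx) mulr1 patchE mem_set; last exact: JD jx.
  exact: fg.
rewrite big1; first by rewrite patchE; case: ifPn => // /set_mem; exact: g0.
move=> i _; rewrite indicE memNset ?mulr0// => ix; apply: nj; by exists i.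
Qed.

(** The Riemann sum is compared with the integrals of the step functions that
    define the Bochner integral. *)
Lemma bochner_partition m (g : R -> E) (I : E) (w : nat -> E) (eps : nat -> R) :
  is_bochner_integral `[tau 0%N, tau m] g I -> (forall j, 0 <= eps j) ->
  (forall j x, (j < m)%N -> tau j <= x < tau j.+1 -> `|g x - w j| <= eps j) ->
  `|I - \sum_(j < m) (tau j.+1 - tau j) *: w j| <=
  \sum_(j < m) (tau j.+1 - tau j) * eps j.
Proof.
move=> [S [Son _ Sg SI]] eps0 gw; set D : set X := `[tau 0%N, tau m]%classic.
have mD : measurable D by exact: measurable_itv.
have JD j : (j < m)%N -> J j `<=` D.
  move=> jm x; rewrite /D /= !in_itv/= => /andP[x1 x2].
  have := partition_le (leq0n j); have := partition_le jm => ? ?.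
  by apply/andP; split; lra.
have key k : (`|step_integral (S k) - \sum_(j < m) (tau j.+1 - tau j) *: w j|%:E <=
    (\sum_(j < m) (tau j.+1 - tau j) * eps j)%:E +
    \int[leb]_(x in D) (`|g x - step_eval (S k) x|%R)%:E)%E.
  have mA i : measurable (step_set (s := S k) i) by exact: (Son k i).1.
  have -> : step_integral (S k) = \sum_(i < step_size (S k))
      fine (leb (step_set (s := S k) i `&` `[tau 0%N, tau m[)) *: step_val i.
    apply: eq_bigr => i _; congr (fine _ *: _).
    have sub := (Son k i).2; set Z := step_set i in sub *.
    apply/eqP; rewrite eq_le; apply/andP; split; last first.
      by apply: le_measure; rewrite ?inE//; [exact: measurableI (mA _) (measurable_itv _)|exact: mA].
    have mZJ : measurable (Z `&` `[tau 0%N, tau m[).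
      exact: measurableI (mA _) (measurable_itv _).
    apply: (@le_trans _ _ (leb ((Z `&` `[tau 0%N, tau m[) `|` [set tau m]))).
      apply: le_measure; rewrite ?inE; [exact: mA|exact: measurableU|].
      move=> x Zx; have := sub _ Zx; rewrite /= in_itv/= => /andP[x1 x2].
      have [xm|xm] := ltP x (tau m); [left|right] => /=.
        by split => //; rewrite in_itv/= x1.
      by apply/eqP; rewrite eq_le x2.
    rewrite (le_trans (measureU2 _ _ _))// [X in (_ + X)%E](_ : _ = 0%E) ?adde0//.
    exact: lebesgue_measure_set1.
  apply: le_trans (step_partition_norm (fun i => step_val i) w m mA) _.
  (* A measurable lower bound of the distance between g and the step function. *)
  pose f j x := Num.max (`|- w j + step_eval (S k) x| - eps j) 0.
  have mstep j : measurable_fun setT (fun x : X => `|- w j + step_eval (S k) x|).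
    exact: measurable_step_norm.
  have mf j : measurable_fun setT (f j).
    by apply: measurable_maxr => //; apply: measurable_funB => //; exact: mstep.
  have mEf j (Y : set X) : measurable_fun Y (fun x : X => (f j x)%:E).
    by apply: measurable_funTS; apply/measurable_EFinP; exact: mf.
  have f0 j x : 0 <= f j x by rewrite le_max lexx orbT.
  apply: (@le_trans _ _ (\sum_(j < m) (((tau j.+1 - tau j) * eps j)%:E +
     \int[leb]_(x in J j) (f j x)%:E))%E).
    apply: lee_sum => j _.
    apply: (@le_trans _ _ (\int[leb]_(x in J j) ((eps j)%:E + (f j x)%:E))%E).
      apply: ge0_le_integral => //.
      - by apply/measurable_EFinP/measurable_funTS.
      - by apply: emeasurable_funD => //; exact: mEf.
      move=> x _; rewrite -EFinD lee_fin -lerBlDl.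
      by rewrite le_max lexx.
    rewrite ge0_integralD//.
    - have lJ : leb (J j) = (tau j.+1 - tau j)%:E := lebJ j.
      rewrite integral_cst// mulrC EFinM -lJ; exact: lexx.
    - by move=> x _; rewrite lee_fin.
    - by move=> x _; rewrite lee_fin.
  rewrite big_split/= sumEFin leeD2l//.
  apply: sum_lower_integral => // j x jm jx; rewrite lee_fin /f ge_max normr_ge0 andbT.
  have h1 : `|g x - w j| <= eps j by apply: gw => //; move: jx; rewrite /= in_itv.
  have := ler_normB (g x - w j) (g x - step_eval (S k) x).
  rewrite (_ : g x - w j - _ = - w j + step_eval (S k) x); first by lra.
  by rewrite opprB [g x - w j]addrC -addrA [g x + _]addrCA subrr addr0.
apply/ler_addgt0Pr => e e0; have e2 : 0 < e / 2 by rewrite divr_gt0.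
have n1 : \forall k \near \oo, `|I - step_integral (S k)| < e / 2.
  by move/cvgrPdist_lt: SI => /(_ _ e2).
have n2 : \forall k \near \oo,
    (\int[leb]_(x in D) (`|g x - step_eval (S k) x|%R)%:E < (e / 2)%:E)%E.
  have e2' : (0%E < (e / 2)%:E)%E by rewrite lte_fin.
  exact: (Sg _ (open_ereal_lt' e2')).
have [k [k1 k2]] := filter_ex (filterI n1 n2).
have h : `|step_integral (S k) - \sum_(j < m) (tau j.+1 - tau j) *: w j| <=
    \sum_(j < m) (tau j.+1 - tau j) * eps j + e / 2.
  by rewrite -lee_fin EFinD; apply: le_trans (key k) _; rewrite leeD2l// ltW.
rewrite -(subrKA (step_integral (S k))) (le_trans (ler_normD _ _))//.
lra.
Qed.

End partition.

End bochner_estimate.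

(** * The discrete Duhamel formula *)

Section duhamel.
Context (R : realType) (d : nat) (k : domain).
Local Notation Omega := (phase_space R d k).
Local Notation B := (borel R d k).
Local Notation M := (signed_measure R d k).
Context (E : completeNormedModType R) (iota : M -> E).
Hypothesis iotaP : is_FM_completion iota.
Context (v : R -> Omega -> 'rV[R]_d).
Context (Phi : R -> R -> Omega -> Omega).
Hypothesis flowP : is_flow v Phi.
Context (T K : R).
Hypothesis TK : velocity_bound v T K.
Implicit Types (m : M) (tau : nat -> R) (F : nat -> M).
Local Notation P s t := (cpush (Phi s t)).
Local Notation factor := (expR (K * T)).

Let factor_ge1 : 0 <= T -> 1 <= factor.
Proof. by move=> T0; rewrite -expR0 ler_expR mulr_ge0//; case: TK. Qed.

Let mPhi s t : 0 <= s <= t -> t <= T -> measurable_fun [set: B] (Phi s t : B -> B).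
Proof. by move=> st tT; apply: (flow_measurable flowP TK). Qed.

Lemma push_comp r s t m : 0 <= r <= s -> s <= t -> t <= T ->
  charge_eq (P s t (P r s m)) (P r t m).
Proof.
move=> /andP[r0 rs] st tT A mA.
have mrs : measurable_fun [set: B] (Phi r s : B -> B).
  by apply: mPhi; [rewrite r0|exact: le_trans tT].
have mst : measurable_fun [set: B] (Phi s t : B -> B).
  by apply: mPhi => //; rewrite st (le_trans r0).
have mrt : measurable_fun [set: B] (Phi r t : B -> B).
  by apply: mPhi => //; rewrite r0 (le_trans rs).
rewrite !cpushE//; congr (m _); apply/seteqP; split => x /=;
  by rewrite (flow_comp flowP TK) ?r0.
Qed.

Lemma push_id s m : 0 <= s <= T -> charge_eq (P s s m) m.
Proof.
move=> /andP[s0 sT] A mA; rewrite cpushE; last by apply: mPhi => //; rewrite s0/=.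
by congr (m _); apply/seteqP; split => x /=; rewrite (flow_id flowP).
Qed.

Lemma push_cadd s t m1 m2 : 0 <= s <= t -> t <= T ->
  iota (P s t (cadd m1 m2)) = iota (P s t m1) + iota (P s t m2).
Proof.
move=> st tT; rewrite -(iota_add iotaP); apply: (iota_eq iotaP) => A mA.
by rewrite caddE !cpushE//; exact: mPhi.
Qed.

Lemma push_cscale s t c m : 0 <= s <= t -> t <= T ->
  iota (P s t (cscale c m)) = c *: iota (P s t m).
Proof.
move=> st tT; have [_ h _ _] := iotaP; rewrite -h; apply: (iota_eq iotaP) => A mA.
by rewrite cscaleE !cpushE//; exact: mPhi.
Qed.

Lemma push_iota_sub s t m1 m2 : 0 <= s <= t -> t <= T ->
  `|iota (P s t m1) - iota (P s t m2)| <= factor * `|iota m1 - iota m2|.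
Proof.
move=> /andP[s0 st] tT; have T0 : 0 <= T by lra.
have [_ hs _ _] := iotaP.
have -> : iota (P s t m1) - iota (P s t m2) = iota (P s t (csub m1 m2)).
  rewrite push_cadd ?s0//; congr (_ + _).
  rewrite -(iota_opp iotaP); apply: (iota_eq iotaP) => A mA.
  by rewrite coppE !cpushE//; apply: mPhi; rewrite ?s0.
rewrite (norm_iota iotaP) -(FMnorm_sub iotaP); apply: FMnorm_push => [|a b].
  exact: factor_ge1.
by apply: (flow_lipschitz flowP TK); rewrite ?s0.
Qed.

(** Starting the transport at another time moves each point by at most a
    constant times the time difference. *)
Lemma push_kernel s s' t m m' : 0 <= s <= s' -> s' <= t -> t <= T ->
  `|iota (P s' t m') - iota (P s t m)| <=
  factor * (`|iota m' - iota m| + d%:R * (K * (s' - s)) * TVnorm m).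
Proof.
move=> /andP[s0 ss] st tT.
have -> : iota (P s' t m') - iota (P s t m) = (iota (P s' t m') - iota (P s' t m)) -
    (iota (P s t m) - iota (P s' t m)) by rewrite opprB addrA subrK.
rewrite (le_trans (ler_normB _ _))// mulrDr lerD//.
  by apply: push_iota_sub => //; rewrite (le_trans s0).
rewrite -(FMnorm_sub iotaP) mulrA; apply: FMnorm_push_sub => [||a].
- by apply: mPhi => //; rewrite s0 (le_trans ss).
- by apply: mPhi => //; rewrite st (le_trans s0).
- by apply: (flow_time flowP TK); rewrite ?s0.
Qed.

(** The value at tau n of the curve started at nu that is transported by the
    flow and receives the instalment (tau i.+1 - tau i) F i at each time
    tau i. *)
Fixpoint duhamel tau F (nu : M) n : M :=
  if n is i.+1 then
    cpush (Phi (tau i) (tau i.+1))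
      (cadd (duhamel tau F nu i) (cscale (tau i.+1 - tau i) (F i)))
  else nu.

Section unroll.
Context (tau : nat -> R) (F : nat -> M) (nu : M).
Hypotheses (tau0 : 0 <= tau 0%N) (tau_le : forall i, tau i <= tau i.+1).

Let tau_ge0 i : 0 <= tau i.
Proof. exact: le_trans tau0 (partition_le tau_le (leq0n i)). Qed.

Lemma duhamel_unroll n t : tau n <= t -> t <= T ->
  iota (P (tau n) t (duhamel tau F nu n)) = iota (P (tau 0%N) t nu) +
  \sum_(i < n) (tau i.+1 - tau i) *: iota (P (tau i) t (F i)).
Proof.
elim: n t => [|n ih] t nt tT; first by rewrite big_ord0 addr0.
have nt' : tau n <= t := le_trans (tau_le n) nt.
rewrite big_ord_recr/= addrA -ih// -push_cscale ?tau_ge0// -push_cadd ?tau_ge0//.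
by apply: (iota_eq iotaP); apply: push_comp; rewrite ?tau_ge0/=.
Qed.

Lemma duhamel_value n : tau n <= T ->
  iota (duhamel tau F nu n) = iota (P (tau 0%N) (tau n) nu) +
  \sum_(i < n) (tau i.+1 - tau i) *: iota (P (tau i) (tau n) (F i)).
Proof.
move=> nT; rewrite -duhamel_unroll//; apply/esym/(iota_eq iotaP)/push_id.
by rewrite tau_ge0.
Qed.

(** Unrolling the recursion avoids a compounding of the constant D by which
    one transport may enlarge the dual ball. *)
Lemma duhamel_dual_ball (lam : {sigma_finite_measure set B -> \bar R}) q D r b n :
  0 <= D -> 0 <= r -> 0 <= b ->
  (forall s t x m, 0 <= s <= t -> t <= T -> 0 <= x -> dual_ball lam q x m ->
     dual_ball lam q (D * x) (P s t m)) ->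
  dual_ball lam q r nu -> (forall i, (i < n)%N -> dual_ball lam q b (F i)) ->
  tau n <= T ->
  dual_ball lam q (D * (r + (tau n - tau 0%N) * b)) (duhamel tau F nu n).
Proof.
move=> D0 r0 b0 HD Hnu HF nT.
suff H t : tau n <= t -> t <= T ->
    dual_ball lam q (D * (r + (tau n - tau 0%N) * b)) (P (tau n) t (duhamel tau F nu n)).
  by apply: dual_ball_eq (H _ _ nT) => //; apply: push_id; rewrite tau_ge0.
elim: n HF {nT} t => [|n ih] HF t nt tT.
  by rewrite subrr mul0r addr0; apply: HD; rewrite ?tau_ge0.
have nt' : tau n <= t := le_trans (tau_le n) nt.
have dt : 0 <= tau n.+1 - tau n by rewrite subr_ge0.
have dt0 : 0 <= tau n - tau 0%N by rewrite subr_ge0 partition_le.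
have h1 := ih (fun i ni => HF i (ltnW ni)) t nt' tT.
have h2 : dual_ball lam q ((tau n.+1 - tau n) * (D * b))
    (cscale (tau n.+1 - tau n) (P (tau n) t (F n))).
  apply: dual_ball_scale dt _; apply: HD => //; first by rewrite tau_ge0.
  exact: HF.
have p1 : 0 <= D * (r + (tau n - tau 0%N) * b).
  by apply: mulr_ge0 => //; apply: addr_ge0 => //; exact: mulr_ge0.
have p2 : 0 <= (tau n.+1 - tau n) * (D * b).
  by apply: mulr_ge0 => //; exact: mulr_ge0.
have h3 := dual_ball_add p1 p2 h1 h2.
rewrite (_ : D * _ = D * (r + (tau n - tau 0%N) * b) + (tau n.+1 - tau n) * (D * b)); last ring.
apply: dual_ball_eq h3 => A mA /=; apply/esym.
rewrite push_comp ?tau_ge0/=//.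
have mt : measurable_fun [set: B] (Phi (tau n) t : B -> B) by apply: mPhi; rewrite ?tau_ge0.
by rewrite cpushE// !caddE !cscaleE !cpushE.
Qed.

End unroll.

End duhamel.

(** * Mild solutions *)

(** lra looks neither into nor for conjunctions such as a <= x <= b. *)
Ltac itv_lra := repeat match goal with
  | H : is_true (_ && _) |- _ => let h := fresh "h" in move: (H) => /andP[h {}H]
  end; try (apply/andP; split); lra.

Section mild_solution_properties.
Context (R : realType) (d : nat) (k : domain).
Local Notation Omega := (phase_space R d k).
Local Notation B := (borel R d k).
Local Notation M := (signed_measure R d k).
Context (E : completeNormedModType R) (iota : M -> E).
Hypothesis iotaP : is_FM_completion iota.
Context (v : R -> Omega -> 'rV[R]_d).
Context (Phi : R -> R -> Omega -> Omega).
Hypothesis flowP : is_flow v Phi.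
Context (T K : R).
Hypothesis TK : velocity_bound v T K.
Context (f : R -> M -> M).
Hypotheses (f1 : A1 f) (f3 : A3 f).
Context (t0 : R) (nu : M) (mu : R -> M).
Hypotheses (t00 : 0 <= t0) (t0T : t0 <= T).
Hypothesis muP : mild_solution iota Phi f t0 T nu mu.
Local Notation P s t := (cpush (Phi s t)).
Local Notation factor := (expR (K * T)).
Local Notation G s := (f s (mu s)).

Lemma mild_TV_bounded : exists2 r, 0 < r & forall t, t0 <= t <= T -> TVnorm (mu t) <= r.
Proof.
have [_ [C hC] _] := muP; exists (`|C| + 1); first by rewrite ltr_wpDl.
move=> t /hC h; apply: le_trans h _; rewrite (le_trans (ler_norm C))//; lra.
Qed.

Lemma reaction_TV_bounded : exists2 C, 0 < C & forall t, t0 <= t <= T -> TVnorm (G t) <= C.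
Proof.
have [r r0 hr] := mild_TV_bounded; have [C C0 hC] := f3 r0.
exists C => // t tT; have u0 := t00; apply: hC; [exact: hr|itv_lra].
Qed.

Lemma reaction_uniform w : 0 < w -> exists2 delta, 0 < delta &
  forall s s', t0 <= s <= T -> t0 <= s' <= T -> `|s - s'| < delta ->
    `|iota (G s) - iota (G s')| <= w.
Proof.
move=> w0; apply: segment_uniform => t tT; have u0 := t00.
have w2 : 0 < w / 2 by rewrite divr_gt0.
have t0' : 0 <= t by itv_lra.
have [d1 d10 h1] := f1 (mu t) t0' w2.
have [cont _ _] := muP; have [d2 d20 h2] := cont t tT _ d10.
exists (Num.min d1 d2) => [|s s' sT sT']; first by rewrite lt_min d10.
have H r : t0 <= r <= T -> `|r - t| < Num.min d1 d2 ->
    `|iota (G r) - iota (G t)| < w / 2.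
  move=> rT; rewrite lt_min => /andP[ra rb]; rewrite -(FMnorm_sub iotaP).
  by apply: h1 => //; [itv_lra|exact: h2].
move=> /(H _ sT) a1 /(H _ sT') a2.
have -> : iota (G s) - iota (G s') =
  (iota (G s) - iota (G t)) - (iota (G s') - iota (G t)) by rewrite opprB addrA subrK.
apply: le_trans (ler_normB _ _) _; lra.
Qed.

(** The integrand of the mild formula is uniformly continuous in s, uniformly
    in t, which makes Riemann sums converge. *)
Lemma kernel_uniform w : 0 < w -> exists2 delta, 0 < delta &
  forall s s' t, t0 <= s -> s <= s' -> s' <= t -> t <= T -> s' - s < delta ->
    `|iota (P s' t (G s')) - iota (P s t (G s))| <= w.
Proof.
move=> w0; have [C C0 hC] := reaction_TV_bounded; have u0 := t00.
have F0 : 0 < factor by exact: expR_gt0.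
have [K0 _ _] := TK.
have w1 : 0 < w / (2 * factor) by rewrite divr_gt0// mulr_gt0.
have [d1 d10 h1] := reaction_uniform w1.
pose c := d%:R * K * C; have c0 : 0 <= c by rewrite !mulr_ge0// ltW.
have c1 : 0 < c + 1 by rewrite ltr_wpDl.
exists (Num.min d1 (w / (2 * factor) / (c + 1))).
  by rewrite lt_min d10 divr_gt0.
move=> s s' t ts ss st tT; rewrite lt_min => /andP[sd1 sd2].
have h0 := push_kernel iotaP flowP TK (G s) (G s') (s := s) (s' := s') (t := t).
have {}h0 := h0 _ st tT; apply: le_trans (h0 _) _; first by itv_lra.
have a1 : `|iota (G s') - iota (G s)| <= w / (2 * factor).
  by apply: h1; [itv_lra|itv_lra|rewrite ger0_norm; lra].
have a2 : d%:R * (K * (s' - s)) * TVnorm (G s) <= w / (2 * factor).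
  apply: (@le_trans _ _ (d%:R * (K * (s' - s)) * C)).
    by apply: ler_wpM2l; [rewrite !mulr_ge0// subr_ge0|apply: hC; itv_lra].
  rewrite (_ : _ * C = (s' - s) * c); last by rewrite /c; ring.
  apply: (@le_trans _ _ ((s' - s) * (c + 1))).
    by apply: ler_wpM2l; [lra|lra].
  by rewrite -ler_pdivlMr// ltW.
have -> : w = factor * (w / (2 * factor) + w / (2 * factor)).
  by field; rewrite gt_eqF.
by rewrite ler_pM2l// lerD.
Qed.

(** The Bochner integral over [t0, t0] vanishes. *)
Lemma mild_initial : iota (mu t0) = iota nu.
Proof.
have [_ _ /(_ t0)] := muP; rewrite lexx t0T => /(_ isT)[I hI ->].
have h := @bochner_partition _ _ (fun=> t0) (fun=> lexx _) 0 _ I (fun=> 0) (fun=> 0) hI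
  (fun=> lexx 0).
have {h} : `|I| <= 0 by have := h _; rewrite !big_ord0 subr0; apply.
rewrite normr_le0 => /eqP ->.
by rewrite addr0; apply: (iota_eq iotaP); apply: (push_id flowP TK); rewrite t00.
Qed.

(** Duhamel's formula restarted at a time t1, in discrete form.  Bochner
    integrals over [t0, t] and [t0, t1] are compared with Riemann sums over
    the same fine partition of [t0, t1], the first one being continued by the
    given partition of [t1, t]; transporting the second sum to time t turns
    it into the first part of the first sum. *)
Lemma restart (tau : nat -> R) (m : nat) (w : nat -> E) (eps : nat -> R) :
  t0 <= tau 0%N -> (forall i, tau i <= tau i.+1) -> tau m <= T ->
  (forall j, 0 <= eps j) ->
  (forall j x, (j < m)%N -> tau j <= x < tau j.+1 ->
     `|iota (P x (tau m) (G x)) - w j| <= eps j) ->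
  `|iota (mu (tau m)) - iota (P (tau 0%N) (tau m) (mu (tau 0%N))) -
    \sum_(j < m) (tau j.+1 - tau j) *: w j| <= \sum_(j < m) (tau j.+1 - tau j) * eps j.
Proof.
set t1 := tau 0%N; set t := tau m => t01 tau_le tT eps0 hw; have u0 := t00.
have t1t : t1 <= t by exact: (partition_le tau_le (leq0n m)).
have F0 : 0 < factor by exact: expR_gt0.
apply/ler_addgt0Pr => e e0.
pose eta := e / ((t1 - t0 + 1) * (1 + factor)).
have D0 : 0 < (t1 - t0 + 1) * (1 + factor) by rewrite mulr_gt0; lra.
have eta0 : 0 < eta by rewrite divr_gt0.
have [delta delta0 hker] := kernel_uniform eta0.
pose N := (Num.truncn ((t1 - t0) / delta)).+1.
pose h := (t1 - t0) / N%:R; have N0 : 0 < N%:R :> R by rewrite ltr0n.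
have h0 : 0 <= h by rewrite divr_ge0; lra.
have hd : h < delta.
  by rewrite ltr_pdivrMr// mulrC -ltr_pdivrMr// truncnS_gt.
have hN : h * N%:R = t1 - t0 by rewrite /h; field; rewrite gt_eqF.
pose sg (j : nat) : R := t0 + h * j%:R.
have sg0 : sg 0%N = t0 by rewrite /sg mulr0 addr0.
have sgN : sg N = t1 by rewrite /sg hN; ring.
have sgS j : sg j.+1 - sg j = h by rewrite /sg -natr1; ring.
have sg_le j : sg j <= sg j.+1 by rewrite -subr_ge0 sgS.
have sg_lt j : (j <= N)%N -> t0 <= sg j <= t1.
  by move=> jN; rewrite -{1}sg0 -sgN !(partition_le sg_le).
pose cc (j : nat) := if (j < N)%N then sg j else tau (j - N)%N.
have cc_lo (j : nat) : (j <= N)%N -> cc j = sg j.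
  rewrite leq_eqVlt /cc => /orP[/eqP ->|->//]; by rewrite ltnn subnn sgN.
have cc_hi (j : nat) : cc (N + j)%N = tau j by rewrite /cc ltnNge leq_addr addKn.
have cc_le (j : nat) : cc j <= cc j.+1.
  have [jN|jN] := ltnP j N; first by rewrite !cc_lo// ltnW.
  by rewrite -(subnKC jN) -addnS !cc_hi.
have [_ _ mild] := muP.
have [|I hI It] := mild t; first by rewrite tT (le_trans t01).
have [|I1 hI1 It1] := mild t1; first by rewrite t01 (le_trans t1t).
pose ww (j : nat) := if (j < N)%N then iota (P (sg j) t (G (sg j))) else w (j - N)%N.
pose ee (j : nat) := if (j < N)%N then eta else eps (j - N)%N.
have ee0 (j : nat) : 0 <= ee j by rewrite /ee; case: ifP => // _; exact: ltW.
have A0 := @bochner_partition _ _ cc cc_le (N + m) (fun s => iota (P s t (G s))) I ww ee.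
rewrite cc_hi cc_lo// sg0 in A0; have {}A0 := A0 hI ee0.
have {}A0 : `|I - (\sum_(j < N) h *: iota (P (sg j) t (G (sg j))) +
      \sum_(j < m) (tau j.+1 - tau j) *: w j)| <=
    \sum_(j < N) h * eta + \sum_(j < m) (tau j.+1 - tau j) * eps j.
  have lo (i : 'I_N) : [/\ cc i.+1 - cc i = h, ww i = iota (P (sg i) t (G (sg i))) &
      ee i = eta].
    have iN := ltn_ord i.
    by rewrite (cc_lo _ iN) (cc_lo _ (ltnW iN)) sgS /ww /ee iN.
  have hi (i : 'I_m) : [/\ cc (N + i).+1 - cc (N + i)%N = tau i.+1 - tau i,
      ww (N + i)%N = w i & ee (N + i)%N = eps i].
    by rewrite -addnS !cc_hi /ww /ee ltnNge leq_addr addKn.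
  have S1 : \sum_(j < N + m) (cc j.+1 - cc j) *: ww j =
      \sum_(j < N) h *: iota (P (sg j) t (G (sg j))) +
      \sum_(j < m) (tau j.+1 - tau j) *: w j.
    rewrite big_split_ord; congr (_ + _); apply: eq_bigr => i _ /=.
      by have [-> -> _] := lo i.
    by have [-> -> _] := hi i.
  have S2 : \sum_(j < N + m) (cc j.+1 - cc j) * ee j =
      \sum_(j < N) h * eta + \sum_(j < m) (tau j.+1 - tau j) * eps j.
    rewrite big_split_ord; congr (_ + _); apply: eq_bigr => i _ /=.
      by have [-> _ ->] := lo i.
    by have [-> _ ->] := hi i.
  rewrite -S1 -S2; apply: A0.
  move=> j x jm; have [jN|jN] := ltnP j N.
    rewrite (cc_lo _ jN) (cc_lo _ (ltnW jN)) /ww /ee jN => /andP[x1 x2].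
    have := sg_lt j (ltnW jN); have := sg_lt j.+1 jN; have := sgS j => s1 /andP[s2 s3] /andP[s4 s5].
    by apply: hker => //; lra.
  move: jm; rewrite -(subnKC jN); set i := (j - N)%N; rewrite ltn_add2l => im.
  have [_ -> ->] := hi (Ordinal im); rewrite -addnS !cc_hi; exact: hw.
have A1 := @bochner_partition _ _ sg sg_le N (fun s => iota (P s t1 (G s))) I1
   (fun j => iota (P (sg j) t1 (G (sg j)))) (fun=> eta).
rewrite sgN sg0 in A1; have {}A1 := A1 hI1 (fun=> ltW eta0).
have {}A1 : `|I1 - \sum_(j < N) h *: iota (P (sg j) t1 (G (sg j)))| <= \sum_(j < N) h * eta.
  have -> : \sum_(j < N) h *: iota (P (sg j) t1 (G (sg j))) =
      \sum_(j < N) (sg j.+1 - sg j) *: iota (P (sg j) t1 (G (sg j))).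
    by apply: eq_bigr => i _; rewrite sgS.
  have -> : \sum_(j < N) h * eta = \sum_(j < N) (sg j.+1 - sg j) * eta.
    by apply: eq_bigr => i _; rewrite sgS.
  apply: A1 => j x jN /andP[x1 x2].
  have := sg_lt j (ltnW jN); have := sg_lt j.+1 jN; have := sgS j => s1 /andP[s2 s3] /andP[s4 s5].
  by apply: hker => //; lra.
pose Y := duhamel Phi sg (fun j => G (sg j)) nu N.
have Y1 : iota Y = iota (P t0 t1 nu) + \sum_(j < N) h *: iota (P (sg j) t1 (G (sg j))).
  rewrite -sgN /Y (duhamel_value iotaP flowP TK)//; last 2 first.
  - by rewrite sg0.
  - by rewrite sgN (le_trans t1t).
  by rewrite sg0; congr (_ + _); apply: eq_bigr => i _; rewrite sgS.
have Y2 : iota (P t1 t Y) = iota (P t0 t nu) + \sum_(j < N) h *: iota (P (sg j) t (G (sg j))).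
  have := duhamel_unroll iotaP flowP TK (tau := sg) (fun j => G (sg j)) nu _ sg_le (n := N) (t := t).
  rewrite sg0 sgN => -> //; congr (_ + _); by apply: eq_bigr => i _; rewrite sgS.
have sumh : \sum_(j < N) h * eta = (t1 - t0) * eta.
  by rewrite sumr_const card_ord -mulr_natr -hN; ring.
have B1 : `|iota (mu t1) - iota Y| <= (t1 - t0) * eta.
  by rewrite It1 Y1 opprD addrACA subrr add0r -sumh.
have B2 : `|iota (P t1 t (mu t1)) - iota (P t1 t Y)| <= factor * ((t1 - t0) * eta).
  apply: le_trans (push_iota_sub iotaP flowP TK _ _ _ tT) _.
    by rewrite t1t andbT (le_trans t00).
  by rewrite ler_pM2l.
have -> : iota (mu t) - iota (P t1 t (mu t1)) - \sum_(j < m) (tau j.+1 - tau j) *: w j =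
  (I - (\sum_(j < N) h *: iota (P (sg j) t (G (sg j))) +
      \sum_(j < m) (tau j.+1 - tau j) *: w j)) -
  (iota (P t1 t (mu t1)) - iota (P t1 t Y)).
  rewrite It Y2; set a := iota (P t0 t nu); set b := iota (P t1 t _).
  set x := \sum_(_ < N) _; set y := \sum_(_ < m) _.
  rewrite opprB addrA [LHS]addrAC; congr (_ - b).
  by rewrite [RHS]addrC [RHS]addrACA opprD [x + _]addrA subrr add0r.
apply: le_trans (ler_normB _ _) _; apply: le_trans (lerD A0 B2) _; rewrite sumh.
have : (t1 - t0) * eta + factor * ((t1 - t0) * eta) <= e.
  have -> : e = ((t1 - t0 + 1) * (1 + factor)) * eta by rewrite /eta; field; rewrite !gt_eqF//; lra.
  rewrite [leLHS](_ : _ = ((t1 - t0) * (1 + factor)) * eta); last ring.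
  by rewrite ler_pM2r// ler_pM2r; lra.
lra.
Qed.

End mild_solution_properties.

(** * The Euler scheme *)

Section euler_scheme.
Context (R : realType) (d : nat) (k : domain).
Local Notation Omega := (phase_space R d k).
Local Notation B := (borel R d k).
Local Notation M := (signed_measure R d k).

(** Writing S j for rho plus kappa times the right-hand side, one has
    S (j + 1) <= (1 + kappa h) S j. *)
Lemma discrete_gronwall (rho kappa h : R) (e : nat -> R) n :
  0 <= rho -> 0 <= kappa -> 0 <= h ->
  (forall j, (j <= n)%N -> e j <= \sum_(i < j) h * (rho + kappa * e i)) ->
  forall j, (j <= n)%N -> rho + kappa * e j <= rho * (1 + kappa * h) ^+ j.
Proof.
move=> rho0 k0 h0 H; pose S j := rho + kappa * \sum_(i < j) h * (rho + kappa * e i).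
have HS j : (j <= n)%N -> rho + kappa * e j <= S j.
  by move=> jn; rewrite lerD2l ler_wpM2l// H.
move=> j jn; apply: le_trans (HS j jn) _; elim: j jn => [|j ih] jn.
  by rewrite /S big_ord0 mulr0 addr0 mulr1.
have {}ih := ih (ltnW jn); have hj := HS j (ltnW jn).
rewrite exprSr mulrA; apply: (@le_trans _ _ (S j * (1 + kappa * h))).
  have -> : S j.+1 = S j + kappa * h * (rho + kappa * e j).
    by rewrite /S big_ord_recr/= mulrDr addrA mulrA.
  by rewrite [leRHS]mulrDr mulr1 lerD2l mulrC ler_wpM2r// mulr_ge0.
by rewrite ler_wpM2r// addr_ge0// mulr_ge0.
Qed.

Section euler.
Context (Phi : R -> R -> Omega -> Omega) (f : R -> M -> M).

Fixpoint euler (tau : nat -> R) (m : M) n : M :=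
  if n is i.+1 then
    cpush (Phi (tau i) (tau i.+1)) (cadd (euler tau m i)
      (cscale (tau i.+1 - tau i) (f (tau i) (euler tau m i))))
  else m.

Lemma euler_duhamel tau m n :
  euler tau m n = duhamel Phi tau (fun i => f (tau i) (euler tau m i)) m n.
Proof. by elim: n => //= n ih; rewrite -ih. Qed.

End euler.

Lemma push_pos (h : Omega -> Omega) (m : M) : measurable_fun [set: B] (h : B -> B) ->
  charge_pos m -> charge_pos (cpush h m).
Proof.
move=> mh m0 A mA; rewrite cpushE//; apply: m0.
by rewrite -[X in measurable X]setTI; exact: mh.
Qed.

(** Over a time step h with h * C <= 1 the loss h * C * m is compensated by m. *)
Lemma reaction_step_pos (m a b : M) (F : Omega -> R) h C :
  charge_pos m -> charge_pos a -> BL Num.norm F -> (supnorm Num.norm F <= C%:E)%E ->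
  (forall A, measurable A -> b A = (a A + (cintegral m A F)%:E)%E) ->
  0 <= h -> h * C <= 1 -> charge_pos (cadd m (cscale h b)).
Proof.
move=> m0 a0 FBL FC bE h0 hC A mA; rewrite caddE cscaleE bE//.
have {}FC x : `|F x| <= C.
  by rewrite -lee_fin; apply: le_trans FC; apply: ereal_sup_ubound; exists x.
have bF : bounded_measurable (F : B -> R).
  split; last by exists C.
  have [L _ [_ FL]] := BL_bounds (@normr0 R R) FBL; exact: (lipschitz_measurable FL).
have low : - C * fine (m A) <= cintegral m A F.
  rewrite -cintegral_cst//; apply: le_cintegral => // [|x _].
    exact: bounded_measurable_cst.
  by have := FC x; rewrite ler_norml => /andP[].
have mf : m A \is a fin_num by exact: fin_num_measure.
have af : a A \is a fin_num by exact: fin_num_measure.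
have p := m0 A mA; have q := a0 A mA; move: p q; rewrite -(fineK mf) -(fineK af).
rewrite !lee_fin => p q.
suff : 0 <= fine (m A) + h * (fine (a A) + cintegral m A F) by rewrite -lee_fin.
have : h * (- C * fine (m A)) <= h * cintegral m A F by rewrite ler_wpM2l.
have : (h * C) * fine (m A) <= 1 * fine (m A) by rewrite ler_wpM2r.
have : 0 <= h * fine (a A) by rewrite mulr_ge0.
lra.
Qed.

Context (E : completeNormedModType R) (iota : M -> E).
Hypothesis iotaP : is_FM_completion iota.
Context (v : R -> Omega -> 'rV[R]_d).
Context (Phi : R -> R -> Omega -> Omega).
Hypothesis flowP : is_flow v Phi.
Context (T K : R).
Hypothesis TK : velocity_bound v T K.
Context (f gain : R -> M -> M) (F : R -> M -> Omega -> R).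
Hypotheses (f1 : A1 f) (f2 : A2 f) (f3 : A3 f).
Hypothesis gain0 : forall (t : R) (m : M), 0 <= t -> charge_pos (gain t m).
Hypothesis FBL : forall (t : R) (m : M), 0 <= t -> BL Num.norm (F t m).
Hypothesis fE : forall (t : R) (m : M), 0 <= t -> forall A, measurable A ->
     f t m A = (gain t m A + (cintegral m A (F t m))%:E)%E.
Hypothesis Fbound : forall r T : R, 0 < r -> 0 < T -> exists2 C : R, 0 < C &
     forall m : M, charge_pos m -> TVnorm m <= r -> forall t : R, 0 <= t <= T ->
       (supnorm Num.norm (F t m) <= C%:E)%E.
Context (t0 : R) (nu : M) (mu : R -> M).
Hypotheses (t00 : 0 <= t0) (t0T : t0 <= T) (T0 : 0 < T).
Hypothesis nu0 : charge_pos nu.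
Hypothesis muP : mild_solution iota Phi f t0 T nu mu.
Local Notation P s t := (cpush (Phi s t)).
Local Notation factor := (expR (K * T)).
Local Notation G s := (f s (mu s)).

Let partition_order (s t1 a x b c t T' : R) : 0 <= s -> s <= t1 -> t1 <= a -> a <= x ->
  x < b -> b <= c -> c <= t -> t <= T' ->
  [/\ 0 <= a <= x, 0 <= x - a & x <= c] /\ [/\ s <= x <= T', 0 <= a <= T' & s <= a <= T'].
Proof. by move=> *; split; split => //; try (apply/andP; split); lra. Qed.

(** By restart and duhamel_value, the error e_j at the j-th step is at most the
    sum of h * (rho + kappa * e_i) over i < j, where rho, which may be any
    positive number, bounds the discretization error for small h;
    discrete_gronwall concludes.  Positivity and the error bound are proved
    together: the constants L, Cf and C are available only for measures of mass
    at most r + 1, and the flat distance to mu controls the mass of the iterates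
    because these are positive. *)
Lemma euler_close t1 t eta : t0 <= t1 -> t1 <= t -> t <= T -> 0 < eta -> eta <= 1 ->
  charge_pos (mu t1) -> exists N (tau : nat -> R),
  [/\ tau 0%N = t1, tau N = t, (forall i, tau i <= tau i.+1) &
    forall j, (j <= N)%N -> charge_pos (euler Phi f tau (mu t1) j) /\
      `|iota (mu (tau j)) - iota (euler Phi f tau (mu t1) j)| <= eta].
Proof.
move=> t01 t1t tT eta0 eta1 mu1; have u0 := t00; have T0' := T0.
have [r r0 hr] := mild_TV_bounded muP.
have r1 : 0 < r + 1 by lra.
have [L L0 hL] := f2 (ltW T0) r1.
have [Cf Cf0 hCf] := f3 r1.
have [C C0 hC] := Fbound r1 T0.
have [K0 _ _] := TK.
have F0 : 0 < factor by exact: expR_gt0.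
pose kappa := factor * L; have k0 : 0 < kappa by rewrite mulr_gt0.
have X0 : 0 < expR (kappa * T) by exact: expR_gt0.
pose rho := eta * kappa / expR (kappa * T).
have rho0 : 0 < rho by rewrite divr_gt0// mulr_gt0.
pose om := rho / (2 * factor); have om0 : 0 < om by rewrite divr_gt0// mulr_gt0.
have [delta delta0 hG] := reaction_uniform iotaP f1 t00 muP om0.
pose a1 := d%:R * K * Cf; have a10 : 0 <= a1 by rewrite !mulr_ge0// ltW.
(* The bounds on the step are, in this order, for the continuity in time of
   the reaction, for the displacement of points by the flow during one step, and
   for positivity. *)
pose h1 := Num.min delta (Num.min (om / (a1 + 1)) C^-1).
have h10 : 0 < h1 by rewrite !lt_min delta0 invr_gt0 C0 divr_gt0//; lra.
pose N := (Num.truncn ((t - t1) / h1)).+1.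
pose h := (t - t1) / N%:R; have N0 : 0 < N%:R :> R by rewrite ltr0n.
have h0 : 0 <= h by rewrite divr_ge0; lra.
have hh1 : h < h1 by rewrite ltr_pdivrMr// mulrC -ltr_pdivrMr// truncnS_gt.
have [hdelta hom hCC] : [/\ h < delta, h * a1 <= om & h * C <= 1].
  move: hh1; rewrite !lt_min => /and3P[? x2 x3]; split => //.
    apply: (@le_trans _ _ (h * (a1 + 1))); first by apply: ler_wpM2l; lra.
    by rewrite -ler_pdivlMr ?ltW//; lra.
  by rewrite -ler_pdivlMr// mul1r ltW.
have hN : h * N%:R = t - t1 by rewrite /h; field; rewrite gt_eqF.
pose tau (j : nat) : R := t1 + h * j%:R.
have tau0 : tau 0%N = t1 by rewrite /tau mulr0 addr0.
have tauN : tau N = t by rewrite /tau hN; ring.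
have tauS j : tau j.+1 - tau j = h by rewrite /tau -natr1; ring.
have tau_le j : tau j <= tau j.+1 by rewrite -subr_ge0 tauS.
have tau_lt j : (j <= N)%N -> t1 <= tau j <= t.
  by move=> jN; rewrite -{1}tau0 -tauN !(partition_le tau_le).
exists N, tau; split => //.
pose X j := euler Phi f tau (mu t1) j; pose e j := `|iota (mu (tau j)) - iota (X j)|.
suff H n j : (j < n)%N -> (j <= N)%N -> charge_pos (X j) /\ e j <= eta.
  by move=> j jN; exact: H (ltnSn j) jN.
elim: n j => // n ih j; rewrite ltnS => jn jN.
have XTV i : (i < j)%N -> TVnorm (X i) <= r + 1.
  move=> ij; have iN : (i <= N)%N := leq_trans (ltnW ij) jN.
  have [Xi ei] := ih i (leq_trans ij jn) iN.
  apply: le_trans (TVnorm_le_FM (mu (tau i)) Xi) _; apply: lerD.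
    have /andP[ti it] := tau_lt i iN; apply: hr.
    by rewrite (le_trans t01 ti) (le_trans it).
  rewrite (FMnorm_sub iotaP) distrC; exact: le_trans ei eta1.
split.
  case: j jn jN XTV => [|i] jn jN XTV; first by rewrite /X/=.
  have /andP[ti _] := tau_lt i (ltnW jN); have /andP[_ tSi] := tau_lt _ jN.
  have ti0 : 0 <= tau i := le_trans t00 (le_trans t01 ti).
  have tSiT : tau i.+1 <= T := le_trans tSi tT.
  rewrite /X/=; apply: push_pos.
    by apply: (flow_measurable flowP TK) => //; rewrite ti0 tau_le.
  have [Xi _] := ih i jn (ltnW jN).
  apply: (reaction_step_pos (a := gain (tau i) (X i)) (F := F (tau i) (X i)) (C := C)) => //.
  - exact: gain0.
  - exact: FBL.
  - by apply: hC => //; [exact: XTV|rewrite ti0 (le_trans (tau_le i))].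
  - exact: fE.
  - by rewrite subr_ge0.
  - by rewrite tauS.
have est (i : nat) : (i <= j)%N -> e i <= \sum_(l < i) h * (rho + kappa * e l).
  move=> ij; have iN : (i <= N)%N := leq_trans ij jN; have hi := tau_lt i iN.
  have iT : tau i <= T by case/andP: hi => _ /le_trans; apply.
  rewrite /e {1}/X euler_duhamel (duhamel_value iotaP flowP TK)//; last by rewrite tau0; lra.
  set w := fun l : nat => iota (P (tau l) (tau i) (f (tau l) (X l))).
  have h2 := restart iotaP flowP TK f1 f3 t00 muP (tau := tau) (m := i) (w := w)
    (eps := fun l => rho + kappa * e l).
  rewrite tau0 in h2; have {}h2 := h2 t01 tau_le iT.
  have -> : iota (P (tau 0%N) (tau i) (mu t1)) = iota (P t1 (tau i) (mu t1)) by rewrite tau0.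
  rewrite opprD addrA.
  have -> : \sum_(l < i) h * (rho + kappa * e l) =
      \sum_(l < i) (tau l.+1 - tau l) * (rho + kappa * e l).
    by apply: eq_bigr => l _; rewrite tauS.
  apply: h2 => [l|l x li /andP[x1 x2]].
    by apply: addr_ge0; [exact: ltW|apply: mulr_ge0; [exact: ltW|exact: normr_ge0]].
  have lN : (l < N)%N := leq_trans li iN.
  have /andP[tl1 _] := tau_lt l (ltnW lN); have /andP[_ it] := hi.
  have [[xl xl0 xi] [xT tl tlT]] := partition_order t00 t01 tl1 x1 x2
    (partition_le tau_le li) it tT.
  have xh : x - tau l <= h by rewrite -(tauS l) lerD2r ltW.
  have ker := push_kernel iotaP flowP TK (f (tau l) (X l)) (G x)
    (s := tau l) (s' := x) (t := tau i).
  rewrite /w; apply: le_trans (ker xl xi iT) _.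
  have b1 : `|iota (G x) - iota (G (tau l))| <= om.
    by apply: hG => //; rewrite ger0_norm// (le_lt_trans xh).
  have b2 : `|iota (G (tau l)) - iota (f (tau l) (X l))| <= L * e l.
    rewrite /e -!(FMnorm_sub iotaP); apply: hL => //; last by apply: XTV; exact: leq_trans ij.
    by rewrite (le_trans (hr _ tlT))// lerDl.
  have b3 : d%:R * (K * (x - tau l)) * TVnorm (f (tau l) (X l)) <= om.
    apply: le_trans hom; apply: (@le_trans _ _ (d%:R * (K * h) * Cf)).
      apply: ler_pM; rewrite ?TVnorm_ge0//.
      - by rewrite !mulr_ge0.
      - by do 2 apply: ler_wpM2l => //.
      - by apply: hCf; [apply: XTV; exact: leq_trans ij|case/andP: tl].
    by rewrite /a1 le_eqVlt; apply/orP; left; apply/eqP; ring.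
  have -> : rho + kappa * e l = factor * (om + L * e l + om).
    by rewrite /kappa /om; field; rewrite gt_eqF.
  rewrite ler_pM2l// lerD//.
  have -> : iota (G x) - iota (f (tau l) (X l)) =
    (iota (G x) - iota (G (tau l))) + (iota (G (tau l)) - iota (f (tau l) (X l))).
    by rewrite addrA subrK.
  by rewrite (le_trans (ler_normD _ _))// lerD.
have := discrete_gronwall (ltW rho0) (ltW k0) h0 est (leqnn j).
have step1 : (1 + kappa * h) ^+ j <= expR (kappa * T).
  apply: (@le_trans _ _ (expR (kappa * h) ^+ j)).
    apply: lerXn2r; rewrite ?nnegrE ?expR_ge0//; last exact: expR_ge1Dx.
    by apply: addr_ge0 => //; apply: mulr_ge0 => //; exact: ltW.
  rewrite -expRM_natr ler_expR -mulrA ler_pM2l//.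
  have := tau_lt j jN; rewrite /tau; itv_lra.
move=> gr; have {}gr : rho + kappa * e j <= rho * expR (kappa * T).
  by apply: le_trans gr _; rewrite ler_pM2l.
have e1 : rho * expR (kappa * T) = eta * kappa by rewrite /rho divfK// gt_eqF.
rewrite -(ler_pM2l k0) mulrC; lra.
Qed.

Lemma mild_initial_FM : FMnorm (csub nu (mu t0)) = 0.
Proof.
by rewrite (FMnorm_sub iotaP) (mild_initial iotaP flowP TK t00 t0T muP) subrr normr0.
Qed.

Lemma mild_pos t : t0 <= t <= T -> charge_pos (mu t).
Proof.
move=> /andP[t1 t2].
have mu0 : charge_pos (mu t0).
  by apply: charge_pos_closed => e e0; exists nu => //; rewrite mild_initial_FM ltW.
apply: charge_pos_closed => e e0.
have m0 : 0 < Num.min e 1 by rewrite lt_min e0/=.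
have m1 : Num.min e 1 <= 1 by rewrite ge_min lexx orbT.
have [N [tau [_ tN _ H]]] := euler_close (lexx t0) t1 t2 m0 m1 mu0.
have [H1 H2] := H N (leqnn N); exists (euler Phi f tau (mu t0) N) => //.
rewrite (FMnorm_sub iotaP) distrC -tN; apply: le_trans H2 _.
by rewrite ge_min lexx.
Qed.

End euler_scheme.

(** * Propagation of integrability *)

Section integrability.
Context (R : realType) (d : nat) (k : domain).
Local Notation Omega := (phase_space R d k).
Local Notation B := (borel R d k).
Local Notation M := (signed_measure R d k).
Context (lam : {sigma_finite_measure set B -> \bar R}).
Hypotheses (d0 : (0 < d)%N) (lamL : is_lebesgue lam).
Context (E : completeNormedModType R) (iota : M -> E).
Hypothesis iotaP : is_FM_completion iota.
Context (v : R -> Omega -> 'rV[R]_d).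
Context (Phi : R -> R -> Omega -> Omega).
Hypothesis flowP : is_flow v Phi.
Context (T K : R).
Hypothesis TK : velocity_bound v T K.
Context (f gain : R -> M -> M) (F : R -> M -> Omega -> R).
Hypotheses (f1 : A1 f) (f2 : A2 f) (f3 : A3 f).
Hypothesis gain0 : forall (t : R) (m : M), 0 <= t -> charge_pos (gain t m).
Hypothesis FBL : forall (t : R) (m : M), 0 <= t -> BL Num.norm (F t m).
Hypothesis fE : forall (t : R) (m : M), 0 <= t -> forall A, measurable A ->
     f t m A = (gain t m A + (cintegral m A (F t m))%:E)%E.
Hypothesis Fbound : forall r T : R, 0 < r -> 0 < T -> exists2 C : R, 0 < C &
     forall m : M, charge_pos m -> TVnorm m <= r -> forall t : R, 0 <= t <= T ->
       (supnorm Num.norm (F t m) <= C%:E)%E.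
Context (p : \bar R) (q : R).
Hypothesis pq : conjugate_exponents p q.
Hypothesis fLp : forall t' t r : R, 0 <= t' -> t' < t -> 0 < r -> exists2 B : R, 0 <= B &
     forall m : M, (Lpnorm lam p m <= r%:E)%E -> forall s : R, t' <= s <= t ->
       (Lpnorm lam p (f s m) <= B%:E)%E.
Context (t0 : R) (nu : M) (mu : R -> M).
Hypotheses (t00 : 0 <= t0) (t0T : t0 <= T) (T0 : 0 < T).
Hypothesis nu0 : charge_pos nu.
Hypothesis muP : mild_solution iota Phi f t0 T nu mu.
Local Notation P s t := (cpush (Phi s t)).
Local Notation factor := (expR (K * T)).

Let mild_ge0 t : t0 <= t <= T -> charge_pos (mu t).
Proof. exact: (mild_pos iotaP flowP TK f1 f2 f3 gain0 FBL fE Fbound t00 t0T T0 nu0 muP). Qed.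

Lemma mild_initial_Lp r : 0 <= r -> (Lpnorm lam p nu <= r%:E)%E ->
  (Lpnorm lam p (mu t0) <= r%:E)%E.
Proof.
move=> r0 nur; have q1 := conjugate_exponents_ge1 pq.
apply: (dual_ball_Lpnorm lamL pq r0); first by apply: mild_ge0; rewrite lexx.
apply: (dual_ball_closed q1 r0 lamL) => e e0; exists nu.
  exact: (hoelder_dual_ball r0 pq nur).
by rewrite (mild_initial_FM iotaP flowP TK t00 t0T muP) ltW.
Qed.

(** The push-forward by the flow enlarges dual balls by at most a factor D.  The
    radius r' is chosen before the bound b on the reaction in the ball of radius
    r'; during a time 1 / (b + 1) the Euler scheme started in the ball of radius r
    cannot leave that of radius r', because D * (r + b / (b + 1)) <= r'.  The time
    delta depends on t1 only through the bound r. *)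
Lemma local_Lp_bound r : 0 <= r -> exists2 delta, 0 < delta & exists r',
  forall t1 t, t0 <= t1 -> t1 <= t -> t <= T -> t - t1 <= delta ->
    (Lpnorm lam p (mu t1) <= r%:E)%E -> (Lpnorm lam p (mu t) <= r'%:E)%E.
Proof.
move=> r0; have q1 := conjugate_exponents_ge1 pq.
have F0 : 0 < factor by exact: expR_gt0.
pose C := (4 * factor * d%:R) ^+ d; pose D := C `^ q^-1.
have C0 : 0 <= C by rewrite exprn_ge0// !mulr_ge0// ltW.
have D0 : 0 <= D by exact: powR_ge0.
pose r' := D * (r + 1) + 1.
have r'0 : 0 < r' by rewrite ltr_wpDl// mulr_ge0//; lra.
have [b b0 hb] := fLp (lexx 0) T0 r'0.
have b1 : 0 < b + 1 by lra.
exists (b + 1)^-1; first by rewrite invr_gt0.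
exists r' => t1 t t01 t1t tT dt mu1; have u0 := t00.
have HD s u x m : 0 <= s <= u -> u <= T -> 0 <= x -> dual_ball lam q x m ->
    dual_ball lam q (D * x) (P s u m).
  move=> su uT x0 mx.
  have ms : measurable_fun [set: B] (Phi s u : B -> B) by exact: (flow_measurable flowP TK).
  apply: (dual_ball_push q1 x0 C0 ms) => // A mA.
  apply: (lebesgue_preimage_le d0 lamL F0 ms) => // a c.
  exact: (flow_expansive flowP TK).
have pos1 : charge_pos (mu t1) by apply: mild_ge0; rewrite t01 (le_trans t1t).
have ball1 : dual_ball lam q r (mu t1) by exact: (hoelder_dual_ball r0 pq mu1).
have ballt e : 0 < e -> exists2 m, dual_ball lam q r' m & FMnorm (csub m (mu t)) <= e.
  move=> e0; have m0 : 0 < Num.min e 1 by rewrite lt_min e0/=.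
  have m1 : Num.min e 1 <= 1 by rewrite ge_min lexx orbT.
  have [N [tau [tau0 tauN tau_le H]]] := euler_close iotaP flowP TK f1 f2 f3 gain0
    FBL fE Fbound t00 T0 muP t01 t1t tT m0 m1 pos1.
  have ball_step n j : (j < n)%N -> (j <= N)%N ->
      dual_ball lam q r' (euler Phi f tau (mu t1) j).
    elim: n j => // n ih j; rewrite ltnS => jn jN.
    have tj : tau j <= t by rewrite -tauN; exact: (partition_le tau_le jN).
    have tj0 : t1 <= tau j by rewrite -tau0; exact: (partition_le tau_le (leq0n j)).
    rewrite euler_duhamel.
    have tau00 : 0 <= tau 0%N by rewrite tau0; lra.
    have jT : tau j <= T by exact: le_trans tT.
    have reaction_ball i : (i < j)%N ->
        dual_ball lam q b (f (tau i) (euler Phi f tau (mu t1) i)).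
      move=> ij; have iN : (i <= N)%N := leq_trans (ltnW ij) jN.
      have ti : tau i <= tau j := partition_le tau_le (ltnW ij).
      have ti0 : t1 <= tau i by rewrite -tau0; exact: (partition_le tau_le (leq0n i)).
      apply: (hoelder_dual_ball b0 pq); apply: hb; last by apply/andP; split; lra.
      apply: (dual_ball_Lpnorm lamL pq (ltW r'0)); first by have [] := H i iN.
      exact: ih (leq_trans ij jn) iN.
    have h := duhamel_dual_ball flowP TK tau00 tau_le D0 r0 b0 HD ball1 reaction_ball jT.
    apply: dual_ball_le h; rewrite /r'.
    have : (tau j - tau 0%N) * b <= 1.
      apply: (@le_trans _ _ ((b + 1)^-1 * (b + 1))).
        by apply: ler_pM => //; rewrite ?tau0; lra.
      by rewrite mulVf// gt_eqF.
    move=> le1; have : D * (r + (tau j - tau 0%N) * b) <= D * (r + 1).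
      by apply: ler_wpM2l => //; lra.
    lra.
  exists (euler Phi f tau (mu t1) N); first exact: ball_step (ltnSn N) (leqnn N).
  have [_] := H N (leqnn N); rewrite tauN (FMnorm_sub iotaP) distrC => h.
  by apply: le_trans h _; rewrite ge_min lexx.
apply: (dual_ball_Lpnorm lamL pq (ltW r'0)).
  by apply: mild_ge0; rewrite tT (le_trans t01).
exact: (dual_ball_closed q1 (ltW r'0) lamL).
Qed.

End integrability.

Theorem theorem4p2 (R : realType) (d : nat) (k : domain)
    (lam : {sigma_finite_measure set (borel R d k) -> \bar R})
    (E : completeNormedModType R) (iota : signed_measure R d k -> E)
    (v : R -> phase_space R d k -> 'rV[R]_d)
    (Phi : R -> R -> phase_space R d k -> phase_space R d k)
    (f gain : R -> signed_measure R d k -> signed_measure R d k)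
    (F : R -> signed_measure R d k -> phase_space R d k -> R)
    (p : \bar R) (t0 : R) (nu : signed_measure R d k)
    (Tstar : \bar R) (mu : R -> signed_measure R d k) :
  (0 < d)%N ->
  is_lebesgue lam ->
  is_FM_completion iota ->
  V1 v -> V2 v -> V3 v ->
  is_flow v Phi ->
  A1 f -> A2 f -> A3 f ->
  (forall (t : R) (m : signed_measure R d k), 0 <= t -> charge_pos (gain t m)) ->
  (forall (t : R) (m : signed_measure R d k), 0 <= t -> BL Num.norm (F t m)) ->
  (forall (t : R) (m : signed_measure R d k), 0 <= t -> forall A, measurable A ->
     f t m A = (gain t m A + (cintegral m A (F t m))%:E)%E) ->
  (forall r T : R, 0 < r -> 0 < T -> exists2 C : R, 0 < C &
     forall m : signed_measure R d k, charge_pos m -> TVnorm m <= r -> forall t : R, 0 <= t <= T ->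
       (supnorm Num.norm (F t m) <= C%:E)%E) ->
  (1 < p)%E ->
  (forall (t : R) (m : signed_measure R d k), 0 <= t -> Lp lam p m -> Lp lam p (f t m)) ->
  (forall t' t r : R, 0 <= t' -> t' < t -> 0 < r -> exists2 B : R, 0 <= B &
     forall m : signed_measure R d k, (Lpnorm lam p m <= r%:E)%E -> forall s : R, t' <= s <= t ->
       (Lpnorm lam p (f s m) <= B%:E)%E) ->
  0 <= t0 ->
  charge_pos nu ->
  Lp_pos lam p nu ->
  maximal_mild_solution iota Phi f t0 nu Tstar mu ->
  exists That : \bar R,
    [/\ (t0%:E < That <= Tstar)%E,
        (forall t : R, t0 <= t -> (t%:E < That)%E -> Lp_pos lam p (mu t)),
        (forall T : R, t0 < T -> (T%:E < That)%E ->
           (ereal_sup [set Lpnorm lam p (mu t) | t in `[t0, T]] < +oo)%E) &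
        ((That < Tstar)%E ->
           limf_esup (fun t => Lpnorm lam p (mu t)) (fine That)^'- = +oo%E)].
Proof.
move=> d0 lamL iotaP _ v2 v3 flowP f1 f2 f3 gain0 FBL fE Fbound p1 _ fLp t00 nu0 nuLp
  [t0S muP _].
have [q pq] := conjugate_exponents_exist p1.
have beyond (x : R) : (x%:E < Tstar)%E -> exists2 y, x < y & (y%:E < Tstar)%E.
  case: (Tstar) => [s| |//]; rewrite ?lte_fin.
  + by move=> xs; exists ((x + s) / 2); rewrite ?lte_fin; lra.
  + by exists (x + 1); rewrite ?ltry//; lra.
have pos t : t0 <= t -> (t%:E < Tstar)%E -> charge_pos (mu t).
  move=> tt tS; have [T tT TS] := beyond _ tS; have T0 : 0 < T by lra.
  have t0T : t0 <= T by lra.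
  have [K TK] := velocity_bounded v2 v3 T.
  apply: (mild_pos iotaP flowP TK f1 f2 f3 gain0 FBL fE Fbound t00 t0T T0 nu0 (muP T t0T TS)).
  by rewrite tt ltW.
have local T r : t0 <= T -> 0 < T -> (T%:E < Tstar)%E -> 0 <= r ->
    exists2 delta, 0 < delta & exists r', forall t1 t, t0 <= t1 -> t1 <= t -> t <= T ->
      t - t1 <= delta ->
      (Lpnorm lam p (mu t1) <= r%:E)%E -> (Lpnorm lam p (mu t) <= r'%:E)%E.
  move=> t0T T0 TS r0; have [K TK] := velocity_bounded v2 v3 T.
  exact: (local_Lp_bound d0 lamL iotaP flowP TK f1 f2 f3 gain0 FBL fE Fbound pq fLp t00
    t0T T0 nu0 (muP T t0T TS) r0).
(* The times up to which the L^p norm remains bounded. *)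
pose good T := [/\ t0 <= T, (T%:E < Tstar)%E &
  exists C : R, forall t, t0 <= t <= T -> (Lpnorm lam p (mu t) <= C%:E)%E].
pose That := ereal_sup [set T%:E | T in good].
have That_ub T : good T -> (T%:E <= That)%E by move=> gT; apply: ereal_sup_ubound; exists T.
have That_lt t : (t%:E < That)%E -> exists2 T, good T & t < T.
  by move=> /ereal_sup_gt[_ [T gT <-]]; rewrite lte_fin => tT; exists T.
have t0That : (t0%:E < That)%E.
  have [T t0T TS] := beyond _ t0S; have T0 : 0 < T by lra.
  have [r r0 nur] : exists2 r, 0 <= r & (Lpnorm lam p nu <= r%:E)%E.
    have [] := nuLp; rewrite /Lp; case: (Lpnorm lam p nu) => [r _ _|//|_ _].
      by exists `|r|; rewrite ?lee_fin ?ler_norm.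
    by exists 0; rewrite ?leNye.
  have [K TK] := velocity_bounded v2 v3 T.
  have mu0r := mild_initial_Lp lamL iotaP flowP TK f1 f2 f3 gain0 FBL fE Fbound pq t00
    (ltW t0T) T0 nu0 (muP T (ltW t0T) TS) r0 nur.
  have [delta delta0 [r' hr']] := local T r (ltW t0T) T0 TS r0.
  pose T1 := Num.min T (t0 + delta).
  have T1T : T1 <= T by rewrite ge_min lexx.
  have T1d : T1 <= t0 + delta by rewrite ge_min lexx orbT.
  have t0T1 : t0 < T1 by rewrite lt_min t0T/=; lra.
  apply: (@lt_le_trans _ _ T1%:E); first by rewrite lte_fin.
  apply: That_ub; split; first exact: ltW.
    by apply: le_lt_trans TS; rewrite lee_fin.
  exists r' => t /andP[t0t tT1]; apply: (hr' t0) => //; lra.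
exists That; split.
- by rewrite t0That; apply: ge_ereal_sup => _ [T [_ TS _] <-]; exact: ltW.
- move=> t t0t /That_lt[T [t0T TS [C hC]] tT].
  have tS : (t%:E < Tstar)%E by apply: le_lt_trans TS; rewrite lee_fin ltW.
  have tC : (Lpnorm lam p (mu t) <= C%:E)%E by apply: hC; rewrite t0t ltW.
  split; first by rewrite /Lp (le_lt_trans tC)// ltry.
  apply: density_ae_ge0; last exact: pos.
  by move: tC; rewrite /Lpnorm; case: asboolP.
- move=> T t0T /That_lt[T' [t0T' TS' [C hC]] TT'].
  apply: (@le_lt_trans _ _ C%:E); last by rewrite ltry.
  apply: ge_ereal_sup => x [t /=]; rewrite in_itv/= => /andP[t0t tT] <-.
  by apply: hC; rewrite t0t/=; lra.
- move=> ThatS; have bE : That = (fine That)%:E.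
    by rewrite fineK// fin_real// (lt_trans _ t0That) ?ltNyr//= (lt_le_trans ThatS)// leey.
  move: ThatS t0That; rewrite {1 2}bE lte_fin; set b := fine That => bS t0b.
  apply/eqP; rewrite eq_le leey leNgt; apply/negP => /ereal_inf_lt[_ [V bV <-]] supV.
  have [C hC] : exists C : R, forall t, V t -> (Lpnorm lam p (mu t) <= C%:E)%E.
    have ub t : V t -> (Lpnorm lam p (mu t) <= ereal_sup
        [set Lpnorm lam p (mu u) | u in V])%E by move=> Vt; apply: ereal_sup_ubound; exists t.
    move: supV ub; case: (ereal_sup _) => [c _ h|//|_ h]; first by exists c.
    by exists 0 => t /h /le_trans; apply; rewrite leNye.
  have [eps eps0 Veps] : exists2 eps, 0 < eps & forall t, b - eps < t -> t < b -> V t.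
    have [e /= e0 he] := (bV : nbhs _ _).
    exists e => // t te tb; apply: he => //=; rewrite ger0_norm; lra.
  (* If the limsup is finite, the norm is at most C on the left of b; a restart
     at t1, close enough to b, bounds it beyond b, as delta depends on C only. *)
  have [T bT TS] := beyond _ bS; have T0 : 0 < T by lra.
  have r0 : 0 <= `|C| by [].
  have [delta delta0 [r' hr']] := local T _ (ltW (lt_trans t0b bT)) T0 TS r0.
  pose m := Num.min (Num.min eps delta) (b - t0).
  have m0 : 0 < m by rewrite !lt_min eps0 delta0 subr_gt0.
  have [m1 m2 m3] : [/\ m <= eps, m <= delta & m <= b - t0].
    by rewrite !ge_min !lexx ?orbT.
  pose t1 := b - m / 2.
  have [t1b t1m t01] : [/\ t1 < b, b - t1 < m & t0 < t1] by split; rewrite /t1; lra.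
  have [T' [t0T' T'S [C' hC']] t1T'] : exists2 T', good T' & t1 < T'.
    apply: That_lt; rewrite bE lte_fin; exact: t1b.
  pose T1 := Num.min T (t1 + delta).
  have T1T : T1 <= T by rewrite ge_min lexx.
  have T1d : T1 <= t1 + delta by rewrite ge_min lexx orbT.
  have bT1 : b < T1 by rewrite lt_min bT/= /t1; lra.
  suff /That_ub : good T1 by rewrite bE lee_fin leNgt bT1.
  split; first exact: ltW (lt_trans t0b bT1).
    by apply: le_lt_trans TS; rewrite lee_fin.
  exists (Num.max C' r') => t /andP[t0t tT1]; have [tt1|t1t] := leP t t1.
    rewrite (le_trans (hC' t _)) ?lee_fin ?le_max ?lexx//.
    by rewrite t0t (ltW (le_lt_trans tt1 t1T')).
  rewrite (@le_trans _ _ r'%:E)//; last by rewrite lee_fin le_max lexx orbT.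
  apply: (hr' t1 t); [exact: ltW|exact: ltW|exact: le_trans tT1 T1T| |].
    by rewrite lerBlDl (le_trans tT1).
  apply: le_trans (hC _ _) _; last by rewrite lee_fin ler_norm.
  by apply: Veps; rewrite ?t1b //; lra.
Qed.
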